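(* There exist absolute constants $\varrho_1>\varrho_2>0$ such that, along any sequence $n,d\to\infty$: (i) if $d^2\ge \varrho_1\, n\log n$ for all $n$ in the sequence, then $\mathbb P(\mathsf{PR}_n)\to 1$; (ii) if $d^2\le \varrho_2\, n\log n$ for all $n$ in the sequence, then $\mathbb P(\mathsf{PR}_n)\to 0$. Moreover, one may take any $\varrho_1>8$ and any $\varrho_2<2/\pi$.
   Context: Gaussian model: $u_1,\dots,u_n,v_1,\dots,v_n\in\mathbb R^d$ are i.i.d. $\mathcal N(0,I_d/d)$. For $W\in\mathbb R^{d\times d}$, the top-1 retrieval event is $\mathsf{PR}_n(W)=\bigcap_{i=1}^n\{u_i^\top W v_i>u_j^\top W v_i \text{ for all } j\neq i\}$, and $\mathsf{PR}_n$ is the event that there exists some $W\in\mathbb R^{d\times d}$ (allowed to depend on the whole realization of the $u_i,v_i$) such that $\mathsf{PR}_n(W)$ holds. *)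

(* Defs.v *)
From HB Require Import structures.
From mathcomp Require Import all_boot all_order all_algebra.
From mathcomp Require Import all_classical all_reals all_analysis.
Set Implicit Arguments. Unset Strict Implicit. Unset Printing Implicit Defensive.
Import Order.TTheory GRing.Theory Num.Theory.
Local Open Scope classical_set_scope.
Local Open Scope ring_scope.

Section Defs.
Variable R : realType.

Definition bil (d : nat) (x : 'rV[R]_d) (W : 'M[R]_d) (y : 'rV[R]_d) : R :=
  (x *m W *m y^T) 0 0.

Definition PRW (n d : nat) (u v : 'I_n -> 'rV[R]_d) (W : 'M[R]_d) : Prop :=
  forall i j : 'I_n, j != i -> bil (u j) W (v i) < bil (u i) W (v i).

Definition PR (n d : nat) (u v : 'I_n -> 'rV[R]_d) : Prop :=
  exists W : 'M[R]_d, PRW u v W.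

(* Expectation of F(X_1,...,X_N) for X_k i.i.d. N(0, s^2), as an iterated
   integral (equal to the product-measure integral by Tonelli for the
   nonnegative measurable integrands used below). *)
Fixpoint gauss_iter (s : R) (N : nat) (F : seq R -> \bar R) : \bar R :=
  match N with
  | 0 => F [::]
  | N'.+1 => (\int[normal_prob 0 s]_x gauss_iter s N' (fun l => F (x :: l)))%E
  end.

(* decoding of 2nd i.i.d. coordinates into u_1..u_n, v_1..v_n in R^d *)
Definition dec_u (n d : nat) (l : seq R) : 'I_n -> 'rV[R]_d :=
  fun i => \row_(a < d) nth 0 l (i * d + a)%N.
Definition dec_v (n d : nat) (l : seq R) : 'I_n -> 'rV[R]_d :=
  fun i => \row_(a < d) nth 0 l (n * d + i * d + a)%N.

(* P(PR_n) where u_i, v_i i.i.d. N(0, I_d / d): each coordinate N(0, 1/d),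
   i.e. standard deviation sqrt(1/d). *)
Definition probPR (n d : nat) : \bar R :=
  gauss_iter (Num.sqrt ((d%:R : R)^-1)) (2 * n * d)%N
    (fun l => (if `[< PR (@dec_u n d l) (@dec_v n d l) >] then 1 else 0)%:E).

Definition upper_regime (rho : R) : Prop :=
  forall nn dd : nat -> nat,
    (nn @ \oo --> \oo)%N -> (dd @ \oo --> \oo)%N ->
    (forall k, rho * (nn k)%:R * ln ((nn k)%:R) <= ((dd k)%:R) ^+ 2) ->
    (fun k => probPR (nn k) (dd k)) @ \oo --> 1%E.

Definition lower_regime (rho : R) : Prop :=
  forall nn dd : nat -> nat,
    (nn @ \oo --> \oo)%N -> (dd @ \oo --> \oo)%N ->
    (forall k, ((dd k)%:R) ^+ 2 <= rho * (nn k)%:R * ln ((nn k)%:R)) ->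
    (fun k => probPR (nn k) (dd k)) @ \oo --> 0%E.

End Defs.

(* Main.v *)
Require Import Defs.
From HB Require Import structures.
From mathcomp Require Import all_boot all_order all_algebra.
From mathcomp Require Import all_classical all_reals all_analysis.
From mathcomp Require Import measurable_realfun ring lra zify.
Import Order.TTheory GRing.Theory Num.Theory.
Import numFieldNormedType.Exports.
Set Implicit Arguments. Unset Strict Implicit. Unset Printing Implicit Defensive.
Local Open Scope classical_set_scope.
Local Open Scope ring_scope.

(** Expectations are computed by integrating out one Gaussian coordinate at a
    time; by Tonelli the coordinates may be integrated in any order, so an event
    can be bounded by freezing some coordinates and applying Chernoff to the
    others.

    If [d^2 >= rho n log n] with [rho > 8], take [W = sum_k u_k v_k^T].  Then
    [(u_i - u_j)^T W v_i] is a signal [<u_i - u_j, u_i> |v_i|^2], close to 1,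
    plus a noise that is Gaussian given [u] and [v_i], of variance about
    [2 n / d^2]; a union bound over the [n^2] pairs needs [d^2 > 8 n log n].

    If [d^2 <= rho n log n] with [rho < 2 / pi], three facts hold with high
    probability: every [x] has [max_j <u_j, x>] at least about
    [sqrt (log n / d) |x|] (the [n^O(d)] points of a fine grid only cost a factor
    [exp (O(d log n))], and [d log n] is below [n^(1/2 + c)]); every [x] has
    [sum_i |<x, v_i>|] at least about [n sqrt (2 / (pi d)) |x|]; and
    [|sum_i u_i v_i^T|_F] is at most about [sqrt n].  If [W] retrieves, then
    [sum_i u_i^T W v_i >= sqrt (log n / d) sum_i |W v_i|], the last sum is at least
    [n sqrt (2 / (pi d)) |W|_F], and the left-hand side is at most
    [|W|_F sqrt n], so that [d^2 >= (2 / pi) n log n] up to [1 + o(1)]. *)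

(** * One-dimensional Gaussian integrals *)

(** Since [W] may depend on all the data, the lower regime needs bounds that are uniform in [W]. A
    net of matrices would have about exp (d^2 log n) points, which for d^2 of order n log n is far
    more than failure probabilities of order exp (- c n) can pay for. Nets of vectors suffice,
    because [W] enters the argument only through its rows and the vectors [W v_i].

    The price is the level of the maximum. For one fixed direction, max_j <u_j, x> is about sqrt (2
    log n / d), but a union over n^O(d) directions with d near sqrt (n log n) requires a failure
    probability below exp (- n^(1/2 + c)), and this is available only up to the level sqrt (log n /
    d). The factor 2 / pi is the square of the mean of |N(0, 1)|.

    All error terms are controlled by one small parameter [e], chosen from the gap between the given
    constant and 8 or 2 / pi. *)

Section density.
Context {R : realType}.
Local Notation mu := (@lebesgue_measure R).
Import HBNNSimple.

(** The usual extension from indicators to simple functions to monotone limits. Afterwards every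
    Gaussian integral is a Lebesgue integral, where substitutions are available. *)
Lemma integral_normal_prob (m s : R) (f : measurableTypeR R -> \bar R) :
  measurable_fun [set: measurableTypeR R] f -> (forall x, 0 <= f x)%E ->
  (\int[normal_prob m s]_x f x = \int[mu]_x (f x * (normal_pdf m s x)%:E))%E.
Proof.
move=> mf f0.
have mp : measurable_fun [set: measurableTypeR R] (fun x => (normal_pdf m s x)%:E).
  by apply/measurable_EFinP; exact: measurable_normal_pdf.
have p0 x : (0 <= (normal_pdf m s x)%:E)%E by rewrite lee_fin normal_pdf_ge0.
have step_indic E : measurable E ->
  (\int[normal_prob m s]_x (\1_E x)%:E =
   \int[mu]_x ((\1_E x)%:E * (normal_pdf m s x)%:E))%E.
  move=> mE; rewrite integral_indic//= /normal_prob setIT integral_mkcond.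
  apply: eq_integral => x _; rewrite patchE indicE.
  by case: ifPn => _; rewrite ?mul1e ?mul0e.
have step_nnsfun (g : {nnsfun measurableTypeR R >-> R}) :
  (\int[normal_prob m s]_x (g x)%:E =
   \int[mu]_x ((g x)%:E * (normal_pdf m s x)%:E))%E.
  under [LHS]eq_integral do rewrite fimfunE -fsumEFin//.
  rewrite [LHS]ge0_integral_fsum//; last 2 first.
    - by move=> r; exact/measurable_EFinP/measurableT_comp.
    - by move=> n x _; rewrite EFinM nnfun_muleindic_ge0.
  under [RHS]eq_integral.
    move=> x xD; rewrite fimfunE -fsumEFin// ge0_mule_fsuml; last first.
      by move=> r; rewrite EFinM nnfun_muleindic_ge0.
    over.
  rewrite [RHS]ge0_integral_fsum//; last 2 first.
    - move=> r; apply: emeasurable_funM => //.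
      exact/measurable_EFinP/measurableT_comp.
    - move=> n x _; rewrite mule_ge0//; last by rewrite EFinM nnfun_muleindic_ge0.
  apply: eq_fsbigr => r _.
  have [r0|r0] := leP 0 r; last first.
    have -> : g @^-1` [set r] = set0 by rewrite preimage_nnfun0.
    rewrite !integral0_eq//= => x _; rewrite indic0/= mulr0 ?mul0e//.
  under [RHS]eq_integral do rewrite EFinM -muleA.
  under [LHS]eq_integral do rewrite EFinM.
  rewrite !ge0_integralZl//=; first by rewrite step_indic.
  - by apply: emeasurable_funM => //; exact/measurable_EFinP.
  - by move=> x _; rewrite mule_ge0// lee_fin.
  - exact/measurable_EFinP.
pose f_ := nnsfun_approx measurableT mf.
transitivity (lim (\int[normal_prob m s]_x (f_ n x)%:E @[n --> \oo])%E).
  rewrite -monotone_convergence//=.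
  - apply: eq_integral => ? /[!inE] xD; apply/esym/cvg_lim => //=.
    exact: cvg_nnsfun_approx.
  - by move=> n; exact/measurable_EFinP/measurable_funTS.
  - by move=> n ? _; rewrite lee_fin.
  - by move=> ? _ ? ? mn; rewrite lee_fin; exact/lefP/nd_nnsfun_approx.
rewrite [RHS](_ : _ = lim
    (\int[mu]_x ((f_ n x)%:E * (normal_pdf m s x)%:E) @[n --> \oo])%E).
  by apply: congr_lim; apply/funext => n; exact: step_nnsfun.
rewrite -monotone_convergence//=.
- apply: eq_integral => x _; apply/esym/cvg_lim => //.
  apply: cvgeZr => //; exact: cvg_nnsfun_approx.
- by move=> n; apply: emeasurable_funM => //; exact/measurable_EFinP/measurable_funTS.
- by move=> n ? _; rewrite mule_ge0// lee_fin.
- move=> x _ a b ab; rewrite lee_wpmul2r// lee_fin.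
  exact/lefP/nd_nnsfun_approx.
Qed.

(** The image of Lebesgue measure under the shift has the right value on half-open intervals, so
    uniqueness identifies it; [lebesgue_integral_scale] argues in the same way. *)
Lemma lebesgue_integral_translate (c : R) (f : measurableTypeR R -> \bar R) :
  measurable_fun [set: measurableTypeR R] f -> (forall x, 0 <= f x)%E ->
  (\int[mu]_x f (x + c)%R = \int[mu]_x f x)%E.
Proof.
move=> mf f0.
pose phi := (fun x : measurableTypeR R => (x + c) : measurableTypeR R).
have mphi : measurable_fun setT phi by exact: measurable_funD.
have := @ge0_integral_pushforward _ _ _ _ _ phi mphi mu setT f measurableT mf _.
rewrite preimage_setT => /(_ (fun x _ => f0 x)) <-.
apply: eq_measure_integral => //= A mA _.
apply/esym/lebesgue_measure_unique => //= _ [[a b]] _ <-.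
rewrite /pushforward.
have -> : phi @^-1` [set` `]a, b]] = [set` `](a - c), (b - c)]].
  by apply/seteqP; split => x; rewrite /phi /= !in_itv/= ltrBlDr lerBrDr.
by rewrite !lebesgue_measure_itv/= !lte_fin ltrD2r -!EFinB opprB addrA subrK.
Qed.

Lemma lebesgue_integral_scale (c : R) (f : measurableTypeR R -> \bar R) : 0 < c ->
  measurable_fun [set: measurableTypeR R] f -> (forall x, 0 <= f x)%E ->
  (\int[mu]_x f (c * x)%R * c%:E = \int[mu]_x f x)%E.
Proof.
move=> c0 mf f0.
pose phi := (fun x : measurableTypeR R => (c * x) : measurableTypeR R).
have mphi : measurable_fun setT phi by exact: measurable_funM.
pose pm : {measure set (measurableTypeR R) -> \bar R} := measure_function_pushforward__canonical__measure_function_Measure mu mphi.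
pose nu : {measure set (measurableTypeR R) -> \bar R} := measure_function_mscale__canonical__measure_function_Measure (NngNum (ltW c0)) pm.
have := @ge0_integral_pushforward _ _ _ _ _ phi mphi mu setT f measurableT mf _.
rewrite preimage_setT => /(_ (fun x _ => f0 x)) <-.
rewrite muleC -(@ge0_integral_mscale _ _ _ pm setT measurableT (NngNum (ltW c0)) f mf (fun x _ => f0 x)).
apply: eq_measure_integral => //= A mA _.
apply/esym.
apply: (@lebesgue_measure_unique R nu) => //= _ [[a b]] _ <-.
rewrite /nu /= /mscale /= /pushforward.
have -> : phi @^-1` [set` `]a, b]] = [set` `](a / c), (b / c)]].
  apply/seteqP; split => x; rewrite /phi /= !in_itv/=;
  by rewrite ltr_pdivrMr// ler_pdivlMr// mulrC.
rewrite !lebesgue_measure_itv/= !lte_fin ltr_pM2r ?invr_gt0//.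
case: ifPn => _; last by rewrite mule0.
by rewrite -!EFinB -EFinM -mulrBl mulrC divfK// gt_eqF.
Qed.

Lemma lebesgue_integral_opp (f : measurableTypeR R -> \bar R) :
  measurable_fun [set: measurableTypeR R] f -> (forall x, 0 <= f x)%E ->
  (\int[mu]_x f (- x)%R = \int[mu]_x f x)%E.
Proof.
move=> mf f0.
pose phi := (fun x : measurableTypeR R => (- x) : measurableTypeR R).
have mphi : measurable_fun setT phi by exact: oppr_measurable.
have := @ge0_integral_pushforward _ _ _ _ _ phi mphi mu setT f measurableT mf _.
rewrite preimage_setT => /(_ (fun x _ => f0 x)) <-.
by apply: eq_measure_integral => //= A mA _; exact: lebesgue_measureN.
Qed.

Lemma measurable_EFin_normal_pdf (m s : R) :
  measurable_fun [set: measurableTypeR R] (fun x => (normal_pdf m s x)%:E).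
Proof. by apply/measurable_EFinP; exact: measurable_normal_pdf. Qed.

Lemma sqrt2pi_gt0 : 0 < Num.sqrt (pi *+ 2) :> R.
Proof. by rewrite sqrtr_gt0 pmulrn_lgt0// pi_gt0. Qed.

Lemma normal_peakE (s : R) : 0 < s ->
  normal_peak s = (s * Num.sqrt (pi *+ 2))^-1.
Proof.
move=> s0; rewrite /normal_peak -mulrnAr sqrtrM ?sqr_ge0//.
by rewrite sqrtr_sqr gtr0_norm.
Qed.

(** Tilting a centred Gaussian of variance [s ^+ 2] by a quadratic exponent gives a Gaussian of mean
    [b * s ^+ 2 / q] and variance [s ^+ 2 / q]. *)
Let complete_square (s b q x : R) : s != 0 -> q != 0 ->
  b * x + (1 - q) / (2 * s ^+ 2) * x ^+ 2 + - (x - 0) ^+ 2 / (s ^+ 2 *+ 2) =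
  b * (b * (s * (s / (2 * q)))) +
  - (x - b * s ^+ 2 / q) ^+ 2 / (s ^+ 2 / q *+ 2).
Proof.
move=> s0 q0; rewrite -[s ^+ 2 *+ 2]mulr_natr -[s ^+ 2 / q *+ 2]mulr_natr; field.
by rewrite ?s0 ?q0.
Qed.

Let scale_exponent (s a x : R) : s != 0 -> a != 0 ->
  - (a * x - 0) ^+ 2 / ((a * s) ^+ 2 *+ 2) = - (x - 0) ^+ 2 / (s ^+ 2 *+ 2).
Proof.
move=> s0 a0; rewrite -[s ^+ 2 *+ 2]mulr_natr -[(a * s) ^+ 2 *+ 2]mulr_natr; field.
by rewrite ?s0 ?a0.
Qed.

(** The joint law of a summand [x] and the sum [z] factors into the law of [z] and the conditional
    law of [x] given [z], of mean [z * s ^+ 2 / q] and variance [s ^+ 2 * t ^+ 2 / q]. *)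
Let convolve_exponent (s t q x z : R) : s != 0 -> t != 0 -> q != 0 -> q = s ^+ 2 + t ^+ 2 ->
  - (z - x - 0) ^+ 2 / (t ^+ 2 *+ 2) + - (x - 0) ^+ 2 / (s ^+ 2 *+ 2) =
  - (z - 0) ^+ 2 / (q *+ 2) + - (x - z * s ^+ 2 / q) ^+ 2 / (s ^+ 2 * t ^+ 2 / q *+ 2).
Proof.
move=> s0 t0 q0 qE; rewrite -[t ^+ 2 *+ 2]mulr_natr -[s ^+ 2 *+ 2]mulr_natr -[q *+ 2]mulr_natr.
rewrite -[s ^+ 2 * t ^+ 2 / q *+ 2]mulr_natr qE; rewrite qE in q0.
field.
by rewrite ?s0 ?t0 ?q0.
Qed.

(** The integrand times the density is [K] times another normal density, of total mass 1; the
    hypothesis on [c] keeps its variance positive. All the exponential moments used later come from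
    this integral. *)
Lemma integral_normal_expR (s b c : R) : 0 < s -> 2 * c * s ^+ 2 < 1 ->
  (\int[normal_prob 0 s]_x (expR (b * x + c * x ^+ 2))%:E =
   ((Num.sqrt (1 - 2 * c * s ^+ 2))^-1 *
    expR (b ^+ 2 * s ^+ 2 / (2 * (1 - 2 * c * s ^+ 2))))%:E)%E.
Proof.
move=> s0 cs; set q := 1 - 2 * c * s ^+ 2.
have q0 : 0 < q by rewrite subr_gt0.
have sq0 : 0 < Num.sqrt q by rewrite sqrtr_gt0.
have sqq : Num.sqrt q ^+ 2 = q by rewrite sqr_sqrtr// ltW.
pose t := s / Num.sqrt q; pose m := b * s ^+ 2 / q.
have t0 : 0 < t by rewrite divr_gt0.
rewrite integral_normal_prob; last 2 first.
- apply/measurable_EFinP; apply: measurableT_comp => //.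
  by apply: measurable_funD => //; apply: measurable_funM => //; exact: measurable_funX.
- by move=> x; rewrite lee_fin expR_ge0.
set K := (X in _ = X%:E).
transitivity (\int[mu]_x (K%:E * (normal_pdf m t x)%:E))%E.
  apply: eq_integral => x _; rewrite -!EFinM; congr EFin.
  rewrite !normal_pdfE ?gt_eqF// /normal_fun !normal_peakE//.
  rewrite mulrCA -expRD /K [RHS]mulrCA -!mulrA -expRD [RHS]mulrA.
  congr (_ * expR _).
    rewrite /t; have := sqrt2pi_gt0; set w := Num.sqrt (pi *+ 2) => w0.
    by field; rewrite !gt_eqF.
  have -> : c = (1 - q) / (2 * s ^+ 2).
    by rewrite /q; field; rewrite gt_eqF.
  rewrite /t exprMn exprVn sqq /m; apply: complete_square; exact: lt0r_neq0.
rewrite ge0_integralZl//=.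
- by rewrite integral_normal_pdf mule1.
- exact: measurable_EFin_normal_pdf.
- by move=> x _; rewrite lee_fin normal_pdf_ge0.
- by rewrite lee_fin mulr_ge0// ?expR_ge0// invr_ge0 sqrtr_ge0.
Qed.

Lemma integral_normal_scale (s a : R) (f : measurableTypeR R -> \bar R) :
  0 < s -> 0 < a ->
  measurable_fun [set: measurableTypeR R] f -> (forall x, 0 <= f x)%E ->
  (\int[normal_prob 0 (a * s)]_x f x = \int[normal_prob 0 s]_x f (a * x)%R)%E.
Proof.
move=> s0 a0 mf f0.
have as0 : 0 < a * s by rewrite mulr_gt0.
have mfa : measurable_fun [set: measurableTypeR R] (fun x => f (a * x)%R).
  by apply: measurableT_comp => //; exact: measurable_funM.
rewrite (integral_normal_prob 0 (a * s) mf f0).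
rewrite [RHS](integral_normal_prob 0 s mfa (fun x => f0 (a * x)%R)).
rewrite -(@lebesgue_integral_scale a)//; last 2 first.
- by apply: emeasurable_funM => //; exact: measurable_EFin_normal_pdf.
- by move=> x; rewrite mule_ge0// lee_fin normal_pdf_ge0.
rewrite -ge0_integralZr//; last 3 first.
- apply: emeasurable_funM.
    by apply: measurableT_comp => //; exact: measurable_funM.
  apply: (@measurableT_comp _ _ _ _ _ _ (fun x => (normal_pdf 0 (a * s) x)%:E)).
    exact: measurable_EFin_normal_pdf.
  exact: measurable_funM.
- by move=> x _; rewrite mule_ge0// lee_fin normal_pdf_ge0.
- by rewrite lee_fin ltW.
apply: eq_integral => x _; rewrite -muleA -EFinM; congr (_ * _%:E)%E.
rewrite !normal_pdfE ?gt_eqF// /normal_fun !normal_peakE// mulrAC.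
congr (_ * expR _).
  have := sqrt2pi_gt0; set w := Num.sqrt (pi *+ 2) => w0.
  by field; rewrite !gt_eqF.
by apply: scale_exponent; exact: lt0r_neq0.
Qed.

Lemma integral_normal_opp (s : R) (f : measurableTypeR R -> \bar R) :
  0 < s -> measurable_fun [set: measurableTypeR R] f -> (forall x, 0 <= f x)%E ->
  (\int[normal_prob 0 s]_x f (- x)%R = \int[normal_prob 0 s]_x f x)%E.
Proof.
move=> s0 mf f0.
rewrite !integral_normal_prob//; last first.
  apply: measurableT_comp => //; exact: oppr_measurable.
rewrite -[RHS]lebesgue_integral_opp; last 2 first.
- by apply: emeasurable_funM => //; exact: measurable_EFin_normal_pdf.
- by move=> x; rewrite mule_ge0// lee_fin normal_pdf_ge0.
apply: eq_integral => x _; congr (_ * _%:E)%E.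
by rewrite !normal_pdfE ?gt_eqF// /normal_fun !subr0 sqrrN.
Qed.

Lemma integral_normal_norm (s a : R) (f : measurableTypeR R -> \bar R) :
  0 < s -> measurable_fun [set: measurableTypeR R] f -> (forall x, 0 <= f x)%E ->
  (\int[normal_prob 0 s]_x f (a * x)%R = \int[normal_prob 0 s]_x f (`|a| * x)%R)%E.
Proof.
move=> s0 mf f0; have [a0|a0] := ger0P a; first by [].
rewrite -[RHS]integral_normal_opp//.
- by apply: eq_integral => x _; rewrite mulrNN.
- apply: measurableT_comp => //; exact: measurable_funM.
Qed.

(** Shift the inner variable to the sum and exchange the integrals: by [convolve_exponent], the
    inner one is then that of a conditional density, equal to 1. *)
Lemma normal_convolution (s t : R) (f : measurableTypeR R -> \bar R) :
  0 < s -> 0 < t ->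
  measurable_fun [set: measurableTypeR R] f -> (forall x, 0 <= f x)%E ->
  (\int[normal_prob 0 s]_x \int[normal_prob 0 t]_z f (x + z)%R =
   \int[normal_prob 0 (Num.sqrt (s ^+ 2 + t ^+ 2))]_x f x)%E.
Proof.
move=> s0 t0 mf f0.
set r := Num.sqrt _.
have st0 : 0 < s ^+ 2 + t ^+ 2 by rewrite addr_gt0 ?exprn_gt0.
have r0 : 0 < r by rewrite sqrtr_gt0.
have r2 : r ^+ 2 = s ^+ 2 + t ^+ 2 by rewrite sqr_sqrtr// ltW.
have addm : measurable_fun [set: measurableTypeR R * measurableTypeR R]
    (fun z : measurableTypeR R * measurableTypeR R => (z.1 + z.2) : measurableTypeR R).
  by apply: measurable_funD; [exact: measurable_fst|exact: measurable_snd].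
have subm : measurable_fun [set: measurableTypeR R * measurableTypeR R]
    (fun z : measurableTypeR R * measurableTypeR R => (z.2 - z.1) : measurableTypeR R).
  by apply: measurable_funB; [exact: measurable_snd|exact: measurable_fst].
have pm u := @measurable_EFin_normal_pdf 0 u.
have p0 u v x : (0 <= (normal_pdf u v x)%:E :> \bar R)%E.
  by rewrite lee_fin normal_pdf_ge0.
transitivity (\int[mu]_x \int[mu]_z (f z * ((normal_pdf 0 t (z - x))%:E * (normal_pdf 0 s x)%:E)))%E.
  rewrite integral_normal_prob; last 2 first.
  - apply: (@measurable_fun_fubini_tonelli_F _ _ (measurableTypeR R) (measurableTypeR R) R (normal_prob 0 t) (fun z => f (z.1 + z.2)%R)) => //.
    exact: measurableT_comp.
  - by move=> x; exact: integral_ge0.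
  apply: eq_integral => x _.
  rewrite integral_normal_prob//; last first.
    by apply: measurableT_comp => //; exact: measurable_funD.
  rewrite -(@lebesgue_integral_translate (- x)); last 2 first.
  - apply: emeasurable_funM => //; apply: measurableT_comp => //.
    exact: measurable_funD.
  - by move=> y; rewrite mule_ge0.
  rewrite -ge0_integralZr//; last 2 first.
  - apply: emeasurable_funM.
      apply: measurableT_comp => //.
      by apply: measurable_funD => //; apply: measurable_funD.
    apply: (measurableT_comp (pm t)).
    exact: measurable_funD.
  - by move=> y _; rewrite mule_ge0.
  by apply: eq_integral => z _; rewrite -muleA; congr (f _ * _)%E; ring.
rewrite (@fubini_tonelli _ _ (measurableTypeR R) (measurableTypeR R) R mu mu
  (fun w => f w.2 * ((normal_pdf 0 t (w.2 - w.1))%:E * (normal_pdf 0 s w.1)%:E))%E); last 2 first.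
- apply: emeasurable_funM; first exact: measurableT_comp.
  apply: emeasurable_funM; first exact: (measurableT_comp (pm t)).
  exact: (measurableT_comp (pm s)).
- by move=> w; rewrite !mule_ge0.
rewrite integral_normal_prob//.
apply: eq_integral => z _ /=.
pose k := s * t / r; pose m := z * s ^+ 2 / r ^+ 2.
have k0 : 0 < k by rewrite divr_gt0 ?mulr_gt0.
transitivity (\int[mu]_x ((f z * (normal_pdf 0 r z)%:E) * (normal_pdf m k x)%:E))%E.
  apply: eq_integral => x _; rewrite -muleA -!EFinM; congr (_ * _%:E)%E.
  rewrite !normal_pdfE ?gt_eqF// /normal_fun !normal_peakE//.
  rewrite !mulrA [X in X * _ = _]mulrAC [X in _ = X * _]mulrAC -!mulrA -!expRD !mulrA.
  congr (_ * expR _).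
    rewrite /k; have := sqrt2pi_gt0; set w := Num.sqrt (pi *+ 2) => w0.
    by field; rewrite !gt_eqF.
  rewrite /k /m !exprMn !exprVn; apply: convolve_exponent => //; apply: lt0r_neq0 => //.
  by rewrite r2.
rewrite ge0_integralZl//=.
- by rewrite integral_normal_pdf mule1.
- exact: measurable_EFin_normal_pdf.
- by rewrite mule_ge0.
Qed.

(** Rotation invariance in the plane. [normal_convolution] asks for positive deviations, so zero
    coefficients are treated apart and signs are removed by symmetry. *)
Lemma normal_lincomb2 (s a b : R) (f : measurableTypeR R -> \bar R) : 0 < s ->
  measurable_fun [set: measurableTypeR R] f -> (forall x, 0 <= f x)%E ->
  (\int[normal_prob 0 s]_x \int[normal_prob 0 s]_z f (a * x + b * z)%R =
   \int[normal_prob 0 s]_x f (Num.sqrt (a ^+ 2 + b ^+ 2) * x)%R)%E.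
Proof.
move=> s0 mf f0.
have mfD c : measurable_fun [set: measurableTypeR R] (fun z => f (c + z)%R).
  by apply: measurableT_comp => //; exact: measurable_funD.
have mfM c : measurable_fun [set: measurableTypeR R] (fun z => f (c * z)%R).
  by apply: measurableT_comp => //; exact: measurable_funM.
have [->|b0] := eqVneq b 0.
  under eq_integral => x _.
    under eq_integral do rewrite mul0r addr0.
    rewrite integral_cst//= probability_setT mule1.
    over.
  by rewrite expr0n addr0 sqrtr_sqr integral_normal_norm.
have [->|a0] := eqVneq a 0.
  under eq_integral => x _.
    under eq_integral do rewrite mul0r add0r.
    over.
  rewrite integral_cst//= probability_setT mule1 expr0n add0r sqrtr_sqr.
  exact: integral_normal_norm.
have na0 : 0 < `|a| by rewrite normr_gt0.
have nb0 : 0 < `|b| by rewrite normr_gt0.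
pose G := fun y => (\int[normal_prob 0 (`|b| * s)]_z f (y + z)%R)%E.
have mG : measurable_fun [set: measurableTypeR R] G.
  apply: (@measurable_fun_fubini_tonelli_F _ _ (measurableTypeR R) (measurableTypeR R) R (normal_prob 0 _) (fun z => f (z.1 + z.2)%R)) => //.
  apply: measurableT_comp => //.
  by apply: measurable_funD; [exact: measurable_fst|exact: measurable_snd].
have G0 y : (0 <= G y)%E by exact: integral_ge0.
transitivity (\int[normal_prob 0 s]_x G (a * x)%R)%E.
  apply: eq_integral => x _.
  rewrite (@integral_normal_norm s b (fun z => f (a * x + z)%R) s0 (mfD _) (fun _ => f0 _)).
  by rewrite /G (@integral_normal_scale s `|b| (fun z => f (a * x + z)%R) s0 nb0 (mfD _) (fun _ => f0 _)).
rewrite (integral_normal_norm a s0 mG G0) -(integral_normal_scale s0 na0 mG G0) /G.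
have ab0 : 0 < Num.sqrt (a ^+ 2 + b ^+ 2).
  by rewrite sqrtr_gt0 addr_gt0// exprn_even_gt0.
rewrite (normal_convolution (mulr_gt0 na0 s0) (mulr_gt0 nb0 s0) mf f0).
rewrite -(integral_normal_scale s0 ab0 mf f0).
congr (\int[normal_prob 0 _]_x f x)%E.
rewrite !exprMn -mulrDl sqrtrM ?addr_ge0 ?sqr_ge0// !real_normK ?num_real//.
by rewrite sqrtr_sqr gtr0_norm.
Qed.

(** The interval [[t, t + 1]] has length 1 and the density is smallest at its right end. The loss,
    [t + 1] in place of [t], is negligible when [t] is of order sqrt (log n). *)
Lemma normal_lower_tail (t : R) : 0 <= t ->
  (normal_prob 0 1 `]-oo, t[ <= (1 - normal_peak 1 * expR (- (t + 1) ^+ 2 / 2))%:E)%E.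
Proof.
move=> t0.
have mI : measurable (`[t, t+1]%classic : set (measurableTypeR R)) by [].
have lo : ((normal_peak 1 * expR (- (t + 1) ^+ 2 / 2))%:E <= normal_prob 0 1 `[t, (t+1)%R])%E.
  rewrite /normal_prob.
  apply: (@le_trans _ _ (\int[mu]_(x in `[t, (t+1)%R]) (normal_peak 1 * expR (- (t + 1) ^+ 2 / 2))%:E)%E).
    have muI : mu `[t, (t + 1)%R] = 1%E.
      rewrite lebesgue_measure_itv/= lte_fin ltrDl ltr01.
      by rewrite -EFinB addrAC subrr add0r.
    by rewrite (integral_cst _ mI) [X in (_ * X)%E]muI mule1.
  apply: ge0_le_integral => //.
  - by move=> x _; rewrite lee_fin mulr_ge0 ?normal_peak_ge0 ?expR_ge0.
  - apply: measurable_funTS; exact: measurable_EFin_normal_pdf.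
  - move=> x /=; rewrite in_itv/= => /andP[tx xt].
    rewrite lee_fin normal_pdfE ?oner_neq0// ler_wpM2l ?normal_peak_ge0//.
    rewrite ler_expR subr0 expr1n ler_pM2r ?invr_gt0// lerN2.
    by rewrite lerXn2r// ?nnegrE ?addr_ge0// (le_trans t0).
have : (normal_prob 0 1 `]-oo, t[ + normal_prob 0 1 `[t, (t+1)%R] <= 1)%E.
  rewrite -measureU//.
  - by apply: probability_le1; exact: measurableU.
  - by apply/seteqP; split => x //=; rewrite !in_itv/= => -[xt /andP[tx _]]; move: (lt_le_trans xt tx); rewrite ltxx.
move=> le1.
have fin : (normal_prob 0 1 `]-oo, t[ \is a fin_num) by exact: fin_num_measure.
rewrite EFinB leeBrDr//.
by apply: le_trans le1; rewrite leeD2l.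
Qed.

(** The origin of the constant [2 / pi]. By evenness the integral is twice that over the half line,
    where minus the density is an antiderivative ([F] below). *)
Lemma normal_abs_moment :
  (\int[normal_prob 0 1]_x `|x|%:E = (Num.sqrt (2 / pi))%:E :> \bar R)%E.
Proof.
rewrite integral_normal_prob//; last first.
  by apply/measurable_EFinP; exact: normr_measurable.
pose p (x : R) : R := `|x| * (normal_peak 1 * expR (- (x ^+ 2 / 2))).
have pE x : p x = `|x| * normal_pdf 0 1 x.
  rewrite /p normal_pdfE ?oner_neq0// /normal_fun subr0 expr1n.
  by rewrite mulNr.
have p0 x : 0 <= p x by rewrite pE mulr_ge0// normal_pdf_ge0.
have cp : continuous p.
  move=> x; rewrite (_ : p = fun x => `|x| * normal_pdf 0 1 x); last exact/funext.
  apply: cvgM; first exact: norm_continuous.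
  by apply: continuous_normal_pdf; rewrite oner_neq0.
transitivity (\int[mu]_x (p x)%:E)%E.
  by apply: eq_integral => x _; rewrite pE EFinM.
rewrite ge0_symfun_integralT//; last by move=> x; rewrite /p/= normrN sqrrN.
pose F (x : R) := - normal_peak 1 * expR (- (x ^+ 2 / 2)).
have dF (x : R) : is_derive x 1 F (x * (normal_peak 1 * expR (- (x ^+ 2 / 2)))).
  apply: is_derive_eq.
  rewrite /GRing.scale/=; lra.
rewrite -set_itvcy (@ge0_continuous_FTC2y _ p F 0 0)//.
- rewrite /F expr0n/= mul0r oppr0 expR0 mulr1 -EFinB sub0r opprK -EFinM.
  congr EFin; rewrite normal_peakE// mul1r.
  have := @pi_gt0 R; move: (@pi R) => q q0.
  have -> : Num.sqrt (q *+ 2) = Num.sqrt q * Num.sqrt 2.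
    by rewrite -sqrtrM ?ltW// mulr_natr.
  have -> : Num.sqrt (2 / q) = Num.sqrt 2 / Num.sqrt q.
    by rewrite sqrtrM// sqrtrV// ltW.
  have : Num.sqrt q != 0 by rewrite gt_eqF// sqrtr_gt0.
  have s2 : Num.sqrt 2 ^+ 2 = 2 :> R by rewrite sqr_sqrtr.
  have : Num.sqrt 2 != 0 :> R by rewrite gt_eqF// sqrtr_gt0.
  move: s2; move: (Num.sqrt 2) (Num.sqrt q) => x y x2 x0 y0.
  by rewrite -x2; field; rewrite x0 y0.
- exact: continuous_subspaceT.
- rewrite (_ : 0 = - normal_peak 1 * 0); last by rewrite mulr0.
  apply: cvgM; first exact: cvg_cst.
  apply: (cvg_comp (fun x : R => x ^+ 2 / 2) (fun x => expR (- x))); last exact: cvgr_expR.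
  apply: gt0_cvgMly; last exact: cvgr_expr2.
  by rewrite invr_gt0.
- have : {for 0, continuous F}.
    apply/differentiable_continuous/derivable1_diffP; exact: ex_derive.
  by move=> /cvg_at_right_filter.
- move=> x; rewrite in_itv/= andbT => x0.
  rewrite derive1E derive_val /p gtr0_norm//.
Qed.

(** The first-order coefficient must be exact, the second may be crude. It comes from the pointwise
    bounds exp (- y) + y <= 1 + y^2 for y >= 0 and x^2 <= 4 exp (x^2 / 4); the last exponential has
    mean sqrt 2 <= 3 / 2, hence the factor 6. *)
Lemma normal_laplace_abs (l : R) : 0 <= l ->
  (\int[normal_prob 0 1]_x (expR (- (l * `|x|)))%:E <=
   (1 - l * Num.sqrt (2 / pi) + 6 * l ^+ 2)%:E)%E.
Proof.
move=> l0.
have mabs : measurable_fun [set: measurableTypeR R] (fun x : R => `|x|%:E).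
  by apply/measurable_EFinP; exact: normr_measurable.
have mexp : measurable_fun [set: measurableTypeR R] (fun x : R => (expR (- (l * `|x|)))%:E).
  apply/measurable_EFinP; apply: measurableT_comp => //.
  by apply: measurableT_comp => //; apply: measurable_funM => //.
have msq : measurable_fun [set: measurableTypeR R] (fun x : R => (expR (0 * x + 4^-1 * x ^+ 2))%:E).
  apply/measurable_EFinP; apply: measurableT_comp => //.
  by apply: measurable_funD => //; apply: measurable_funM => //; exact: measurable_funX.
suff H : (\int[normal_prob 0 1]_x (expR (- (l * `|x|)))%:E + l%:E * \int[normal_prob 0 1]_x `|x|%:E
   <= 1 + (4 * l ^+ 2)%:E * \int[normal_prob 0 1]_x (expR (0 * x + 4^-1 * x ^+ 2))%:E)%E.
  move: H; rewrite normal_abs_moment integral_normal_expR//; last by lra.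
  rewrite -EFinM -leeBrDr// => /le_trans; apply.
  rewrite -!EFinM -!EFinD lee_fin.
  have -> : 1 - 2 * 4^-1 * 1 ^+ 2 = 2^-1 :> R by lra.
  rewrite !expr0n /= !mul0r expR0 mulr1.
  have : (Num.sqrt 2^-1)^-1 <= 3 / 2 :> R.
    rewrite sqrtrV// invrK -[leRHS]ger0_norm; last by lra.
    by rewrite -sqrtr_sqr ler_sqrt; lra.
  set q := (_^-1); have := sqr_ge0 l; nra.
have l2 : (0 <= (4 * l ^+ 2)%:E)%E by rewrite lee_fin mulr_ge0// sqr_ge0.
have ex0 (x : R) : (0 <= (expR x)%:E)%E by rewrite lee_fin expR_ge0.
have lx0 (x : R) : (0 <= l%:E * `|x|%:E)%E by rewrite -EFinM lee_fin mulr_ge0.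
have lxm : measurable_fun [set: measurableTypeR R] (fun x : R => l%:E * `|x|%:E)%E.
  exact: emeasurable_funM.
have lem : measurable_fun [set: measurableTypeR R]
    (fun x : R => (4 * l ^+ 2)%:E * (expR (0 * x + 4^-1 * x ^+ 2))%:E)%E.
  exact: emeasurable_funM.
have le0 (x : R) : (0 <= (4 * l ^+ 2)%:E * (expR x)%:E)%E by rewrite mule_ge0.
rewrite -!ge0_integralZl// -ge0_integralD//.
have -> : (1 = \int[normal_prob 0 1]_x (cst 1 x) :> \bar R)%E.
  by rewrite integral_cst//= probability_setT mule1.
rewrite -ge0_integralD//.
apply: ge0_le_integral => //.
- by move=> x _; rewrite adde_ge0// -?EFinM lee_fin ?expR_ge0// mulr_ge0.
- by apply: emeasurable_funD => //; exact: emeasurable_funM.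
- by apply: emeasurable_funD => //; exact: emeasurable_funM.
move=> x _; rewrite -!EFinM -!EFinD lee_fin mul0r add0r.
have y0 : 0 <= l * `|x| by rewrite mulr_ge0.
have e1 : expR (- (l * `|x|)) <= 1 - l * `|x| + (l * `|x|) ^+ 2.
  rewrite expRN; have := expR_ge1Dx (l * `|x|); set y := l * _ in y0 * => ey.
  apply: (@le_trans _ _ (1 + y)^-1).
    by rewrite lef_pV2 ?posrE ?expR_gt0//; lra.
  rewrite -[leLHS]mul1r ler_pdivrMr; last by lra.
  nra.
have e2 : 4^-1 * x ^+ 2 <= expR (4^-1 * x ^+ 2).
  apply: le_trans (expR_ge1Dx _); lra.
have := sqr_ge0 l; have := sqr_ge0 x.
have : (l * `|x|) ^+ 2 = l ^+ 2 * x ^+ 2 by rewrite exprMn real_normK ?num_real.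
nra.
Qed.

End density.

(** * Integrating out coordinates *)

(* Measurability is not assumed: the retrieval event, an existential over [W],
   is only ever compared with measurable functions. *)
Lemma le_integral_ge0 d (T : measurableType d) (R : realType)
    (mu : {measure set T -> \bar R}) (f g : T -> \bar R) :
  (forall x, 0 <= f x)%E -> (forall x, f x <= g x)%E ->
  (\int[mu]_x f x <= \int[mu]_x g x)%E.
Proof.
move=> f0 fg; rewrite !ge0_integralTE//; last first.
  by move=> x; exact: le_trans (f0 x) (fg x).
apply: le_ereal_sup => _ [h hf <-]; exists h => // x.
exact: le_trans (hf x) (fg x).
Qed.

Lemma cauchy_schwarz (R : realFieldType) (A : finType) (f g : A -> R) :
  (\sum_a f a * g a) ^+ 2 <= (\sum_a f a ^+ 2) * (\sum_a g a ^+ 2).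
Proof.
set C := \sum_a _; set X := \sum_a _; set Y := \sum_a _.
have Y0 : 0 <= Y by apply: sumr_ge0 => a _; exact: sqr_ge0.
have : 0 <= \sum_a (f a * Y - g a * C) ^+ 2 by apply: sumr_ge0 => a _; exact: sqr_ge0.
have -> : \sum_a (f a * Y - g a * C) ^+ 2 = Y * (X * Y - C ^+ 2).
  transitivity (\sum_a (f a ^+ 2 * Y ^+ 2 - f a * g a * (2 * Y * C) + g a ^+ 2 * C ^+ 2)).
    by apply: eq_bigr => a _; ring.
  by rewrite big_split/= sumrB -!mulr_suml -/X -/C -/Y; ring.
move: Y0; rewrite le_eqVlt => /orP[/eqP Y0 _|Y0]; last by rewrite pmulr_rge0// subr_ge0.
have g0 a : g a = 0.
  apply/eqP; rewrite -sqrf_eq0; move/esym/eqP: Y0.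
  rewrite psumr_eq0 => [/allP/(_ a)|? _]; last exact: sqr_ge0.
  by rewrite mem_index_enum => /(_ isT).
have -> : C = 0 by rewrite /C big1// => a _; rewrite g0 mulr0.
by rewrite -Y0 mulr0 expr0n.
Qed.

(** Puts the exponential moment of a squared Gaussian into exponential form, exact to first order,
    with either sign of [q]. The chi-square bounds use [q = e / 4] with [e <= 1 / 2], hence the
    threshold 1 / 8. *)
Lemma invsqrt_le_expR (R : realType) (q : R) : q <= 8^-1 ->
  (Num.sqrt (1 - 2 * q))^-1 <= expR (q + 2 * q ^+ 2).
Proof.
move=> q8; have p0 : 0 < 1 - 2 * q by lra.
have key : 1 <= (1 - 2 * q) * expR (2 * q + (2 * q) ^+ 2).
  (* The linear lower bound of the exponential leaves [1 - 8 * q ^+ 3], good enough only for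
     [q <= 0]; for positive [q] the linear bound at half the argument is squared. *)
  have [x0|x0] := leP 0 q.
    have : (1 + (2 * q + (2 * q) ^+ 2) / 2) ^+ 2 <= expR (2 * q + (2 * q) ^+ 2).
      rewrite [in leRHS](_ : 2 * q + _ = 2%:R * ((2 * q + (2 * q) ^+ 2) / 2)); last by field.
      rewrite expRM_natl lerXn2r ?nnegrE ?expR_ge0 ?expR_ge1Dx//.
      by rewrite addr_ge0// divr_ge0// addr_ge0 ?sqr_ge0// mulr_ge0.
    move=> /(ler_wpM2l (ltW p0)); apply: le_trans.
    have : 0 <= q ^+ 2 * (1 - 6 * q - 4 * q ^+ 2 - 8 * q ^+ 3).
      by rewrite mulr_ge0 ?sqr_ge0//; nra.
    nra.
  have := expR_ge1Dx (2 * q + (2 * q) ^+ 2) => /(ler_wpM2l (ltW p0)).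
  apply: le_trans; have : 0 <= - q ^+ 3 by rewrite oppr_ge0 exprn_odd_le0// ltW.
  nra.
rewrite -(sqrtrV (ltW p0)) -[leRHS]ger0_norm ?expR_ge0// -sqrtr_sqr ler_sqrt ?sqr_ge0//.
rewrite -expRM_natl -[leLHS]mul1r ler_pdivrMr// mulrC.
by move: key; congr (_ <= _ * expR _); ring.
Qed.

(** * The product sigma-algebra on finite families of reals *)

Section cylinder.
Context (R : realType) (J : finType).

Definition cylinders : set (set (J -> R)) :=
  [set A | exists j (B : set (measurableTypeR R)),
     measurable B /\ A = (fun x : J -> R => x j) @^-1` B].

Definition cspace := g_sigma_algebraType cylinders.

Lemma measurable_coord (j : J) :
  measurable_fun [set: cspace] (fun x : cspace => (x j : measurableTypeR R)).
Proof.
move=> _ B mB; rewrite setTI; apply: sub_sigma_algebra.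
by exists j, B.
Qed.

Lemma measurable_into_cspace d (T : measurableType d) (f : T -> cspace) :
  (forall j, measurable_fun [set: T] (fun t => (f t j : measurableTypeR R))) ->
  measurable_fun [set: T] f.
Proof.
move=> mf; apply: (@measurability _ _ _ _ setT f cylinders) => //.
move=> _ [_ [j [B [mB ->]]] <-].
by have := mf j measurableT B mB.
Qed.

Definition upd (j : J) (x : cspace) (t : R) : cspace :=
  fun i => if i == j then t else x i.

Lemma updE j x t : upd j x t j = t. Proof. by rewrite /upd eqxx. Qed.

Lemma upd_neq j x t i : i != j -> upd j x t i = x i.
Proof. by rewrite /upd => /negbTE ->. Qed.

Lemma updC i j x t u : i != j -> upd i (upd j x t) u = upd j (upd i x u) t.
Proof.
move=> ij; apply/funext => k; rewrite /upd.
by have [->|//] := eqVneq k i; rewrite (negbTE ij).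
Qed.

Lemma measurable_upd d (T : measurableType d) (j : J) (f : T -> cspace)
    (g : T -> measurableTypeR R) :
  measurable_fun [set: T] f -> measurable_fun [set: T] g ->
  measurable_fun [set: T] (fun t => upd j (f t) (g t)).
Proof.
move=> mf mg; apply: measurable_into_cspace => i; rewrite /upd.
have [_|_] := eqVneq i j; first exact: mg.
exact: (measurableT_comp (measurable_coord i) mf).
Qed.

End cylinder.

(** * Gaussian integrals over chosen coordinates *)

Section marginal.
Context (R : realType) (J : finType) (s : R).
Local Notation Om := (cspace R J).
Implicit Types (F G : Om -> \bar R) (x y : Om) (l : seq J).

(** The result is again a function on the whole space, constant in the coordinate [j]. Partial
    integrals thus compose without change of type and act as conditional expectations given the
    other coordinates. *)
Definition marg1 (j : J) F x : \bar R :=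
  (\int[normal_prob 0 s]_t F (upd j x t))%E.

Definition marg l F : Om -> \bar R := foldr marg1 F l.

Definition nnmeas F := measurable_fun [set: Om] F /\ forall x, (0 <= F x)%E.

Lemma marg_cons j l F x : marg (j :: l) F x = (\int[normal_prob 0 s]_t marg l F (upd j x t))%E.
Proof. by []. Qed.

Lemma marg_cat l1 l2 F : marg (l1 ++ l2) F = marg l1 (marg l2 F).
Proof. by rewrite /marg foldr_cat. Qed.

Lemma marg_ge0 l F : (forall x, 0 <= F x)%E -> forall x, (0 <= marg l F x)%E.
Proof.
move=> F0; elim: l => [//|j l IH] x; rewrite marg_cons.
by apply: integral_ge0 => t _; exact: IH.
Qed.

Lemma nnmeas_marg1 j F : nnmeas F -> nnmeas (marg1 j F).
Proof.
move=> [mF F0]; split; last by move=> x; exact: integral_ge0.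
apply: (@measurable_fun_fubini_tonelli_F _ _ (cspace R J) (measurableTypeR R) R
  (normal_prob 0 s) (fun z => F (upd j z.1 z.2))).
  apply: (measurableT_comp mF).
  by apply: measurable_upd; [exact: measurable_fst|exact: measurable_snd].
by move=> z; exact: F0.
Qed.

Lemma nnmeas_marg l F : nnmeas F -> nnmeas (marg l F).
Proof. by move=> mF; elim: l => [//|j l IH]; exact: nnmeas_marg1. Qed.

Lemma nnmeas_upd j F x : nnmeas F ->
  measurable_fun [set: measurableTypeR R] (fun t => F (upd j x t)).
Proof.
move=> [mF _]; apply: (measurableT_comp mF).
by apply: measurable_upd => //; exact: measurable_cst.
Qed.

(** Integration over [l] leaves the coordinates outside [l] at their values in [x], so the
    comparison is only asked for configurations that agree with [x] there. This is how conditioning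
    on frozen coordinates is expressed. *)
Lemma marg_le_at l F G x : (forall y, 0 <= F y)%E ->
  (forall y, (forall i, i \notin l -> y i = x i) -> F y <= G y)%E ->
  (marg l F x <= marg l G x)%E.
Proof.
move=> F0; elim: l x => [|j l IH] x FG; first exact: FG.
rewrite !marg_cons; apply: le_integral_ge0 => t; first exact: marg_ge0.
apply: IH => y yx; apply: FG => i; rewrite inE negb_or => /andP[ij il].
by rewrite yx// upd_neq.
Qed.

Lemma marg_eq_at l F G x :
  (forall y, (forall i, i \notin l -> y i = x i) -> F y = G y) ->
  marg l F x = marg l G x.
Proof.
elim: l x => [|j l IH] x FG; first exact: FG.
rewrite !marg_cons; apply: eq_integral => t _.
apply: IH => y yx; apply: FG => i; rewrite inE negb_or => /andP[ij il].
by rewrite yx// upd_neq.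
Qed.

Lemma marg_cst l (c : \bar R) x : marg l (fun=> c) x = c.
Proof.
elim: l x => [//|j l IH] x; rewrite marg_cons.
under eq_integral do rewrite IH.
by rewrite integral_cst//= probability_setT mule1.
Qed.

Lemma margD l F G x : nnmeas F -> nnmeas G ->
  marg l (fun y => F y + G y)%E x = (marg l F x + marg l G x)%E.
Proof.
move=> mF mG; elim: l x => [//|j l IH] x; rewrite !marg_cons.
under eq_integral do rewrite IH.
have [? ?] := nnmeas_marg l mF; have [? ?] := nnmeas_marg l mG.
by rewrite ge0_integralD//; exact: nnmeas_upd (nnmeas_marg l _).
Qed.

Lemma margZ l (c : R) F x : 0 <= c -> nnmeas F ->
  marg l (fun y => c%:E * F y)%E x = (c%:E * marg l F x)%E.
Proof.
move=> c0 mF; elim: l x => [//|j l IH] x; rewrite !marg_cons.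
under eq_integral do rewrite IH.
have [? ?] := nnmeas_marg l mF.
by rewrite ge0_integralZl//; exact: nnmeas_upd (nnmeas_marg l _).
Qed.

Lemma nnmeas_cst (c : \bar R) : (0 <= c)%E -> nnmeas (fun=> c).
Proof. by move=> c0; split => //; exact: measurable_cst. Qed.

Lemma nnmeas_sum (I : Type) (r : seq I) (F : I -> Om -> \bar R) :
  (forall i, nnmeas (F i)) -> nnmeas (fun y => \sum_(i <- r) F i y)%E.
Proof.
move=> mF; split; first by apply: emeasurable_sum => i; exact: (mF i).1.
by move=> x; apply: sume_ge0 => i _; exact: (mF i).2.
Qed.

Lemma marg_sum l (I : Type) (r : seq I) (F : I -> Om -> \bar R) x :
  (forall i, nnmeas (F i)) ->
  marg l (fun y => \sum_(i <- r) F i y)%E x = (\sum_(i <- r) marg l (F i) x)%E.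
Proof.
move=> mF; elim: r => [|i r IH].
  rewrite big_nil -[RHS](marg_cst l 0%E x); apply: marg_eq_at => y _.
  by rewrite big_nil.
rewrite big_cons -IH -margD//; last exact: nnmeas_sum.
by apply: marg_eq_at => y _; rewrite big_cons.
Qed.

Lemma marg1C i j F : nnmeas F -> marg1 i (marg1 j F) = marg1 j (marg1 i F).
Proof.
move=> mF; have [->//|ij] := eqVneq i j; apply/funext => x; rewrite /marg1.
transitivity (\int[normal_prob 0 s]_t \int[normal_prob 0 s]_u F (upd i (upd j x u) t))%E.
  by apply: eq_integral => t _; apply: eq_integral => u _; rewrite updC// eq_sym.
apply: (@fubini_tonelli _ _ (measurableTypeR R) (measurableTypeR R) R
  (normal_prob 0 s) (normal_prob 0 s) (fun z => F (upd i (upd j x z.2) z.1))).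
  apply: (measurableT_comp mF.1); apply: measurable_upd; last exact: measurable_fst.
  by apply: measurable_upd; [exact: measurable_cst|exact: measurable_snd].
by move=> z; exact: mF.2.
Qed.

Lemma marg1_marg j l F : nnmeas F -> marg1 j (marg l F) = marg l (marg1 j F).
Proof.
move=> mF; elim: l => [//|i l IH] /=.
by rewrite marg1C; [rewrite IH|exact: nnmeas_marg].
Qed.

Lemma margC l1 l2 F : nnmeas F -> marg l1 (marg l2 F) = marg l2 (marg l1 F).
Proof.
move=> mF; elim: l1 => [//|i l IH] /=.
by rewrite IH marg1_marg//; exact: nnmeas_marg.
Qed.

Lemma marg_perm l1 l2 F : nnmeas F -> perm_eq l1 l2 -> marg l1 F = marg l2 F.
Proof.
move=> mF p; apply: (@catCA_perm_ind _ (fun l => marg l1 F = marg l F) _ l1 l2 p erefl).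
move=> s1 s2 s3 ->; rewrite !marg_cat; apply: margC; exact: nnmeas_marg.
Qed.

(** The induction carries a prefix [p] of coordinates already drawn, whose values are stored in the
    configuration; uniqueness protects them from later updates. *)
Lemma gauss_iter_marg (F : seq R -> \bar R) l x : uniq l ->
  gauss_iter s (size l) F = marg l (fun y => F (map y l)) x.
Proof.
suff H p : uniq (p ++ l) ->
    gauss_iter s (size l) (fun m => F (map x p ++ m)) =
    marg l (fun y => F (map y (p ++ l))) x by exact: (H [::]).
elim: l p x => [|j l IH] p x; first by rewrite /= !cats0.
rewrite -cat_rcons => u; rewrite marg_cons /=.
apply: eq_integral => t _; rewrite -IH//.
congr gauss_iter; apply/funext => m.
rewrite map_rcons updE cat_rcons; congr (F (_ ++ _)).
apply/eq_in_map => i ip; rewrite upd_neq//.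
move: u; rewrite cat_uniq rcons_uniq => /andP[/andP[jp _] _].
by apply: contraNneq jp => <-.
Qed.

(** A linear form in independent centred Gaussians is one Gaussian scaled by the Euclidean norm of
    the coefficients. The shift [b] absorbs the first coordinate while the others are merged by
    induction, and [normal_lincomb2] joins the two. *)
Lemma marg_linear_form l (c : J -> R) (b : R) (f : measurableTypeR R -> \bar R) x :
  0 < s -> uniq l ->
  measurable_fun [set: measurableTypeR R] f -> (forall t, 0 <= f t)%E ->
  marg l (fun y => f (b + \sum_(j <- l) c j * y j)) x =
  (\int[normal_prob 0 s]_t f (b + Num.sqrt (\sum_(j <- l) c j ^+ 2) * t)%R)%E.
Proof.
move=> s0 + mf f0; elim: l b x => [|j l IH] b x /=.
  move=> _; under eq_integral do rewrite big_nil sqrtr0 mul0r addr0.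
  by rewrite integral_cst//= probability_setT mule1 big_nil addr0.
move=> /andP[jl ul]; rewrite -[marg1 _ _]/(marg (j :: l) _) marg_cons.
have mfb : measurable_fun [set: measurableTypeR R] (fun t => f (b + t)).
  by apply: measurableT_comp => //; exact: measurable_funD.
have S0 : 0 <= \sum_(j <- l) c j ^+ 2 by apply: sumr_ge0 => i _; exact: sqr_ge0.
under [RHS]eq_integral do rewrite big_cons -{1}(sqr_sqrtr S0).
rewrite -(@normal_lincomb2 _ s (c j) (Num.sqrt (\sum_(j <- l) c j ^+ 2)) (fun t => f (b + t)))//.
apply: eq_integral => t _.
transitivity (marg l (fun y => f (b + c j * t + \sum_(j <- l) c j * y j)) (upd j x t)).
  apply: marg_eq_at => y yx; rewrite big_cons addrA.
  by rewrite (yx j jl) updE.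
by rewrite IH//; apply: eq_integral => u _; rewrite addrA.
Qed.

Lemma perm_enum_split (l : seq J) : uniq l ->
  perm_eq (enum J) ([seq j <- enum J | j \notin l] ++ l).
Proof.
move=> ul; apply: uniq_perm; first exact: enum_uniq.
  rewrite cat_uniq filter_uniq ?enum_uniq// ul andbT /=.
  by apply/hasPn => j jl; rewrite mem_filter jl.
by move=> j; rewrite mem_cat mem_filter mem_enum /= andbT; case: (j \in l).
Qed.

Lemma marg_bound l F (c : \bar R) x : nnmeas F -> uniq l ->
  (forall y, marg l F y <= c)%E -> (marg (enum J) F x <= c)%E.
Proof.
move=> mF ul H; rewrite (marg_perm mF (perm_enum_split ul)) marg_cat.
rewrite -[leRHS](marg_cst [seq j <- enum J | j \notin l] c x).
by apply: marg_le_at => //; exact: marg_ge0 mF.2.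
Qed.

(** Product rule for conditionally independent factors: [f i] may depend on its own block and on
    coordinates outside all the blocks, but not on the block of another index. *)
Lemma marg_prod (I : eqType) (r : seq I) (B : I -> seq J) (f : I -> Om -> R)
    (c : I -> R) x :
  uniq r ->
  (forall i, nnmeas (fun y => (f i y)%:E)) -> (forall i, 0 <= c i) ->
  (forall i, i \in r -> forall y y' : Om,
     (forall j, (forall k, k \in r -> k != i -> j \notin B k) -> y j = y' j) ->
     f i y = f i y') ->
  (forall i y, i \in r -> (marg (B i) (fun y => (f i y)%:E) y <= (c i)%:E)%E) ->
  (marg (flatten [seq B i | i <- r]) (fun y => (\prod_(i <- r) f i y)%:E) x
   <= (\prod_(i <- r) c i)%:E)%E.
Proof.
move=> + mf c0; have f0 i y : 0 <= f i y by rewrite -lee_fin; exact: (mf i).2.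
elim: r x => [|i r IH] x; first by move=> _ _ _ /=; rewrite !big_nil.
move=> /= /andP[ir ur] indep bnd; rewrite marg_cat big_cons.
have P0 : 0 <= \prod_(i <- r) c i by apply: prodr_ge0.
have mP : nnmeas (fun y => (\prod_(i <- r) f i y)%:E).
  split; last by move=> y; rewrite lee_fin; apply: prodr_ge0.
  apply/measurable_EFinP; apply: measurable_prod => k _.
  by apply/measurable_EFinP; exact: (mf k).1.
apply: (@le_trans _ _ (marg (B i) (fun y => (\prod_(i <- r) c i)%:E * (f i y)%:E)%E x)).
  apply: marg_le_at.
    by apply: marg_ge0 => y; rewrite lee_fin; apply: prodr_ge0.
  move=> y _; set fl := flatten _.
  rewrite (@marg_eq_at fl _ (fun z => (f i y)%:E * (\prod_(i <- r) f i z)%:E)%E).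
    rewrite margZ// muleC lee_wpmul2r ?lee_fin//.
    apply: IH => //.
      move=> k kr z z' zz; apply: indep; first by rewrite inE kr orbT.
      move=> j hj; apply: zz => k' k'r k'k; apply: hj => //.
      by rewrite inE k'r orbT.
    by move=> k z kr; apply: bnd; rewrite inE kr orbT.
  move=> z zy; rewrite big_cons EFinM; congr (_%:E * _)%E.
  apply: indep; first by rewrite inE eqxx.
  move=> j hj; apply: zy; apply/negP => /flatten_mapP[k kr jk].
  have : j \notin B k.
    apply: hj; first by rewrite inE kr orbT.
    by apply: contraNneq ir => <-.
  by rewrite jk.
rewrite margZ// EFinM muleC lee_wpmul2r ?lee_fin//.
by apply: bnd; rewrite inE eqxx.
Qed.

Lemma measurable_coordR (j : J) : measurable_fun [set: Om] (fun y : Om => (y j : R)).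
Proof. exact: measurable_coord. Qed.

Lemma nnmeas_EFin (g : Om -> R) : measurable_fun [set: Om] g ->
  (forall y, 0 <= g y) -> nnmeas (fun y => (g y)%:E).
Proof.
by move=> mg g0; split; [exact/measurable_EFinP|move=> y; rewrite lee_fin].
Qed.

Lemma nnmeas_expR (g : Om -> R) : measurable_fun [set: Om] g ->
  nnmeas (fun y => (expR (g y))%:E).
Proof.
move=> mg; apply: nnmeas_EFin; last by move=> y; exact: expR_ge0.
exact: measurableT_comp.
Qed.

Lemma measurable_bool_nat (b : Om -> bool) : measurable_fun [set: Om] b ->
  measurable_fun [set: Om] (fun y => (b y)%:R : R).
Proof.
move=> mb; rewrite (_ : (fun _ => _) = fun y => if b y then 1 else 0); last first.
  by apply/funext => y; case: (b y).
by apply: measurable_fun_ifT => //; exact: measurable_cst.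
Qed.

Lemma nnmeas_bool (b : Om -> bool) : measurable_fun [set: Om] b ->
  nnmeas (fun y => ((b y)%:R)%:E).
Proof.
by move=> mb; apply: nnmeas_EFin => [|y]; [exact: measurable_bool_nat|exact: ler0n].
Qed.

Lemma measurable_lin (l : seq J) (c : J -> R) :
  measurable_fun [set: Om] (fun y : Om => \sum_(j <- l) c j * y j).
Proof.
by apply: measurable_sum => j; apply: measurable_funM => //; exact: measurable_coordR.
Qed.

Hypothesis s0 : 0 < s.

Lemma marg_exp_linear l (c : J -> R) (t : R) x : uniq l ->
  marg l (fun y => (expR (t * \sum_(j <- l) c j * y j))%:E) x =
  (expR (t ^+ 2 * s ^+ 2 * (\sum_(j <- l) c j ^+ 2) / 2))%:E.
Proof.
move=> ul; pose f (z : measurableTypeR R) := (expR (t * z))%:E.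
have S0 : 0 <= \sum_(j <- l) c j ^+ 2 by apply: sumr_ge0 => i _; exact: sqr_ge0.
transitivity (marg l (fun y => f (0 + \sum_(j <- l) c j * y j)) x).
  by apply: marg_eq_at => y _; rewrite /f add0r.
rewrite marg_linear_form//; last 2 first.
- apply/measurable_EFinP; apply: measurableT_comp => //; exact: measurable_funM.
- by move=> z; rewrite lee_fin expR_ge0.
rewrite /f.
under eq_integral => z _ do
  rewrite add0r mulrA -[_ * z]addr0 -[X in _ + X](mul0r (z ^+ 2)).
rewrite integral_normal_expR//; last by rewrite mulr0 mul0r.
rewrite mulr0 mul0r subr0 sqrtr1 invr1 mul1r mulr1 exprMn sqr_sqrtr//.
by congr (expR _)%:E; ring.
Qed.

Lemma marg_exp_square l (c : J -> R) (t : R) x : uniq l ->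
  2 * t * s ^+ 2 * (\sum_(j <- l) c j ^+ 2) < 1 ->
  marg l (fun y => (expR (t * (\sum_(j <- l) c j * y j) ^+ 2))%:E) x =
  ((Num.sqrt (1 - 2 * t * s ^+ 2 * (\sum_(j <- l) c j ^+ 2)))^-1)%:E.
Proof.
move=> ul lt1; pose f (z : measurableTypeR R) := (expR (t * z ^+ 2))%:E.
have S0 : 0 <= \sum_(j <- l) c j ^+ 2 by apply: sumr_ge0 => i _; exact: sqr_ge0.
transitivity (marg l (fun y => f (0 + \sum_(j <- l) c j * y j)) x).
  by apply: marg_eq_at => y _; rewrite /f add0r.
rewrite marg_linear_form//; last 2 first.
- apply/measurable_EFinP; apply: measurableT_comp => //.
  by apply: measurable_funM => //; exact: measurable_funX.
- by move=> z; rewrite lee_fin expR_ge0.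
rewrite /f.
under eq_integral => z _ do
  rewrite add0r exprMn sqr_sqrtr// mulrA -[X in expR X]add0r -[X in X + _](mul0r z).
rewrite integral_normal_expR//; last by move: lt1; congr (_ < _); ring.
rewrite expr0n/= !mul0r expR0 mulr1; congr ((Num.sqrt _)^-1)%:E; ring.
Qed.

Lemma marg_laplace_abs l (c : J -> R) (t : R) x : uniq l -> 0 <= t ->
  (marg l (fun y => (expR (- (t * `|\sum_(j <- l) c j * y j|)))%:E) x <=
   (1 - t * (s * Num.sqrt (\sum_(j <- l) c j ^+ 2)) * Num.sqrt (2 / pi) +
    6 * (t * (s * Num.sqrt (\sum_(j <- l) c j ^+ 2))) ^+ 2)%:E)%E.
Proof.
move=> ul t0; pose f (z : measurableTypeR R) := (expR (- (t * `|z|)))%:E.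
set q := Num.sqrt _.
have q0 : 0 <= q by exact: sqrtr_ge0.
have mf : measurable_fun [set: measurableTypeR R] f.
  apply/measurable_EFinP; apply: measurableT_comp => //.
  by apply: measurableT_comp => //; apply: measurable_funM.
have f0 z : (0 <= f z)%E by rewrite lee_fin expR_ge0.
have -> : marg l (fun y => (expR (- (t * `|\sum_(j <- l) c j * y j|)))%:E) x =
  marg l (fun y => f (0 + \sum_(j <- l) c j * y j)) x.
  by apply: marg_eq_at => y _; rewrite /f add0r.
rewrite marg_linear_form// -/q.
have mfq : measurable_fun [set: measurableTypeR R] (fun z => f (0 + q * z)).
  apply: measurableT_comp => //; apply: measurable_funD => //; exact: measurable_funM.
rewrite -{1}[s]mulr1 (@integral_normal_scale R 1 s (fun z => f (0 + q * z)))//.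
apply: le_trans (@normal_laplace_abs R (t * (s * q)) _); last first.
  by rewrite !mulr_ge0// ltW.
rewrite le_eqVlt; apply/orP; left; apply/eqP; apply: eq_integral => z _.
rewrite /f add0r !normrM (ger0_norm q0) (gtr0_norm s0); congr (expR (- _))%:E.
ring.
Qed.

Lemma marg_lower_tail l (c : J -> R) (t : R) x : uniq l -> 0 <= t ->
  0 < \sum_(j <- l) c j ^+ 2 ->
  (marg l (fun y => ((\sum_(j <- l) c j * y j <
       t * (s * Num.sqrt (\sum_(j <- l) c j ^+ 2)))%R%:R)%:E) x <=
   (1 - normal_peak 1 * expR (- (t + 1) ^+ 2 / 2))%:E)%E.
Proof.
move=> ul t0; rewrite -sqrtr_gt0; set q := Num.sqrt _ => q0.
pose f (z : measurableTypeR R) : \bar R := ((z < t * (s * q))%R%:R)%:E.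
have mf : measurable_fun [set: measurableTypeR R] f.
  rewrite (_ : f = (fun z => (\1_(`]-oo, (t * (s * q))[) z)%:E)).
    by apply/measurable_EFinP; exact: measurable_indic.
  apply/funext => z; rewrite /f indicE; congr (_%:R)%:E.
  by congr nat_of_bool; apply/idP/idP; rewrite inE/= in_itv.
have f0 z : (0 <= f z)%E by rewrite lee_fin ler0n.
have -> : marg l (fun y => ((\sum_(j <- l) c j * y j < t * (s * q))%R%:R)%:E) x =
  marg l (fun y => f (0 + \sum_(j <- l) c j * y j)) x.
  by apply: marg_eq_at => y _; rewrite /f add0r.
rewrite marg_linear_form// -/q.
have mfq : measurable_fun [set: measurableTypeR R] (fun z => f (0 + q * z)).
  apply: measurableT_comp => //; apply: measurable_funD => //; exact: measurable_funM.
rewrite -{1}[s]mulr1 (@integral_normal_scale R 1 s (fun z => f (0 + q * z)))//.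
apply: le_trans (@normal_lower_tail R t t0).
have -> : normal_prob 0 1 `]-oo, t[ =
    (\int[normal_prob 0 1]_z (\1_(`]-oo, t[%classic : set (measurableTypeR R)) z)%:E)%E.
  by rewrite integral_indic// setIT.
rewrite le_eqVlt; apply/orP; left; apply/eqP; apply: eq_integral => z _.
rewrite /f add0r indicE; congr (_%:R)%:E.
congr nat_of_bool; rewrite [X in X < _](_ : _ = z * (s * q)); last by ring.
rewrite ltr_pM2r ?mulr_gt0//.
by apply/idP/idP; rewrite inE/= in_itv.
Qed.

(** [marg_prod] with blocks of one coordinate. Negative [t] is allowed and serves the lower tail. *)
Lemma marg_exp_chisq l (t : R) x : uniq l -> t * s ^+ 2 <= 8^-1 ->
  (marg l (fun y => (expR (t * \sum_(j <- l) y j ^+ 2))%:E) x <=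
   (expR ((size l)%:R * (t * s ^+ 2 + 2 * (t * s ^+ 2) ^+ 2)))%:E)%E.
Proof.
move=> ul ts.
set e := expR (t * s ^+ 2 + 2 * (t * s ^+ 2) ^+ 2).
have := @marg_prod J l (fun j => [:: j]) (fun j y => expR (t * y j ^+ 2))
  (fun _ => e) x ul.
have -> : flatten [seq [:: i] | i <- l] = l by elim: (l) => //= j l' ->.
rewrite big_const_seq count_predT iter_mulr_1 /e -expRM_natl => H.
rewrite (@marg_eq_at l _ (fun y => (\prod_(i <- l) expR (t * y i ^+ 2))%:E)); last first.
  move=> y _; rewrite mulr_sumr; congr EFin.
  by rewrite (big_morph _ (@expRD R) (@expR0 R)).
apply: H.
- move=> i; apply: nnmeas_expR; apply: measurable_funM => //.
  by apply: measurable_funX; exact: measurable_coordR.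
- by move=> _; exact: expR_ge0.
- move=> i il y y' H; congr (expR (_ * _ ^+ 2)); apply: H => k _.
  by rewrite inE eq_sym.
- move=> i y _.
  have := @marg_exp_square [:: i] (fun _ => 1) t y isT.
  rewrite !big_seq1 expr1n mulr1 => E.
  rewrite (@marg_eq_at _ _ (fun y => (expR (t * (\sum_(j <- [:: i]) 1 * y j) ^+ 2))%:E)); last first.
    by move=> z _; rewrite big_seq1 mul1r.
  rewrite E; last by rewrite -mulrA; lra.
  by rewrite lee_fin -mulrA; exact: invsqrt_le_expR.
Qed.

Lemma marg_exp_square_le l (c : J -> R) (t q : R) x : uniq l -> 0 <= t ->
  t * s ^+ 2 * (\sum_(j <- l) c j ^+ 2) <= q -> q <= 8^-1 ->
  (marg l (fun y => (expR (t * (\sum_(j <- l) c j * y j) ^+ 2))%:E) x <=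
   (expR (q + 2 * q ^+ 2))%:E)%E.
Proof.
move=> ul t0 tq q8.
set q' := t * _ * _ in tq.
have q'0 : 0 <= q'.
  rewrite /q' mulr_ge0//; first by rewrite mulr_ge0// sqr_ge0.
  by apply: sumr_ge0 => j _; exact: sqr_ge0.
have E : 2 * t * s ^+ 2 * \sum_(j <- l) c j ^+ 2 = 2 * q' by rewrite /q' !mulrA.
rewrite marg_exp_square// E; last by lra.
rewrite lee_fin; apply: le_trans (invsqrt_le_expR _) _; first by lra.
rewrite ler_expR; nra.
Qed.

Lemma marg_exp_linear_le l (c : J -> R) (t S : R) x : uniq l ->
  \sum_(j <- l) c j ^+ 2 <= S ->
  (marg l (fun y => (expR (t * \sum_(j <- l) c j * y j))%:E) x <=
   (expR (t ^+ 2 * s ^+ 2 * S / 2))%:E)%E.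
Proof.
move=> ul cS; rewrite marg_exp_linear// lee_fin ler_expR ler_pM2r ?invr_gt0//.
by rewrite ler_wpM2l// mulr_ge0 ?sqr_ge0.
Qed.

Lemma marg_exp_shift l (b B : R) (g : Om -> R) x : measurable_fun [set: Om] g ->
  (marg l (fun y => (expR (g y))%:E) x <= (expR B)%:E)%E ->
  (marg l (fun y => (expR (b + g y))%:E) x <= (expR (b + B))%:E)%E.
Proof.
move=> mg H.
rewrite (@marg_eq_at l _ (fun y => (expR b)%:E * (expR (g y))%:E)%E); last first.
  by move=> y _; rewrite expRD EFinM.
rewrite margZ ?expR_ge0//; last exact: nnmeas_expR.
by rewrite expRD EFinM lee_wpmul2l// lee_fin expR_ge0.
Qed.

Definition prob (b : Om -> bool) x : \bar R :=
  marg (enum J) (fun y => ((b y)%:R)%:E) x.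

Lemma chernoff_marg l (G : Om -> Prop) (b : Om -> bool) (g : Om -> R) (c : R) x :
  uniq l -> measurable_fun [set: Om] b -> 0 <= c ->
  (forall y, b y -> G y /\ 0 <= g y) ->
  (forall x y, (forall i, i \notin l -> y i = x i) -> G y -> G x) ->
  (forall x, G x -> (marg l (fun y => (expR (g y))%:E) x <= c%:E)%E) ->
  (prob b x <= c%:E)%E.
Proof.
move=> ul mb c0 bG GG H; apply: (@marg_bound l) => //; first exact: nnmeas_bool.
move=> {}x; have [Gx|Gx] := pselect (G x).
  apply: le_trans (H _ Gx); apply: marg_le_at => y.
    by rewrite lee_fin ler0n.
  move=> _; rewrite lee_fin; have [/bG[_ gy]|_] := boolP (b y).
    by rewrite -expR0 ler_expR.
  exact: expR_ge0.
rewrite (@marg_eq_at l _ (fun=> 0%E)) ?marg_cst ?lee_fin// => y yx.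
by have [/bG[Gy _]|//] := boolP (b y); exfalso; apply: Gx; exact: GG yx Gy.
Qed.

(* Integrating out [y j] turns the exponent [t] into [t / (1 - 2 t s^2 |w_j|^2)], by
   Cauchy-Schwarz on the cross term; the normalizing factors then telescope. *)
Lemma marg_exp_gram (A : finType) l (w : J -> A -> R) (y0 : A -> R) (t : R) x :
  uniq l -> 0 <= t ->
  2 * t * s ^+ 2 * (\sum_(j <- l) \sum_a w j a ^+ 2) < 1 ->
  (marg l (fun y => (expR (t * \sum_a (y0 a + \sum_(j <- l) y j * w j a) ^+ 2))%:E) x <=
   ((Num.sqrt (1 - 2 * t * s ^+ 2 * (\sum_(j <- l) \sum_a w j a ^+ 2)))^-1 *
    expR (t * (\sum_a y0 a ^+ 2) /
      (1 - 2 * t * s ^+ 2 * (\sum_(j <- l) \sum_a w j a ^+ 2))))%:E)%E.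
Proof.
move=> + t0; elim: l y0 x => [|j l IH] y0 x.
  move=> _ _ /=; rewrite big_nil mulr0 subr0 sqrtr1 invr1 mul1r mulr1 lee_fin.
  rewrite ler_expR le_eqVlt; apply/orP; left; apply/eqP; congr (_ * _).
  by apply: eq_bigr => a _; rewrite big_nil addr0.
move=> /= /andP[jl ul]; rewrite big_cons; set T := \sum_(j <- l) _.
set wj := \sum_a w j a ^+ 2 => lt1.
have T0 : 0 <= T by apply: sumr_ge0 => i _; apply: sumr_ge0 => a _; exact: sqr_ge0.
have wj0 : 0 <= wj by apply: sumr_ge0 => a _; exact: sqr_ge0.
have ts0 : 0 <= 2 * t * s ^+ 2 by rewrite mulr_ge0 ?sqr_ge0// mulr_ge0.
have lt1T : 2 * t * s ^+ 2 * T < 1.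
  by apply: le_lt_trans lt1; rewrite ler_wpM2l// lerDr.
set p := 1 - 2 * t * s ^+ 2 * T.
have p0 : 0 < p by rewrite subr_gt0.
set r := 1 - 2 * t * s ^+ 2 * (wj + T).
have r0 : 0 < r by rewrite subr_gt0.
have pr : r = p - 2 * t * s ^+ 2 * wj by rewrite /r /p; ring.
pose C := \sum_a y0 a * w j a; pose Y := \sum_a y0 a ^+ 2.
have Y0 : 0 <= Y by apply: sumr_ge0 => a _; exact: sqr_ge0.
have CS : C ^+ 2 <= Y * wj by exact: cauchy_schwarz.
have sqE (z : R) : \sum_a (y0 a + z * w j a) ^+ 2 = Y + 2 * z * C + z ^+ 2 * wj.
  rewrite /Y /C /wj !mulr_sumr -!big_split/=; apply: eq_bigr => a _; ring.
have sqE' (z : R) : t * (Y + 2 * z * C + z ^+ 2 * wj) / p =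
    t * Y / p + (2 * t * C / p * z + t * wj / p * z ^+ 2).
  by field; exact: lt0r_neq0.
rewrite -[marg1 _ _]/(marg (j :: l) _) marg_cons.
pose K := (Num.sqrt p)^-1 * expR (t * Y / p).
have K0 : 0 <= K by rewrite mulr_ge0 ?expR_ge0// invr_ge0 sqrtr_ge0.
have mE : measurable_fun [set: measurableTypeR R]
    (fun z : R => (expR (2 * t * C / p * z + t * wj / p * z ^+ 2))%:E).
  apply/measurable_EFinP; apply: measurableT_comp => //.
  by apply: measurable_funD => //; apply: measurable_funM => //; exact: measurable_funX.
apply: (@le_trans _ _ (\int[normal_prob 0 s]_z
   (K%:E * (expR (2 * t * C / p * z + t * wj / p * z ^+ 2))%:E))%E).
  apply: le_integral_ge0 => z.
    by apply: marg_ge0 => y; rewrite lee_fin expR_ge0.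
  rewrite (@marg_eq_at l _ (fun y => (expR (t * \sum_a ((y0 a + z * w j a) + \sum_(j <- l) y j * w j a) ^+ 2))%:E)); last first.
    move=> y yx; congr (expR (t * _))%:E; apply: eq_bigr => a _.
    by rewrite big_cons addrA (yx j jl) updE.
  apply: le_trans (IH _ _ ul lt1T) _; rewrite -/p -EFinM lee_fin sqE.
  by rewrite /K -[leRHS]mulrA -expRD ler_wpM2l ?invr_ge0 ?sqrtr_ge0// ler_expR sqE'.
rewrite ge0_integralZl//.
rewrite integral_normal_expR//; last first.
  rewrite (_ : 2 * _ * _ = (2 * t * s ^+ 2 * wj) / p); last by ring.
  by rewrite ltr_pdivrMr// mul1r; rewrite pr in r0; lra.
rewrite -EFinM lee_fin.
have -> : 1 - 2 * (t * wj / p) * s ^+ 2 = r / p.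
  by rewrite pr; field; exact: lt0r_neq0.
rewrite (sqrtrM _ (ltW r0)) (sqrtrV (ltW p0)).
have sp : 0 < Num.sqrt p by rewrite sqrtr_gt0.
have sr : 0 < Num.sqrt r by rewrite sqrtr_gt0.
set X := (2 * t * C / p) ^+ 2 * s ^+ 2 / (2 * (r / p)).
have -> : K * ((Num.sqrt r / Num.sqrt p)^-1 * expR X) =
    (Num.sqrt r)^-1 * (expR (t * Y / p) * expR X).
  by rewrite /K; field; rewrite !lt0r_neq0.
rewrite /X.
rewrite ler_wpM2l ?invr_ge0 ?sqrtr_ge0// -expRD ler_expR.
have -> : (2 * t * C / p) ^+ 2 * s ^+ 2 / (2 * (r / p)) = 2 * t ^+ 2 * s ^+ 2 / (p * r) * C ^+ 2.
  by field; rewrite !lt0r_neq0.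
have -> : t * (\sum_a y0 a ^+ 2) / r = t * Y / p + 2 * t ^+ 2 * s ^+ 2 / (p * r) * (Y * wj).
  rewrite -/Y.
  have -> : t * Y / r = t * Y * p / (p * r) by field; rewrite !lt0r_neq0.
  have -> : t * Y / p = t * Y * r / (p * r) by field; rewrite !lt0r_neq0.
  rewrite pr; field; rewrite -pr !lt0r_neq0//.
rewrite lerD2l ler_wpM2l// divr_ge0 ?mulr_ge0 ?sqr_ge0// ltW//.
Qed.

End marginal.

(** * Inner products of finite families *)

Definition dot (R : realType) (A : finType) (f g : A -> R) : R := \sum_a f a * g a.

Section dot.
Context (R : realType) (A : finType).
Implicit Types f g h : A -> R.

Lemma dotC f g : dot f g = dot g f.
Proof. by apply: eq_bigr => a _; rewrite mulrC. Qed.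

Lemma dotBl f g h : dot (fun a => f a - g a) h = dot f h - dot g h.
Proof. by rewrite /dot -sumrB; apply: eq_bigr => a _; rewrite mulrBl. Qed.

Lemma dotBr f g h : dot h (fun a => f a - g a) = dot h f - dot h g.
Proof. by rewrite dotC dotBl !(dotC h). Qed.

Lemma dotZl c f g : dot (fun a => c * f a) g = c * dot f g.
Proof. by rewrite /dot mulr_sumr; apply: eq_bigr => a _; rewrite mulrA. Qed.

Lemma dot_ge0 f : 0 <= dot f f.
Proof. by apply: sumr_ge0 => a _; rewrite -expr2 sqr_ge0. Qed.

Lemma dot_sqr f : dot f f = \sum_a f a ^+ 2.
Proof. by apply: eq_bigr => a _; rewrite expr2. Qed.

Lemma dot_norm_le f g : `|dot f g| <= Num.sqrt (dot f f) * Num.sqrt (dot g g).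
Proof.
rewrite -sqrtrM ?dot_ge0// -sqrtr_sqr ler_sqrt ?mulr_ge0 ?dot_ge0//.
by rewrite !dot_sqr; exact: cauchy_schwarz.
Qed.

End dot.

(** * Probabilities of the exceptional events *)

Section events.
Context (R : realType) (n d : nat) (s : R).
Hypothesis s0 : 0 < s.
Local Notation J := (bool * 'I_n * 'I_d)%type.
Local Notation Om := (cspace R J).
Implicit Types (x y : Om) (i j k : 'I_n).

(* The index [(false, i, a)] stands for the coordinate [a] of [u_i] and
   [(true, i, a)] for the coordinate [a] of [v_i]. *)
Definition vec (b : bool) i y : 'I_d -> R := fun a => y (b, i, a).

Definition blk (b : bool) i : seq J := [seq (b, i, a) | a <- enum 'I_d].

Lemma blk_uniq b i : uniq (blk b i).
Proof. by rewrite map_inj_uniq ?enum_uniq// => a a' []. Qed.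

Lemma mem_blk b i (j : J) : (j \in blk b i) = (j.1 == (b, i)).
Proof.
apply/mapP/eqP => [[a _ ->]//|]; case: j => [[b' i'] a] /= [-> ->].
by exists a => //; rewrite mem_enum.
Qed.

Lemma big_blk b i (F : J -> R) : \sum_(j <- blk b i) F j = \sum_a F (b, i, a).
Proof. by rewrite big_map big_enum. Qed.

Lemma blks_uniq b (r : seq 'I_n) : uniq r -> uniq (flatten [seq blk b i | i <- r]).
Proof.
elim: r => //= i r IH /andP[ir ur]; rewrite cat_uniq blk_uniq IH// andbT /=.
apply/hasPn => j /flatten_mapP[k kr]; rewrite !mem_blk => /eqP ->.
by apply: contraNneq ir => -[<-].
Qed.

Lemma big_blks b (r : seq 'I_n) (F : J -> R) :
  \sum_(j <- flatten [seq blk b i | i <- r]) F j = \sum_(i <- r) \sum_a F (b, i, a).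
Proof.
elim: r => [|i r IH]; first by rewrite !big_nil.
by rewrite big_cons big_cat big_blk IH.
Qed.

Lemma notin_blks b (r : seq 'I_n) (j : J) :
  (j.1.1 == b) ==> (j.1.2 \notin r) -> j \notin flatten [seq blk b i | i <- r].
Proof.
move=> H; apply/negP => /flatten_mapP[k kr]; rewrite mem_blk => /eqP E.
by move: H; rewrite E eqxx kr.
Qed.

Lemma size_blks b (r : seq 'I_n) : size (flatten [seq blk b i | i <- r]) = (size r * d)%N.
Proof.
elim: r => //= i r IH; by rewrite size_cat IH size_map -cardE card_ord mulSn.
Qed.

Lemma measurable_dot d' (T : measurableType d') (f g : T -> 'I_d -> R) :
  (forall a, measurable_fun setT (f^~ a)) -> (forall a, measurable_fun setT (g^~ a)) ->
  measurable_fun setT (fun t => dot (f t) (g t)).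
Proof. by move=> mf mg; apply: measurable_sum => a; exact: measurable_funM. Qed.

Lemma measurable_vec b i a : measurable_fun [set: Om] (fun y => vec b i y a).
Proof. exact: measurable_coordR. Qed.

Lemma measurable_all (I : Type) (r : seq I) (b : I -> Om -> bool) :
  (forall k : I, measurable_fun setT (b k)) ->
  measurable_fun [set: Om] (fun y => all (b^~ y) r).
Proof.
move=> mb; elim: r => [|i r IH] /=; first exact: measurable_cst.
exact: measurable_and.
Qed.

Lemma measurable_sumsq (l : seq J) :
  measurable_fun [set: Om] (fun y : Om => \sum_(j <- l) y j ^+ 2).
Proof. by apply: measurable_sum => j; apply: measurable_funX; exact: measurable_coordR. Qed.

Lemma chisq_upper (l : seq J) (e : R) x : uniq l -> 0 <= e -> e <= 2^-1 ->
  (prob s (fun y : Om => (1 + e) * ((size l)%:R * s ^+ 2) < \sum_(j <- l) y j ^+ 2)%R x <=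
   (expR (- ((size l)%:R * e ^+ 2 / 8)))%:E)%E.
Proof.
move=> ul e0 e1; set m := (size l)%:R.
(* With [q = t * s ^+ 2], the exponent per coordinate is [2 * q ^+ 2 - e * q], minimal at
   [q = e / 4] with value [- e ^+ 2 / 8]. The same choice recurs in [quad_upper] and
   [gram_upper]. *)
pose t := e / (4 * s ^+ 2).
have t0 : 0 <= t by rewrite divr_ge0// mulr_ge0// sqr_ge0.
have ts : t * s ^+ 2 = e / 4 by rewrite /t; field; exact: lt0r_neq0.
apply: (@chernoff_marg _ _ _ l (fun=> True) _ (fun y => - (t * ((1 + e) * (m * s ^+ 2))) + t * \sum_(j <- l) y j ^+ 2)) => //.
- apply: measurable_fun_ltr => //; exact: measurable_sumsq.
- move=> y lt; split => //; rewrite addrC -mulrBr mulr_ge0// subr_ge0; exact: ltW.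
- move=> {}x _.
  rewrite (_ : - (m * e ^+ 2 / 8) = - (t * ((1 + e) * (m * s ^+ 2))) +
      m * (t * s ^+ 2 + 2 * (t * s ^+ 2) ^+ 2)).
    apply: marg_exp_shift; first exact: measurable_funM (measurable_sumsq _).
    by apply: marg_exp_chisq => //; rewrite ts; lra.
  rewrite (_ : t * ((1 + e) * (m * s ^+ 2)) = (t * s ^+ 2) * ((1 + e) * m)); last by ring.
  by rewrite ts; field.
Qed.

Lemma chisq_lower (l : seq J) (e : R) x : uniq l -> 0 <= e ->
  (prob s (fun y : Om => \sum_(j <- l) y j ^+ 2 < (1 - e) * ((size l)%:R * s ^+ 2))%R x <=
   (expR (- ((size l)%:R * e ^+ 2 / 8)))%:E)%E.
Proof.
move=> ul e0; set m := (size l)%:R.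
pose t := - (e / (4 * s ^+ 2)).
have t0 : t <= 0 by rewrite oppr_le0 divr_ge0// mulr_ge0// sqr_ge0.
have ts : t * s ^+ 2 = - (e / 4) by rewrite /t; field; exact: lt0r_neq0.
apply: (@chernoff_marg _ _ _ l (fun=> True) _ (fun y => - (t * ((1 - e) * (m * s ^+ 2))) + t * \sum_(j <- l) y j ^+ 2)) => //.
- apply: measurable_fun_ltr => //; exact: measurable_sumsq.
- move=> y lt; split => //; rewrite addrC -mulrBr mulr_le0// subr_le0; exact: ltW.
- move=> {}x _.
  rewrite (_ : - (m * e ^+ 2 / 8) = - (t * ((1 - e) * (m * s ^+ 2))) +
      m * (t * s ^+ 2 + 2 * (t * s ^+ 2) ^+ 2)).
    apply: marg_exp_shift; first exact: measurable_funM (measurable_sumsq _).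
    by apply: marg_exp_chisq => //; rewrite ts; lra.
  rewrite (_ : t * ((1 - e) * (m * s ^+ 2)) = (t * s ^+ 2) * ((1 - e) * m)); last by ring.
  by rewrite ts; field.
Qed.

(** Given the first vector, of squared norm at most 2, the inner product is Gaussian of variance at
    most [2 * s ^+ 2]. The sign [g] gives both tails. *)
Lemma inner_upper (b : bool) i j (g e : R) x : i != j -> 0 <= e -> `|g| = 1 ->
  (prob s (fun y : Om => (dot (vec b i y) (vec b i y) <= 2) &&
       (e < g * dot (vec b i y) (vec b j y)))%R x <=
   (expR (- (e ^+ 2 / (4 * s ^+ 2))))%:E)%E.
Proof.
move=> ij e0 g1; pose t := e / (2 * s ^+ 2).
have g2 : g ^+ 2 = 1 by rewrite -real_normK ?num_real// g1 expr1n.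
have t0 : 0 <= t by rewrite divr_ge0// mulr_ge0// sqr_ge0.
apply: (@chernoff_marg _ _ _ (blk b j) (fun y => dot (vec b i y) (vec b i y) <= 2) _
  (fun y => - (t * e) + (t * g) * dot (vec b i y) (vec b j y))).
- exact: blk_uniq.
- apply: measurable_and.
    apply: measurable_fun_ler => //; apply: measurable_dot => a; exact: measurable_vec.
  apply: measurable_fun_ltr => //; apply: measurable_funM => //.
  by apply: measurable_dot => a; exact: measurable_vec.
- exact: expR_ge0.
- move=> y /andP[-> lt]; split => //; rewrite addrC -mulrA -mulrBr mulr_ge0// subr_ge0.
  exact: ltW.
- move=> y y' yy; rewrite (_ : vec b i y' = vec b i y)//.
  apply/funext => a; apply: yy; rewrite mem_blk /=.
  by apply: contraNneq ij => -[->].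
- move=> {}x Gx.
  pose c (k : J) : R := x (b, i, k.2).
  rewrite (@marg_eq_at _ _ _ _ _ (fun y => (expR (- (t * e) + (t * g) * \sum_(k <- blk b j) c k * y k))%:E)); last first.
    move=> y yx; congr (expR (_ + _ * _))%:E; rewrite big_blk; apply: eq_bigr => a _.
    congr (_ * _); rewrite /vec yx// mem_blk /=.
    by apply: contraNneq ij => -[->].
  rewrite (_ : - (e ^+ 2 / _) = - (t * e) + (t * g) ^+ 2 * s ^+ 2 * 2 / 2).
    apply: marg_exp_shift; first exact: measurable_funM (measurable_lin _ _).
    apply: marg_exp_linear_le => //; first exact: blk_uniq.
    by rewrite big_blk; move: Gx; rewrite dot_sqr.
  rewrite exprMn g2 /t; field; exact: lt0r_neq0.
Qed.

Lemma prod_exp_sum (I : Type) (r : seq I) (t : R) (f : I -> R) :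
  expR (t * \sum_(i <- r) f i) = \prod_(i <- r) expR (t * f i).
Proof. by rewrite mulr_sumr (big_morph _ (@expRD R) (@expR0 R)). Qed.

Lemma blk_indep b (r : seq 'I_n) i y y' a :
  (forall j : J, (forall k, k \in r -> k != i -> j \notin blk b k) -> y j = y' j) ->
  y (b, i, a) = y' (b, i, a).
Proof.
move=> H; apply: H => k _ ki; rewrite mem_blk/=.
by apply: contraNneq ki => -[->].
Qed.

(** As [i] and [j] lie outside [r], the difference of the two vectors stays frozen while the vectors
    of [r] are integrated. The sum is then a multiple of a chi-square with [size r] degrees of
    freedom. *)
Lemma quad_upper (r : seq 'I_n) i j (K e : R) x : uniq r -> i \notin r -> j \notin r ->
  0 < K -> 0 <= e -> e <= 2^-1 ->
  (prob s (fun y : Om => (dot (fun a => vec false i y a - vec false j y a)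
                     (fun a => vec false i y a - vec false j y a) <= K) &&
       ((1 + e) * (K * s ^+ 2 * (size r)%:R) <
        \sum_(k <- r) dot (fun a => vec false i y a - vec false j y a) (vec false k y) ^+ 2))%R x <=
   (expR (- ((size r)%:R * e ^+ 2 / 8)))%:E)%E.
Proof.
move=> ur ir jr K0 e0 e1; pose t := e / (4 * K * s ^+ 2).
set m := (size r)%:R.
have t0 : 0 <= t by rewrite divr_ge0// mulr_ge0 ?sqr_ge0// mulr_ge0// ltW.
have ts : t * s ^+ 2 * K = e / 4 by rewrite /t; field; rewrite !lt0r_neq0.
pose w y a := vec false i y a - vec false j y a.
have mw a : measurable_fun setT (fun y => w y a).
  by apply: measurable_funB; exact: measurable_vec.
have wE x' y : (forall k : J, k \notin flatten [seq blk false i | i <- r] -> y k = x' k) -> w y = w x'.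
  move=> yx; apply/funext => a; rewrite /w /vec.
  by congr (_ - _); apply: yx; apply: notin_blks.
have mS : measurable_fun setT (fun y => \sum_(k <- r) dot (w y) (vec false k y) ^+ 2).
  apply: measurable_sum => k; apply: measurable_funX.
  by apply: measurable_dot => // a; exact: measurable_vec.
apply: (@chernoff_marg _ _ _ (flatten [seq blk false i | i <- r]) (fun y => dot (w y) (w y) <= K) _
  (fun y => - (t * ((1 + e) * (K * s ^+ 2 * m))) + t * \sum_(k <- r) dot (w y) (vec false k y) ^+ 2)).
- exact: blks_uniq.
- apply: measurable_and.
    by apply: measurable_fun_ler => //; exact: measurable_dot.
  exact: measurable_fun_ltr.
- exact: expR_ge0.
- move=> y /andP[-> lt]; split => //; rewrite addrC -mulrBr mulr_ge0// subr_ge0.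
  exact: ltW.
- by move=> x' y yx; rewrite (wE _ _ yx).
- move=> {}x Gx.
  rewrite (@marg_eq_at _ _ _ _ _ (fun y => (expR (- (t * ((1 + e) * (K * s ^+ 2 * m))) + t * \sum_(k <- r) dot (w x) (vec false k y) ^+ 2))%:E)); last first.
    by move=> y yx; rewrite (wE _ _ yx).
  rewrite (_ : - (m * e ^+ 2 / 8) = - (t * ((1 + e) * (K * s ^+ 2 * m))) +
      m * (e / 4 + 2 * (e / 4) ^+ 2)); last first.
    rewrite (_ : t * ((1 + e) * (K * s ^+ 2 * m)) = (t * s ^+ 2 * K) * ((1 + e) * m)); last by ring.
    by rewrite ts; field.
  have mdot k : measurable_fun setT (fun y : Om => dot (w x) (vec false k y) ^+ 2).
    by apply: measurable_funX; apply: measurable_dot => // a; exact: measurable_vec.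
  apply: marg_exp_shift; first by apply: measurable_funM => //; exact: measurable_sum.
  rewrite (@marg_eq_at _ _ _ _ _ (fun y => (\prod_(k <- r) expR (t * dot (w x) (vec false k y) ^+ 2))%:E)); last first.
    by move=> y _; rewrite prod_exp_sum.
  have -> : expR (m * (e / 4 + 2 * (e / 4) ^+ 2)) = \prod_(k <- r) expR (e / 4 + 2 * (e / 4) ^+ 2).
    by rewrite big_const_seq count_predT iter_mulr_1 expRM_natl.
  apply: marg_prod => //.
  + by move=> k; apply: nnmeas_expR; exact: measurable_funM.
  + move=> k kr y y' yy; congr (expR (_ * _ ^+ 2)); apply: eq_bigr => a _.
    by congr (_ * _); apply: blk_indep yy.
  + move=> k y kr.
    rewrite (@marg_eq_at _ _ _ _ _ (fun y => (expR (t * (\sum_(l <- blk false k) w x l.2 * y l) ^+ 2))%:E)); last first.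
      by move=> z _; rewrite big_blk.
    apply: marg_exp_square_le => //; first exact: blk_uniq; last by lra.
    have -> : \sum_(l <- blk false k) w x l.2 ^+ 2 = dot (w x) (w x) by rewrite big_blk dot_sqr.
    by rewrite -ts ler_wpM2l// mulr_ge0// sqr_ge0.
Qed.

(** With all [u] and [v_i] frozen, the sum is linear in the remaining [v_k], its coefficients having
    squared norm at most [K * c]. Leaving out [k = i] is what makes it linear; [k = j] stays in. *)
Lemma noise_upper i j (K c h : R) x : 0 < K -> 0 < c -> 0 <= h ->
  (prob s (fun y : Om => [&& \sum_(k | k != i) dot (fun a => vec false i y a - vec false j y a) (vec false k y) ^+ 2 <= K,
       dot (vec true i y) (vec true i y) <= c &
       h <= - \sum_(k | k != i) dot (fun a => vec false i y a - vec false j y a) (vec false k y) *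
              dot (vec true k y) (vec true i y)])%R x <=
   (expR (- (h ^+ 2 / (2 * s ^+ 2 * K * c))))%:E)%E.
Proof.
(* The minimum over [t] of [- t * h + t ^+ 2 * s ^+ 2 * K * c / 2]. *)
move=> K0 c0 h0; pose t := h / (s ^+ 2 * K * c).
have t0 : 0 <= t by rewrite divr_ge0// !mulr_ge0 ?sqr_ge0// ltW.
pose r := [seq k <- enum 'I_n | k != i].
have ur : uniq r by rewrite filter_uniq ?enum_uniq.
have ir : i \notin r by rewrite mem_filter eqxx.
have rE (F : 'I_n -> R) : \sum_(k | k != i) F k = \sum_(k <- r) F k.
  by rewrite big_filter big_enum_cond.
pose w y a := vec false i y a - vec false j y a.
have mw a : measurable_fun setT (fun y => w y a).
  by apply: measurable_funB; exact: measurable_vec.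
set l := flatten [seq blk true i | i <- r].
have uE k x' y : (forall k : J, k \notin l -> y k = x' k) -> vec false k y = vec false k x'.
  by move=> yx; apply/funext => a; apply: yx; apply: notin_blks.
have vE x' y : (forall k : J, k \notin l -> y k = x' k) -> vec true i y = vec true i x'.
  by move=> yx; apply/funext => a; apply: yx; apply: notin_blks.
have wE x' y : (forall k : J, k \notin l -> y k = x' k) -> w y = w x'.
  by move=> yx; rewrite /w !(uE _ _ _ yx).
have mwu k : measurable_fun setT (fun y => dot (w y) (vec false k y)).
  by apply: measurable_dot => // a; exact: measurable_vec.
have mvv k k' : measurable_fun setT (fun y => dot (vec true k y) (vec true k' y)).
  by apply: measurable_dot => // a; exact: measurable_vec.
pose S y := \sum_(k | k != i) dot (w y) (vec false k y) ^+ 2.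
pose N y := \sum_(k | k != i) dot (w y) (vec false k y) * dot (vec true k y) (vec true i y).
have mS : measurable_fun setT S.
  rewrite (_ : S = fun y => \sum_(k <- r) dot (w y) (vec false k y) ^+ 2); last by apply/funext => y; rewrite -rE.
  by apply: measurable_sum => k; exact: measurable_funX.
have mN : measurable_fun setT N.
  rewrite (_ : N = fun y => \sum_(k <- r) dot (w y) (vec false k y) * dot (vec true k y) (vec true i y)); last by apply/funext => y; rewrite -rE.
  by apply: measurable_sum => k; exact: measurable_funM.
apply: (@chernoff_marg _ _ _ l
  (fun y => S y <= K /\ dot (vec true i y) (vec true i y) <= c) _
  (fun y => - (t * h) + (- t) * N y)).
- exact: blks_uniq.
- apply: measurable_and; first exact: measurable_fun_ler.
  apply: measurable_and; first exact: measurable_fun_ler.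
  by apply: measurable_fun_ler => //; exact: measurableT_comp.
- exact: expR_ge0.
- move=> y /and3P[-> -> le]; split => //.
  by rewrite addrC mulNr -mulrN -mulrBr mulr_ge0// subr_ge0.
- move=> x' y yx; rewrite /S (wE _ _ yx) (vE _ _ yx) => -[le1 le2]; split => //.
  by under eq_bigr do rewrite -(uE _ _ _ yx).
- move=> {}x [Sx vx].
  pose cf (k : J) : R := dot (w x) (vec false k.1.2 x) * vec true i x k.2.
  rewrite (@marg_eq_at _ _ _ _ _ (fun y => (expR (- (t * h) + (- t) * \sum_(k <- l) cf k * y k))%:E)); last first.
    move=> y yx; congr (expR (_ + _ * _))%:E.
    rewrite /N rE /l big_blks; apply: eq_bigr => k _.
    rewrite (wE _ _ yx) (uE _ _ _ yx) (vE _ _ yx) /cf /= [dot (vec true k y) _]dotC {2}/dot mulr_sumr.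
    by apply: eq_bigr => a _; rewrite mulrA.
  rewrite (_ : - (h ^+ 2 / _) = - (t * h) + (- t) ^+ 2 * s ^+ 2 * (K * c) / 2); last first.
    by rewrite /t; field; rewrite !lt0r_neq0.
  apply: marg_exp_shift; first exact: measurable_funM (measurable_lin _ _).
  apply: marg_exp_linear_le => //; first exact: blks_uniq.
  rewrite /l big_blks /cf /=.
  under eq_bigr => k _ do under eq_bigr => a _ do rewrite exprMn.
  under eq_bigr => k _ do rewrite -mulr_sumr.
  rewrite -mulr_suml -rE -dot_sqr ler_pM ?dot_ge0//.
  by apply: sumr_ge0 => k _; exact: sqr_ge0.
Qed.

(** For a fixed direction the [n] projections are independent, and each stays below the level with
    probability at most [1 - p <= expR (- p)]. *)
Lemma tail_all (z : 'I_d -> R) (t : R) x : 0 <= t -> 0 < dot z z ->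
  (prob s (fun y : Om => all (fun j => dot z (vec false j y) < t * (s * Num.sqrt (dot z z))) (enum 'I_n))%R x <=
   (expR (- (n%:R * (normal_peak 1 * expR (- (t + 1) ^+ 2 / 2)))))%:E)%E.
Proof.
move=> t0 z0; set p := normal_peak 1 * _.
have mdot k : measurable_fun setT (fun y => dot z (vec false k y)).
  by apply: measurable_dot => // a; exact: measurable_vec.
have mlt k : measurable_fun [set: Om] (fun y => dot z (vec false k y) < t * (s * Num.sqrt (dot z z))).
  exact: measurable_fun_ltr.
have ul : uniq (flatten [seq blk false i | i <- enum 'I_n]) by rewrite blks_uniq ?enum_uniq.
rewrite /prob; apply: (marg_bound _ _ ul); first by apply: nnmeas_bool; exact: measurable_all.
move=> {}x.
rewrite (@marg_eq_at _ _ _ _ _ (fun y => (\prod_(k <- enum 'I_n) ((dot z (vec false k y) < t * (s * Num.sqrt (dot z z)))%R%:R))%:E)); last first.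
  move=> y _; congr EFin; elim: (enum 'I_n) => [|k r IH]; first by rewrite big_nil.
  by rewrite big_cons -IH /= -mulnb natrM.
have -> : expR (- (n%:R * p)) = \prod_(k <- enum 'I_n) expR (- p).
  by rewrite big_const_seq count_predT iter_mulr_1 size_enum_ord -expRM_natl mulrN.
apply: marg_prod => //.
- exact: enum_uniq.
- by move=> k; exact: nnmeas_bool.
- move=> k kr y y' yy; congr ((_ < _)%R%:R); apply: eq_bigr => a _.
  by congr (_ * _); apply: blk_indep yy.
- move=> k y kr.
  have zE : \sum_(l <- blk false k) (z l.2) ^+ 2 = dot z z by rewrite big_blk dot_sqr.
  rewrite (@marg_eq_at _ _ _ _ _ (fun y => ((\sum_(l <- blk false k) z l.2 * y l <
       t * (s * Num.sqrt (\sum_(l <- blk false k) (z l.2) ^+ 2)))%R%:R)%:E)); last first.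
    by move=> y' _; rewrite zE big_blk.
  apply: le_trans (marg_lower_tail _ _ _ _ _) _ => //.
  + exact: blk_uniq.
  + by rewrite zE.
  + by rewrite lee_fin -/p; exact: expR_ge1Dx.
Qed.

Lemma abs_sum_lower (z : 'I_d -> R) (e : R) x : 0 <= e -> 0 < dot z z ->
  (prob s (fun y : Om => \sum_(k <- enum 'I_n) `|dot z (vec true k y)| <
        (1 - e) * n%:R * (s * Num.sqrt (dot z z)) * Num.sqrt (2 / pi))%R x <=
   (expR (- (n%:R * e ^+ 2 * (2 / pi) / 24)))%:E)%E.
Proof.
move=> e0; rewrite -sqrtr_gt0; set q := Num.sqrt (dot z z) => q0.
set kp := Num.sqrt (2 / pi).
have kp2 : kp ^+ 2 = 2 / pi by rewrite sqr_sqrtr// divr_ge0// pi_ge0.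
have kp0 : 0 <= kp by exact: sqrtr_ge0.
(* By [normal_laplace_abs] the exponent per vector is [6 * lam ^+ 2 - e * lam * kp], minimal
   here. *)
pose lam := e * kp / 12; have lam0 : 0 <= lam by rewrite divr_ge0// mulr_ge0.
pose t := lam / (s * q).
have t0 : 0 <= t by rewrite divr_ge0// mulr_ge0// ltW.
have tE : t * (s * q) = lam by rewrite /t; field; rewrite !lt0r_neq0.
have mdot k : measurable_fun setT (fun y => dot z (vec true k y)).
  by apply: measurable_dot => // a; exact: measurable_vec.
have mabs k : measurable_fun [set: Om] (fun y => `|dot z (vec true k y)|).
  exact: measurableT_comp.
apply: (@chernoff_marg _ _ _ (flatten [seq blk true i | i <- enum 'I_n]) (fun=> True) _
  (fun y => t * ((1 - e) * n%:R * (s * q) * kp) + (- t) * \sum_(k <- enum 'I_n) `|dot z (vec true k y)|)) => //.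
- by rewrite blks_uniq ?enum_uniq.
- by apply: measurable_fun_ltr => //; exact: measurable_sum.
- by move=> y lt; split => //; rewrite mulNr -mulrBr mulr_ge0// subr_ge0 ltW.
- move=> {}x _.
  rewrite (_ : - (n%:R * e ^+ 2 * (2 / pi) / 24) = t * ((1 - e) * n%:R * (s * q) * kp) +
     n%:R * (- (lam * kp) + 6 * lam ^+ 2)); last first.
    rewrite (_ : t * _ = (t * (s * q)) * ((1 - e) * n%:R * kp)); last by ring.
    by rewrite tE -kp2 /lam; field.
  apply: marg_exp_shift; first by apply: measurable_funM => //; exact: measurable_sum.
  rewrite (@marg_eq_at _ _ _ _ _ (fun y => (\prod_(k <- enum 'I_n) expR ((- t) * `|dot z (vec true k y)|))%:E)); last first.
    by move=> y _; rewrite prod_exp_sum.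
  have -> : expR (n%:R * (- (lam * kp) + 6 * lam ^+ 2)) = \prod_(k <- enum 'I_n) expR (- (lam * kp) + 6 * lam ^+ 2).
    by rewrite big_const_seq count_predT iter_mulr_1 size_enum_ord -expRM_natl.
  apply: marg_prod => //.
  + exact: enum_uniq.
  + by move=> k; apply: nnmeas_expR; exact: measurable_funM.
  + move=> k kr y y' yy; congr (expR (_ * `|_|)); apply: eq_bigr => a _.
    by congr (_ * _); apply: blk_indep yy.
  + move=> k y kr.
    rewrite (@marg_eq_at _ _ _ _ _ (fun y => (expR (- (t * `|\sum_(l <- blk true k) z l.2 * y l|)))%:E)); last first.
      by move=> y' _; rewrite big_blk mulNr.
    apply: le_trans (marg_laplace_abs _ _ _ _ _) _ => //; first exact: blk_uniq.
    have zE : \sum_(l <- blk true k) (z l.2) ^+ 2 = dot z z by rewrite big_blk dot_sqr.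
    rewrite zE -/q -/kp tE lee_fin; apply: le_trans (expR_ge1Dx _); lra.
Qed.

(** Given all [v], the rows of [sum_k u_k v_k^T] are independent, since row [a] involves only the
    coordinates [a] of the [u_k]: these are the blocks [B a]. [marg_exp_gram] bounds each row
    through the trace [sum_k |v_k|^2] alone, and the [d] rows are multiplied together. *)
Lemma gram_upper (K e : R) x : 0 < K -> 0 <= e -> e <= 2^-1 ->
  (prob s (fun y : Om => (\sum_(k <- enum 'I_n) dot (vec true k y) (vec true k y) <= K) &&
     ((1 + e) * (d%:R * s ^+ 2 * K) <
      \sum_(a <- enum 'I_d) \sum_b (\sum_(k <- enum 'I_n) vec false k y a * vec true k y b) ^+ 2))%R x <=
   (expR (- (d%:R * e ^+ 2 / 8)))%:E)%E.
Proof.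
move=> K0 e0 e1; pose t := e / (4 * K * s ^+ 2).
have t0 : 0 <= t by rewrite divr_ge0// mulr_ge0 ?sqr_ge0// mulr_ge0// ltW.
have ts : t * s ^+ 2 * K = e / 4 by rewrite /t; field; rewrite !lt0r_neq0.
pose B (a : 'I_d) : seq J := [seq (false, k, a) | k <- enum 'I_n].
have uB a : uniq (B a) by rewrite map_inj_uniq ?enum_uniq// => ? ? [].
have memB a (j : J) : (j \in B a) = (j.1.1 == false) && (j.2 == a).
  apply/mapP/andP => [[k _ ->]//=|]; rewrite ?eqxx//.
  case: j => [[b' i'] a'] /= [/eqP -> /eqP ->]; exists i' => //; by rewrite mem_enum.
set l := flatten [seq B a | a <- enum 'I_d].
have ul : uniq l.
  rewrite /l; have := enum_uniq 'I_d; elim: (enum 'I_d) => //= a r IH /andP[ar ur].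
  rewrite cat_uniq uB IH// andbT /=; apply/hasPn => j /flatten_mapP[a' a'r].
  rewrite !memB => /andP[-> /eqP ->] /=; by apply: contraNneq ar => <-.
have vE k x' y : (forall j : J, j \notin l -> y j = x' j) -> vec true k y = vec true k x'.
  move=> yx; apply/funext => a; apply: yx; apply/negP => /flatten_mapP[a' _].
  by rewrite memB.
pose M y a b := \sum_(k <- enum 'I_n) vec false k y a * vec true k y b.
have mM a b : measurable_fun setT (fun y => M y a b).
  by apply: measurable_sum => k; apply: measurable_funM; exact: measurable_vec.
have mMM : measurable_fun setT (fun y => \sum_(a <- enum 'I_d) \sum_b M y a b ^+ 2).
  by apply: measurable_sum => a; apply: measurable_sum => b; exact: measurable_funX.
apply: (@chernoff_marg _ _ _ l (fun y => \sum_(k <- enum 'I_n) dot (vec true k y) (vec true k y) <= K) _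
  (fun y => - (t * ((1 + e) * (d%:R * s ^+ 2 * K))) + t * \sum_(a <- enum 'I_d) \sum_b M y a b ^+ 2)) => //.
- apply: measurable_and.
    apply: measurable_fun_ler => //; apply: measurable_sum => k.
    by apply: measurable_dot => a; exact: measurable_vec.
  exact: measurable_fun_ltr.
- move=> y /andP[-> lt]; split => //; rewrite addrC -mulrBr mulr_ge0// subr_ge0.
  exact: ltW.
- by move=> x' y yx; under eq_bigr do rewrite (vE _ _ _ yx).
- move=> {}x Gx.
  pose M' y a b := \sum_(k <- enum 'I_n) vec false k y a * vec true k x b.
  have mM' a b : measurable_fun setT (fun y => M' y a b).
    by apply: measurable_sum => k; apply: measurable_funM => //; exact: measurable_vec.
  rewrite (@marg_eq_at _ _ _ _ _ (fun y => (expR (- (t * ((1 + e) * (d%:R * s ^+ 2 * K))) + t * \sum_(a <- enum 'I_d) \sum_b M' y a b ^+ 2))%:E)); last first.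
    move=> y yx; congr (expR (_ + _ * _))%:E; apply: eq_bigr => a _; apply: eq_bigr => b _.
    by congr (_ ^+ 2); apply: eq_bigr => k _; rewrite (vE _ _ _ yx).
  rewrite (_ : - (d%:R * e ^+ 2 / 8) = - (t * ((1 + e) * (d%:R * s ^+ 2 * K))) +
      d%:R * (e / 4 + 2 * (e / 4) ^+ 2)); last first.
    rewrite (_ : t * ((1 + e) * (d%:R * s ^+ 2 * K)) = (t * s ^+ 2 * K) * ((1 + e) * d%:R)); last by ring.
    by rewrite ts; field.
  apply: marg_exp_shift.
    apply: measurable_funM => //; apply: measurable_sum => a.
    by apply: measurable_sum => b; exact: measurable_funX.
  rewrite (@marg_eq_at _ _ _ _ _ (fun y => (\prod_(a <- enum 'I_d) expR (t * \sum_b M' y a b ^+ 2))%:E)); last first.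
    by move=> y _; rewrite prod_exp_sum.
  have -> : expR (d%:R * (e / 4 + 2 * (e / 4) ^+ 2)) = \prod_(a <- enum 'I_d) expR (e / 4 + 2 * (e / 4) ^+ 2).
    by rewrite big_const_seq count_predT iter_mulr_1 size_enum_ord expRM_natl.
  apply: marg_prod => //.
  + exact: enum_uniq.
  + move=> a; apply: nnmeas_expR; apply: measurable_funM => //.
    by apply: measurable_sum => b; exact: measurable_funX.
  + move=> a _ y y' yy; congr (expR (_ * _)); apply: eq_bigr => b _.
    congr (_ ^+ 2); apply: eq_bigr => k _; congr (_ * _); apply: yy => a' _ a'a.
    by rewrite memB /= eq_sym.
  + move=> a y _.
    rewrite (@marg_eq_at _ _ _ _ _ (fun y => (expR (t * \sum_b (0 + \sum_(j <- B a) y j * vec true j.1.2 x b) ^+ 2))%:E)); last first.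
      move=> z _; congr (expR (_ * _))%:E; apply: eq_bigr => b _.
      by rewrite add0r big_map.
    have TE : \sum_(j <- B a) \sum_b vec true j.1.2 x b ^+ 2 = \sum_(k <- enum 'I_n) dot (vec true k x) (vec true k x).
      by rewrite big_map; apply: eq_bigr => k _; rewrite dot_sqr.
    set T := \sum_(k <- enum 'I_n) _ in Gx TE.
    have T0 : 0 <= T by apply: sumr_ge0 => k _; exact: dot_ge0.
    have qe : t * s ^+ 2 * T <= e / 4.
      by rewrite -ts ler_wpM2l// mulr_ge0// sqr_ge0.
    have q0 : 0 <= t * s ^+ 2 * T by rewrite mulr_ge0// mulr_ge0// sqr_ge0.
    have E2 : 2 * t * s ^+ 2 * T = 2 * (t * s ^+ 2 * T) by rewrite !mulrA.
    apply: le_trans (marg_exp_gram _ _ _ _ _ _) _ => //; rewrite TE E2; first by lra.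
    have -> : \sum_(b : 'I_d) (0 : R) ^+ 2 = 0 by rewrite big1// => b _; rewrite expr0n.
    rewrite mulr0 mul0r expR0 mulr1 lee_fin.
    apply: le_trans (invsqrt_le_expR _) _; first by lra.
    rewrite ler_expR; nra.
Qed.

End events.

(** * The retrieval probability *)

Section link.
Context (R : realType) (n d : nat).
Local Notation J := (bool * 'I_n * 'I_d)%type.
Local Notation Om := (cspace R J).
Local Notation s := (Num.sqrt (d%:R^-1) : R).
Implicit Types (y : Om).

(** The order in which [dec_u] and [dec_v] read the list of samples. *)
Definition rowmajor : seq J :=
  flatten [seq blk d false i | i <- enum 'I_n] ++ flatten [seq blk d true i | i <- enum 'I_n].

Lemma rowmajor_uniq : uniq rowmajor.
Proof.
rewrite cat_uniq !blks_uniq ?enum_uniq// andbT /=.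
apply/hasPn => j /flatten_mapP[k _]; rewrite mem_blk => /eqP jE.
by apply: notin_blks; rewrite jE.
Qed.

Lemma size_rowmajor : size rowmajor = (2 * n * d)%N.
Proof. by rewrite size_cat !size_blks size_enum_ord; lia. Qed.

Lemma perm_rowmajor : perm_eq rowmajor (enum {: J}).
Proof.
apply: uniq_perm; [exact: rowmajor_uniq|exact: enum_uniq|].
move=> [[b i] a]; rewrite mem_enum /= mem_cat; apply/orP.
by case: b; [right|left]; apply/flatten_mapP; exists i; rewrite ?mem_enum ?mem_blk.
Qed.

Lemma nth_blks (b : bool) (r : seq 'I_n) (i0 : 'I_n) y (k : nat) (a : 'I_d) : (k < size r)%N ->
  nth 0 (map y (flatten [seq blk d b i | i <- r])) (k * d + a) = y (b, nth i0 r k, a).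
Proof.
elim: r k => [//|i r IH] k kr /=.
rewrite map_cat nth_cat size_map size_map size_enum_ord.
case: k kr => [_|k kr].
  rewrite mul0n add0n ltn_ord /blk -map_comp (nth_map a) ?size_enum_ord//=.
  by rewrite nth_ord_enum.
rewrite mulSn -addnA ltnNge leq_addr /= addKn.
exact: IH.
Qed.

Lemma dec_u_rowmajor y (i : 'I_n) :
  @dec_u R n d (map y rowmajor) i = \row_a vec false i y a.
Proof.
apply/rowP => a; rewrite !mxE map_cat nth_cat size_map size_blks size_enum_ord.
have -> : (i * d + a < n * d)%N by have := ltn_ord i; have := ltn_ord a; nia.
by rewrite (nth_blks _ i) ?size_enum_ord// nth_ord_enum.
Qed.

Lemma dec_v_rowmajor y (i : 'I_n) :
  @dec_v R n d (map y rowmajor) i = \row_a vec true i y a.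
Proof.
apply/rowP => a; rewrite !mxE map_cat nth_cat size_map size_blks size_enum_ord.
rewrite -addnA ltnNge leq_addr /= addKn.
by rewrite (nth_blks _ i) ?size_enum_ord// nth_ord_enum.
Qed.

Definition retrievable y : Prop :=
  exists W : 'M[R]_d, forall i j : 'I_n, j != i ->
    \sum_a \sum_b vec false j y a * W a b * vec true i y b <
    \sum_a \sum_b vec false i y a * W a b * vec true i y b.

Lemma bil_row (f g : 'I_d -> R) (W : 'M[R]_d) :
  bil (\row_a f a) W (\row_a g a) = \sum_a \sum_b f a * W a b * g b.
Proof.
rewrite /bil mxE exchange_big/=; apply: eq_bigr => b _.
rewrite !mxE mulr_suml; apply: eq_bigr => a _.
by rewrite mxE.
Qed.

Lemma PR_rowmajor y : PR (@dec_u R n d (map y rowmajor)) (@dec_v R n d (map y rowmajor)) <-> retrievable y.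
Proof.
split=> -[W HW]; exists W => i j ji; have := HW i j ji;
  by rewrite !dec_u_rowmajor !dec_v_rowmajor !bil_row.
Qed.

Lemma probPR_marg x : probPR R n d =
  marg s rowmajor (fun y => (if `[< retrievable y >] then 1 else 0)%:E) x.
Proof.
rewrite /probPR -size_rowmajor (gauss_iter_marg _ _ x rowmajor_uniq).
apply: marg_eq_at => y _; congr (if _ then _ else _)%:E.
by apply/asboolP/asboolP => /PR_rowmajor.
Qed.

(** Integrals are reordered only for measurable functions. The comparison therefore takes place in
    the order of [probPR], and only [G] is moved to the order of [enum]. *)
Lemma probPR_le (G : Om -> \bar R) x : nnmeas G -> (forall y, retrievable y -> 1 <= G y)%E ->
  (probPR R n d <= marg s (enum {: J}) G x)%E.
Proof.
move=> mG H; rewrite (probPR_marg x) -(marg_perm s mG perm_rowmajor).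
apply: marg_le_at => y; first by rewrite lee_fin; case: ifP.
move=> _; case: asboolP => [/H//|_]; exact: mG.2.
Qed.

Lemma probPR_ge (G : Om -> \bar R) x : nnmeas G -> (forall y, G y <= 1)%E ->
  (forall y, ~ retrievable y -> G y = 0)%E ->
  (marg s (enum {: J}) G x <= probPR R n d)%E.
Proof.
move=> mG G1 H; rewrite (probPR_marg x) -(marg_perm s mG perm_rowmajor).
apply: marg_le_at => y; first exact: mG.2.
by move=> _; case: asboolP => [_|/H->//]; exact: G1.
Qed.

Lemma prob_union_le (I : Type) (r : seq I) (b : I -> Om -> bool) (c : I -> R) x :
  (forall i, measurable_fun setT (b i)) ->
  (forall i, prob s (b i) x <= (c i)%:E)%E ->
  (forall y, retrievable y -> has (b^~ y) r) ->
  (probPR R n d <= (\sum_(i <- r) c i)%:E)%E.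
Proof.
move=> mb bc H.
have mG : nnmeas (fun y : Om => \sum_(i <- r) ((b i y)%:R)%:E)%E.
  by apply: nnmeas_sum => i; exact: nnmeas_bool.
apply: (@le_trans _ _ (marg s (enum {: J}) (fun y => \sum_(i <- r) ((b i y)%:R)%:E)%E x)).
  apply: probPR_le => // y /H; elim: r {mG H} => [//|i r IH] /=.
  rewrite big_cons => /orP[->|/IH/le_trans]; last by apply; rewrite leeDr// lee_fin ler0n.
  by rewrite leeDl// sume_ge0// => k _; rewrite lee_fin ler0n.
rewrite marg_sum; last by move=> i; exact: nnmeas_bool.
rewrite -sumEFin; apply: lee_sum => i _; exact: bc.
Qed.

Lemma prob_union_ge (I : Type) (r : seq I) (b : I -> Om -> bool) (c : I -> R) x :
  (forall i, measurable_fun setT (b i)) ->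
  (forall i, prob s (b i) x <= (c i)%:E)%E ->
  (forall y, ~ retrievable y -> has (b^~ y) r) ->
  ((1 - \sum_(i <- r) c i)%:E <= probPR R n d)%E.
Proof.
move=> mb bc H.
pose B (y : Om) : R := \sum_(i <- r) ((b i y)%:R).
have mB : measurable_fun setT B by apply: measurable_sum => i; exact: measurable_bool_nat.
have B0 y : 0 <= B y by apply: sumr_ge0 => i _; exact: ler0n.
(* [G] is a measurable minorant of the indicator of retrieval. *)
pose G (y : Om) : R := Num.max 0 (1 - B y).
have mG : nnmeas (fun y => (G y)%:E).
  apply: nnmeas_EFin; last by move=> y; rewrite /G le_max lexx.
  by apply: measurable_maxr => //; exact: measurable_funB.
have mBE : nnmeas (fun y => (B y)%:E) by exact: nnmeas_EFin.
apply: (@le_trans _ _ (marg s (enum {: J}) (fun y => (G y)%:E) x)).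
  rewrite EFinB leeBlDr//.
  apply: (@le_trans _ _ (marg s (enum {: J}) (fun y => (G y)%:E) x + marg s (enum {: J}) (fun y => (B y)%:E) x)%E).
    rewrite -margD// -[leLHS](marg_cst s (enum {: J}) 1%E x).
    apply: marg_le_at => // y _; rewrite -EFinD lee_fin /G.
    by rewrite -lerBlDr le_max lexx orbT.
  rewrite leeD2l//.
  rewrite (@marg_eq_at _ _ _ _ _ (fun y => \sum_(i <- r) ((b i y)%:R)%:E)%E); last first.
    by move=> y _; rewrite /B sumEFin.
  rewrite marg_sum; last by move=> i; exact: nnmeas_bool.
  by rewrite -sumEFin; apply: lee_sum => i _; exact: bc.
apply: probPR_ge => // y.
  by rewrite lee_fin /G ge_max ler01 lerBlDr lerDl B0.
move=> /H hy; congr EFin; rewrite /G; apply/max_idPl; rewrite subr_le0 /B.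
elim: r {H B mB B0 G mG mBE} hy => [//|i r IH] /=; rewrite big_cons => /orP[->|/IH].
  by rewrite lerDl sumr_ge0// => k _; exact: ler0n.
by move=> /le_trans; apply; rewrite lerDr ler0n.
Qed.

Lemma probPR_le1 : (probPR R n d <= 1)%E.
Proof.
have := @probPR_le (fun=> 1%E) (fun=> 0) (nnmeas_cst _ lee01) (fun _ _ => lexx _).
by rewrite marg_cst.
Qed.

Lemma probPR_ge0 : (0 <= probPR R n d)%E.
Proof.
have := @probPR_ge (fun=> 0%E) (fun=> 0) (nnmeas_cst _ (lexx _)) (fun _ => lee01) (fun _ _ => erefl).
by rewrite marg_cst.
Qed.

End link.

(** * The upper regime: the Hebbian matrix retrieves *)

Section upper.
Context (R : realType) (n d : nat).
Hypothesis d0 : (0 < d)%N.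
Local Notation J := (bool * 'I_n * 'I_d)%type.
Local Notation Om := (cspace R J).
Local Notation s := (Num.sqrt (d%:R^-1) : R).
Implicit Types (y : Om).

Lemma s_gt0 : 0 < s.
Proof. by rewrite sqrtr_gt0 invr_gt0 ltr0n. Qed.

Lemma s_sqr : s ^+ 2 = d%:R^-1.
Proof. by rewrite sqr_sqrtr// invr_ge0 ler0n. Qed.

(** The score gap [(u_i - u_j)^T W v_i] for the Hebbian [W]; the signal is the term [k = i]. *)
Let D i j y := \sum_k dot (fun a => vec false i y a - vec false j y a) (vec false k y) *
  dot (vec true k y) (vec true i y).

Lemma retrievable_hebbian y : (forall i j : 'I_n, j != i -> 0 < D i j y) -> retrievable y.
Proof.
move=> H; exists (\matrix_(a, b) \sum_k vec false k y a * vec true k y b) => i j ji.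
have E i' : \sum_a \sum_b vec false i' y a *
    (\matrix_(a, b) \sum_k vec false k y a * vec true k y b) a b * vec true i y b =
    \sum_k dot (vec false i' y) (vec false k y) * dot (vec true k y) (vec true i y).
  under eq_bigr => a _ do under eq_bigr => b _ do rewrite mxE mulr_sumr mulr_suml.
  under eq_bigr => a _ do rewrite exchange_big/=.
  rewrite exchange_big/=; apply: eq_bigr => k _.
  rewrite /dot mulr_suml; apply: eq_bigr => a _; rewrite mulr_sumr.
  by apply: eq_bigr => b _; rewrite !mulrA.
rewrite !E -subr_gt0 -sumrB.
rewrite (_ : \sum_k _ = D i j y); first exact: H.
by apply: eq_bigr => k _; rewrite dotBl mulrBl.
Qed.

(** [h] is a lower bound for the signal and [KS] an upper bound for the sum of the
    [<u_i - u_j, u_k>^2] over [k != i]. Its summand 4 is for [k = j], the one term that is of order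
    1. *)
Lemma upper_bound (e h KS : R) : 0 < e -> e <= 4^-1 ->
  h = (1 - 2 * e) * (1 - e) ->
  KS = (1 + e) * ((2 + 4 * e) * n%:R / d%:R) + 4 ->
  ((1 - (n%:R * (4 * expR (- (d%:R * e ^+ 2 / 8))) +
         n%:R ^+ 2 * (2 * expR (- (d%:R * e ^+ 2 / 4)) +
                      expR (- ((n%:R - 2) * e ^+ 2 / 8)) +
                      expR (- (h ^+ 2 * d%:R / (2 * KS * (1 + e)))))))%:E <= probPR R n d)%E.
Proof.
move=> e0 e4 hE KSE.
have e1 : e <= 2^-1 by lra.
have dR : 0 < d%:R :> R by rewrite ltr0n.
have h0 : 0 <= h by rewrite hE mulr_ge0; lra.
have KS0 : 0 < KS.
  rewrite KSE ltr_wpDl// mulr_ge0//; first by lra.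
  by rewrite divr_ge0 ?ler0n// mulr_ge0 ?ler0n//; lra.
pose x : Om := fun=> 0.
have s0 := s_gt0.
pose r2 (i j : 'I_n) := [seq k <- enum 'I_n | (k != i) && (k != j)].
pose w (i j : 'I_n) y := fun a => vec false i y a - vec false j y a.
pose bA (i : 'I_n) (c : bool) (up : bool) y : bool :=
  if up then (1 + e) * ((size (blk d c i))%:R * s ^+ 2) < \sum_(k <- blk d c i) y k ^+ 2
  else \sum_(k <- blk d c i) y k ^+ 2 < (1 - e) * ((size (blk d c i))%:R * s ^+ 2).
(* The guard makes the event void on the diagonal, so that all [n ^+ 2] pairs can be indexed
   uniformly. *)
pose bB (i j : 'I_n) (g : bool) y : bool := (i != j) &&
  ((dot (vec false i y) (vec false i y) <= 2) &&
   (e < (if g then 1 else -1) * dot (vec false i y) (vec false j y))).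
pose bC (i j : 'I_n) y : bool := (dot (w i j y) (w i j y) <= 2 + 4 * e) &&
   ((1 + e) * ((2 + 4 * e) * s ^+ 2 * (size (r2 i j))%:R) <
        \sum_(k <- r2 i j) dot (w i j y) (vec false k y) ^+ 2).
pose bD (i j : 'I_n) y : bool :=
   [&& \sum_(k | k != i) dot (w i j y) (vec false k y) ^+ 2 <= KS,
       dot (vec true i y) (vec true i y) <= 1 + e &
       h <= - \sum_(k | k != i) dot (w i j y) (vec false k y) *
              dot (vec true k y) (vec true i y)].
have mw i j a : measurable_fun setT (fun y => w i j y a).
  by apply: measurable_funB; exact: measurable_vec.
have mwu i j k : measurable_fun setT (fun y => dot (w i j y) (vec false k y)).
  by apply: measurable_dot => // a; exact: measurable_vec.
have mvv c k k' : measurable_fun setT (fun y : Om => dot (vec c k y) (vec c k' y)).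
  by apply: measurable_dot => // a; exact: measurable_vec.
have msz c i : (size (blk d c i))%:R = d%:R :> R by rewrite size_map size_enum_ord.
have dnorm c i y : \sum_(k <- blk d c i) y k ^+ 2 = dot (vec c i y) (vec c i y).
  by rewrite big_blk dot_sqr.
have ds : d%:R * s ^+ 2 = 1 by rewrite s_sqr divff// gt_eqF.
(* One index per exceptional event: for each [i], the family ([u] or [v]) and the side of the norm
   bound; for each pair, the sign of the inner product, the quadratic form and the noise. *)
pose P := ('I_n * (bool * bool) + 'I_n * 'I_n * (bool + (unit + unit)))%type.
pose ev (p : P) : Om -> bool := match p with
  | inl (i, (c, up)) => bA i c up
  | inr (i, j, inl g) => bB i j g
  | inr (i, j, inr (inl _)) => bC i j
  | inr (i, j, inr (inr _)) => bD i j end.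
pose cv (p : P) : R := match p with
  | inl (i, (c, up)) => expR (- (d%:R * e ^+ 2 / 8))
  | inr (i, j, inl g) => expR (- (d%:R * e ^+ 2 / 4))
  | inr (i, j, inr (inl _)) => expR (- ((n%:R - 2) * e ^+ 2 / 8))
  | inr (i, j, inr (inr _)) => expR (- (h ^+ 2 * d%:R / (2 * KS * (1 + e)))) end.
have r2size i j : n%:R - 2 <= (size (r2 i j))%:R :> R.
  have : (n <= size (r2 i j) + 2)%N.
    have := count_predC (fun k => (k != i) && (k != j)) (enum 'I_n).
    rewrite size_enum_ord /r2 size_filter => cE; rewrite -[leqLHS]cE leq_add2l.
    apply: (@leq_trans (count (pred1 i) (enum 'I_n) + count (pred1 j) (enum 'I_n))).
      rewrite -count_predUI; apply: (@leq_trans (count (predU (pred1 i) (pred1 j)) (enum 'I_n))); last exact: leq_addr.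
      by apply: sub_count => k /=; rewrite negb_and !negbK.
    by rewrite !count_uniq_mem ?enum_uniq// !mem_enum.
  by rewrite lerBlDr -natrD ler_nat.
have -> : n%:R * (4 * expR (- (d%:R * e ^+ 2 / 8))) +
         n%:R ^+ 2 * (2 * expR (- (d%:R * e ^+ 2 / 4)) +
                      expR (- ((n%:R - 2) * e ^+ 2 / 8)) +
                      expR (- (h ^+ 2 * d%:R / (2 * KS * (1 + e))))) = \sum_(p : P) cv p.
  rewrite big_sumType /=; congr (_ + _).
    rewrite (eq_bigr (fun=> expR (- (d%:R * e ^+ 2 / 8)))); last by move=> [i [c up]].
    rewrite sumr_const card_prod card_ord card_prod card_bool -[RHS]mulr_natl natrM; ring.
  pose ct (t : bool + (unit + unit)) := match t with
     | inl _ => expR (- (d%:R * e ^+ 2 / 4))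
     | inr (inl _) => expR (- ((n%:R - 2) * e ^+ 2 / 8))
     | inr (inr _) => expR (- (h ^+ 2 * d%:R / (2 * KS * (1 + e)))) end.
  rewrite (eq_bigr (fun q => ct q.2)); last by move=> [[i j] [g|[?|?]]].
  rewrite -(pair_bigA _ (fun _ t => ct t)) /= sumr_const card_prod !card_ord.
  rewrite -[RHS]mulr_natl natrM -expr2 !big_sumType /= !sumr_const card_bool !card_unit.
  by rewrite !mulr1n mulr2n; congr (_ * _); ring.
have evm p : measurable_fun setT (ev p).
  case: p => [[i [c [|]]]|[[i j] [g|[[]|[]]]]] /=.
  - by apply: measurable_fun_ltr => //; exact: measurable_sumsq.
  - by apply: measurable_fun_ltr => //; exact: measurable_sumsq.
  - apply: measurable_and; first exact: measurable_cst.
    apply: measurable_and; first exact: measurable_fun_ler.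
    by apply: measurable_fun_ltr => //; exact: measurable_funM.
  - apply: measurable_and.
      by apply: measurable_fun_ler => //; exact: measurable_dot.
    by apply: measurable_fun_ltr => //; apply: measurable_sum => k; exact: measurable_funX.
  - apply: measurable_and.
      apply: measurable_fun_ler => //.
      rewrite (_ : (fun _ => _) = fun y => \sum_(k <- [seq k <- enum 'I_n | k != i]) dot (w i j y) (vec false k y) ^+ 2).
        by apply: measurable_sum => k; exact: measurable_funX.
      by apply/funext => y; rewrite big_filter big_enum_cond.
    apply: measurable_and; first exact: measurable_fun_ler.
    apply: measurable_fun_ler => //; apply: measurableT_comp => //.
    rewrite (_ : (fun _ => _) = fun y => \sum_(k <- [seq k <- enum 'I_n | k != i]) dot (w i j y) (vec false k y) * dot (vec true k y) (vec true i y)).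
      by apply: measurable_sum => k; exact: measurable_funM.
    by apply/funext => y; rewrite big_filter big_enum_cond.
have evc p : (prob s (ev p) x <= (cv p)%:E)%E.
  case: p => [[i [c [|]]]|[[i j] [g|[[]|[]]]]] /=.
  - apply: le_trans (chisq_upper s0 x (blk_uniq d c i) (ltW e0) e1) _.
    by rewrite msz.
  - apply: le_trans (chisq_lower s0 x (blk_uniq d c i) (ltW e0)) _.
    by rewrite msz.
  - rewrite /bB; have [->|ij] /= := eqVneq i j.
      rewrite /prob (@marg_eq_at _ _ _ _ _ (fun=> 0%E)) ?marg_cst ?lee_fin ?expR_ge0//.
    have := inner_upper s0 false x ij (ltW e0) (g := if g then 1 else -1).
    rewrite s_sqr => H; apply: le_trans (H _) _; first by case: g {H}; rewrite ?normrN normr1.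
    by rewrite lee_fin ler_expR lerN2 invfM invrK; lra.
  - have := @quad_upper R n d _ s0 (r2 i j) i j (2 + 4 * e) e x.
    move=> H; apply: le_trans (H _ _ _ _ _ _) _ => //.
    + by rewrite filter_uniq ?enum_uniq.
    + by rewrite mem_filter eqxx.
    + by rewrite mem_filter eqxx andbF.
    + by lra.
    + exact: ltW.
    rewrite lee_fin ler_expR lerN2 ler_pM2r ?invr_gt0// ler_wpM2r ?sqr_ge0//.
  - have := @noise_upper R n d _ s0 i j KS (1 + e) h x KS0 _ h0.
    move=> H; apply: le_trans (H _) _; first by lra.
    rewrite lee_fin ler_expR lerN2 s_sqr le_eqVlt; apply/orP; left; apply/eqP.
    field; rewrite !lt0r_neq0//; lra.
apply: (@prob_union_ge R n d P (index_enum P) ev cv x evm evc) => y nPR.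
apply: contrapT => /negP /hasPn nb.
have {}nb p : ~~ ev p y by apply: nb; exact: mem_index_enum.
apply: nPR; apply: retrievable_hebbian => i j ji.
have Aup c k : dot (vec c k y) (vec c k y) <= 1 + e.
  by have := nb (inl (k, (c, true))); rewrite /= /bA -leNgt msz ds mulr1 dnorm.
have Alo c k : 1 - e <= dot (vec c k y) (vec c k y).
  by have := nb (inl (k, (c, false))); rewrite /= /bA -leNgt msz ds mulr1 dnorm.
have ij : i != j by rewrite eq_sym.
have B1 : dot (vec false i y) (vec false j y) <= e.
  have := nb (inr (i, j, inl true)); rewrite /= /bB ij /= mul1r negb_and -leNgt -ltNge.
  by case/orP => // lt2; have := Aup false i; lra.
have B2 : - e <= dot (vec false i y) (vec false j y).
  have := nb (inr (i, j, inl false)); rewrite /= /bB ij /= mulN1r negb_and -leNgt -ltNge.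
  by case/orP => [lt2|]; have := Aup false i; lra.
have wui : dot (w i j y) (vec false i y) = dot (vec false i y) (vec false i y) - dot (vec false i y) (vec false j y).
  by rewrite /w dotBl (dotC (vec false j y)).
have wuj : dot (w i j y) (vec false j y) = dot (vec false i y) (vec false j y) - dot (vec false j y) (vec false j y).
  by rewrite /w dotBl.
(* Two squared norms of at most [1 + e], and twice an inner product of at least [- e]. *)
have ww : dot (w i j y) (w i j y) <= 2 + 4 * e.
  rewrite {2}/w dotBr wui wuj; have := Aup false i; have := Aup false j; lra.
have Sr : \sum_(k <- r2 i j) dot (w i j y) (vec false k y) ^+ 2 <= (1 + e) * ((2 + 4 * e) * n%:R / d%:R).
  have := nb (inr (i, j, inr (inl tt))); rewrite /= /bC ww /= -leNgt => /le_trans; apply.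
  rewrite s_sqr (_ : (2 + 4 * e) * n%:R / d%:R = (2 + 4 * e) / d%:R * n%:R); last by ring.
  rewrite ler_wpM2l//; first by lra.
  rewrite ler_wpM2l//; first by rewrite mulr_ge0 ?invr_ge0 ?ler0n//; lra.
  by rewrite ler_nat size_filter -[leqRHS](size_enum_ord n) count_size.
have St : \sum_(k | k != i) dot (w i j y) (vec false k y) ^+ 2 <= KS.
  rewrite (bigD1 j)//= KSE addrC lerD//.
    by move: Sr; rewrite /r2 big_filter big_enum_cond.
  rewrite wuj -real_normK ?num_real// (_ : 4 = 2 ^+ 2); last by rewrite expr2; lra.
  rewrite lerXn2r ?nnegrE// ler_norml; have := Aup false j; have := Alo false j; lra.
have := nb (inr (i, j, inr (inr tt))); rewrite /= /bD St (Aup true i) /= -ltNge => lt.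
rewrite /D (bigD1 i)//= -/(w i j y) wui.
(* The first factor is at least [(1 - e) - e] and the second at least [1 - e], whence the formula
   for [h]. *)
have hle : h <= (dot (vec false i y) (vec false i y) - dot (vec false i y) (vec false j y)) * dot (vec true i y) (vec true i y).
  rewrite hE; have := Alo false i; have := Alo true i => q1 q2; apply: ler_pM => //; lra.
move: lt; set N := \sum_(_ | _) _ => lt; lra.
Qed.

End upper.

(** * Nets on the sphere *)

Section grid.
Context (R : realType) (d m : nat).
Hypothesis m0 : (0 < m)%N.
Local Notation norm f := (Num.sqrt (dot f f)).
Local Notation eta := (Num.sqrt d%:R / m%:R : R).

(** The grid of mesh [1 / m] in the cube [[-1, 1]^d]. It is larger than an optimal net of the
    sphere, but its points are trivial to count and are found by rounding. *)
Definition gridpt (f : {ffun 'I_d -> 'I_(2 * m).+1}) : 'I_d -> R :=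
  fun a => (f a)%:R / m%:R - 1.

(** Each coordinate is rounded down, with an error of at most [1 / m]. The lower bound on the norm
    follows by pairing the grid point with [x]. *)
Lemma grid_approx (x : 'I_d -> R) : dot x x = 1 ->
  exists f, norm (fun a => x a - gridpt f a) <= eta /\ 1 - eta <= norm (gridpt f).
Proof.
move=> x1; have mR : 0 < m%:R :> R by rewrite ltr0n.
have xa a : `|x a| <= 1.
  rewrite -(@ler_pXn2r _ 2) ?nnegrE// expr1n real_normK ?num_real// -x1 dot_sqr (bigD1 a)//=.
  by rewrite lerDl sumr_ge0// => b _; exact: sqr_ge0.
pose k a := Num.truncn ((x a + 1) * m%:R).
have kP a : (k a)%:R <= (x a + 1) * m%:R < (k a).+1%:R.
  by apply: Num.Theory.truncn_itv; rewrite mulr_ge0 ?ler0n//; have := xa a; rewrite ler_norml; lra.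
have k2 a : (k a < (2 * m).+1)%N.
  rewrite ltnS -(ler_nat R); have /andP[/le_trans le _] := kP a; apply: le.
  by rewrite natrM ler_wpM2r ?ler0n//; have := xa a; rewrite ler_norml; lra.
pose f : {ffun 'I_d -> 'I_(2 * m).+1} := [ffun a => inord (k a)].
have fE a : gridpt f a = (k a)%:R / m%:R - 1 by rewrite /gridpt ffunE inordK.
have dist a : (x a - gridpt f a) ^+ 2 <= m%:R^-1 ^+ 2.
  rewrite -real_normK ?num_real// lerXn2r ?nnegrE ?invr_ge0 ?ler0n//.
  have /andP[k1 k3] := kP a; rewrite fE.
  have u1 : (k a)%:R / m%:R <= x a + 1 by rewrite ler_pdivrMr.
  have u2 : x a + 1 < ((k a)%:R + 1) / m%:R by rewrite ltr_pdivlMr// natr1.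
  rewrite mulrDl mul1r in u2.
  rewrite ler_norml; lra.
have D1 : norm (fun a => x a - gridpt f a) <= eta.
  have -> : eta = Num.sqrt (d%:R * m%:R^-1 ^+ 2).
    by rewrite sqrtrM ?ler0n// sqrtr_sqr ger0_norm// invr_ge0 ler0n.
  rewrite ler_sqrt ?mulr_ge0 ?ler0n ?sqr_ge0//.
  rewrite dot_sqr; apply: le_trans (ler_sum _ (fun a _ => dist a)) _.
  by rewrite sumr_const card_ord -[leLHS]mulr_natl.
exists f; split => //.
have x1' : norm x = 1 by rewrite x1 sqrtr1.
have E : dot (gridpt f) x = 1 - dot (fun a => x a - gridpt f a) x.
  by rewrite dotBl x1 subKr.
have := dot_norm_le (gridpt f) x; have := dot_norm_le (fun a => x a - gridpt f a) x.
rewrite x1' !mulr1 E !ler_norml => /andP[_ h1] /andP[_ h2].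
by apply: le_trans h2; rewrite lerD2l lerN2; exact: le_trans h1 D1.
Qed.

Lemma norm_unit (x : 'I_d -> R) : 0 < norm x -> dot (fun a => (norm x)^-1 * x a) (fun a => (norm x)^-1 * x a) = 1.
Proof.
move=> c0; rewrite dotZl dotC dotZl mulrA -expr2 exprVn sqr_sqrtr ?dot_ge0//.
by rewrite mulVf// gt_eqF// -sqrtr_gt0.
Qed.

Lemma dot_eq0 (x g : 'I_d -> R) : norm x = 0 -> dot x g = 0.
Proof.
move=> x0; have := dot_norm_le x g; rewrite x0 mul0r normr_le0 => /eqP//.
Qed.

Hypothesis eta1 : eta < 1.

(** By homogeneity [x] may be taken of norm 1. The index that works for a nearby grid point works
    for [x], at a cost of [eta] times the norm of [u j]; [eta < 1] ensures that this grid point is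
    not the origin, about which nothing is assumed. *)
Lemma net_max n (u : 'I_n -> 'I_d -> R) (t K : R) :
  (0 < n)%N -> 0 <= t -> (forall j, dot (u j) (u j) <= K) ->
  (forall f, 0 < dot (gridpt f) (gridpt f) ->
     exists j, t * norm (gridpt f) <= dot (gridpt f) (u j)) ->
  forall x, exists j, (t * (1 - eta) - eta * Num.sqrt K) * norm x <= dot x (u j).
Proof.
move=> n0 t0 uK H x.
have eta0 : 0 <= eta by rewrite divr_ge0 ?sqrtr_ge0 ?ler0n.
have : 0 <= norm x by exact: sqrtr_ge0.
rewrite le_eqVlt => /orP[/eqP x0|x0].
  by exists (Ordinal n0); rewrite -x0 mulr0 dot_eq0.
set c := norm x in x0 *.
have [f [D1 D2]] := grid_approx (norm_unit x0).
have z0 : 0 < dot (gridpt f) (gridpt f).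
  rewrite -sqrtr_gt0; apply: lt_le_trans D2; rewrite subr_gt0; exact: eta1.
have [j jP] := H f z0; exists j.
set x' := fun a => c^-1 * x a in D1.
have -> : dot x (u j) = dot x' (u j) * c.
  by rewrite /x' dotZl mulrAC mulVf ?mul1r// gt_eqF.
rewrite ler_pM2r//.
have -> : dot x' (u j) = dot (gridpt f) (u j) + dot (fun a => x' a - gridpt f a) (u j).
  by rewrite (dotBl x') addrC subrK.
apply: lerD.
  by apply: le_trans jP; rewrite ler_wpM2l.
have := dot_norm_le (fun a => x' a - gridpt f a) (u j).
rewrite ler_norml => /andP[h _]; apply: le_trans h; rewrite lerN2.
apply: ler_pM => //; rewrite ?sqrtr_ge0//.
rewrite ler_wsqrtr//.
Qed.

(** As in [net_max], but the rounding error is paid in each of the [n] summands. *)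
Lemma net_sum n (v : 'I_n -> 'I_d -> R) (t K : R) :
  0 <= t -> (forall j, dot (v j) (v j) <= K) ->
  (forall f, 0 < dot (gridpt f) (gridpt f) ->
     t * norm (gridpt f) <= \sum_j `|dot (gridpt f) (v j)|) ->
  forall x, (t * (1 - eta) - n%:R * (eta * Num.sqrt K)) * norm x <= \sum_j `|dot x (v j)|.
Proof.
move=> t0 vK H x.
have eta0 : 0 <= eta by rewrite divr_ge0 ?sqrtr_ge0 ?ler0n.
have : 0 <= norm x by exact: sqrtr_ge0.
rewrite le_eqVlt => /orP[/eqP x0|x0].
  by rewrite -x0 mulr0 sumr_ge0.
set c := norm x in x0 *.
have [f [D1 D2]] := grid_approx (norm_unit x0).
have z0 : 0 < dot (gridpt f) (gridpt f).
  rewrite -sqrtr_gt0; apply: lt_le_trans D2; rewrite subr_gt0; exact: eta1.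
have fP := H f z0.
set x' := fun a => c^-1 * x a in D1.
have -> : \sum_j `|dot x (v j)| = (\sum_j `|dot x' (v j)|) * c.
  rewrite mulr_suml; apply: eq_bigr => j _.
  rewrite /x' dotZl normrM mulrAC ger0_norm ?invr_ge0 ?ltW// mulVf ?mul1r// gt_eqF//.
rewrite ler_pM2r// lerBlDr.
apply: (@le_trans _ _ (\sum_j (`|dot x' (v j)| + eta * Num.sqrt K))); last first.
  by rewrite big_split/= sumr_const card_ord mulr_natl.
apply: (@le_trans _ _ (\sum_j `|dot (gridpt f) (v j)|)).
  by apply: le_trans fP; rewrite ler_wpM2l.
apply: ler_sum => j _.
have -> : dot (gridpt f) (v j) = dot x' (v j) - dot (fun a => x' a - gridpt f a) (v j).
  by rewrite (dotBl x') subKr.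
apply: le_trans (ler_normB _ _) _; rewrite lerD2l.
apply: le_trans (dot_norm_le _ _) _.
apply: ler_pM => //; rewrite ?sqrtr_ge0//.
rewrite ler_wsqrtr//.
Qed.

End grid.

(** * The lower regime: no matrix retrieves *)

Section lower.
Context (R : realType) (n d : nat).
Hypotheses (d0 : (0 < d)%N) (n2 : (1 < n)%N).
Local Notation J := (bool * 'I_n * 'I_d)%type.
Local Notation Om := (cspace R J).
Local Notation s := (Num.sqrt (d%:R^-1) : R).
Local Notation norm f := (Num.sqrt (dot f f)).
Implicit Types (y : Om).

(** The deterministic core: the sum of the diagonal scores is at least [al * be] and at most [ga]
    times the Frobenius norm [om] of [W]. *)
Lemma not_retrievable y (al be ga : R) : 0 <= al -> 0 <= ga ->
  (forall x, exists j, al * norm x <= dot x (vec false j y)) ->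
  (forall x, be * norm x <= \sum_k `|dot x (vec true k y)|) ->
  \sum_a \sum_b (\sum_k vec false k y a * vec true k y b) ^+ 2 <= ga ^+ 2 ->
  ga < al * be -> ~ retrievable y.
Proof.
move=> al0 ga0 HA HB HC gab [W HW].
pose X i a := \sum_b W a b * vec true i y b.
have bE i j : \sum_a \sum_b vec false j y a * W a b * vec true i y b = dot (X i) (vec false j y).
  apply: eq_bigr => a _; rewrite /X mulr_suml; apply: eq_bigr => b _.
  by rewrite -mulrA mulrC.
(* [X i] is [W v_i]. Some [u_j] has a large product with it, and retrieval makes [u_i] at least as
   good. *)
have low i : al * norm (X i) <= dot (X i) (vec false i y).
  have [j jP] := HA (X i); apply: le_trans jP _.
  by have [->//|ji] := eqVneq j i; have := HW i j ji; rewrite !bE => /ltW.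
pose M a b := \sum_k vec false k y a * vec true k y b.
pose om2 := \sum_(p : 'I_d * 'I_d) W p.1 p.2 ^+ 2.
pose om := Num.sqrt om2.
have om20 : 0 <= om2 by apply: sumr_ge0 => p _; exact: sqr_ge0.
have rowE : om2 = \sum_a dot (fun b => W a b) (fun b => W a b).
  by rewrite /om2 -(pair_bigA _ (fun a b => W a b ^+ 2)) /=; apply: eq_bigr => a _; rewrite dot_sqr.
have omE : om ^+ 2 = om2 by rewrite sqr_sqrtr.
(* A zero matrix gives equal scores, contradicting the strict inequality between two distinct
   indices; this is where [1 < n] enters. *)
have om0 : 0 < om.
  rewrite lt_neqAle sqrtr_ge0 andbT; apply/negP => /eqP om0.
  have W0 a b : W a b = 0.
    apply/eqP; rewrite -sqrf_eq0.
    have : om2 == 0 by rewrite -omE -om0 expr0n.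
    rewrite psumr_eq0 => [/allP/(_ (a, b))|? _]; last exact: sqr_ge0.
    by rewrite mem_index_enum => /(_ isT).
  have i1 : (0 < n)%N by exact: ltnW.
  have := HW (Ordinal i1) (Ordinal n2) isT.
  by rewrite !big1 ?ltxx// => a _; rewrite big1// => b _; rewrite W0 mulr0 mul0r.
have upp : \sum_i dot (X i) (vec false i y) <= om * ga.
  have -> : \sum_i dot (X i) (vec false i y) = \sum_(p : 'I_d * 'I_d) W p.1 p.2 * M p.1 p.2.
    rewrite -(pair_bigA _ (fun a b => W a b * M a b)) /= /dot exchange_big /=.
    apply: eq_bigr => a _; rewrite /X /M.
    under eq_bigr do rewrite mulr_suml.
    rewrite exchange_big /=; apply: eq_bigr => b _; rewrite mulr_sumr.
    by apply: eq_bigr => k _; rewrite -mulrA [vec true _ _ _ * _]mulrC.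
  have CS := cauchy_schwarz (fun p : 'I_d * 'I_d => W p.1 p.2) (fun p => M p.1 p.2).
  apply: le_trans (ler_norm _) _.
  rewrite -(@ler_pXn2r _ 2) ?nnegrE ?mulr_ge0 ?sqrtr_ge0// real_normK ?num_real//.
  apply: le_trans CS _; rewrite exprMn omE ler_wpM2l//.
  by rewrite -(pair_bigA _ (fun a b => M a b ^+ 2)) /=.
(* Cauchy-Schwarz over the rows of [W] reduces the bound to single vectors. *)
have Xlow : be * om <= \sum_i norm (X i).
  rewrite -(ler_pM2r om0) -mulrA -expr2 omE rowE mulr_sumr mulr_suml.
  apply: (@le_trans _ _ (\sum_a norm (fun b => W a b) * \sum_k `|dot (fun b => W a b) (vec true k y)|)).
    apply: ler_sum => a _.
    have wE : dot (fun b => W a b) (fun b => W a b) = norm (fun b => W a b) * norm (fun b => W a b).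
      by rewrite -expr2 sqr_sqrtr ?dot_ge0.
    by rewrite [X in be * X]wE mulrA mulrC ler_wpM2l ?sqrtr_ge0.
  under eq_bigr do rewrite mulr_sumr.
  rewrite exchange_big /=; apply: ler_sum => i _.
  have CS := cauchy_schwarz (fun a => norm (fun b => W a b)) (fun a => `|dot (fun b => W a b) (vec true i y)|).
  apply: le_trans (ler_norm _) _.
  rewrite -(@ler_pXn2r _ 2) ?nnegrE ?mulr_ge0 ?sqrtr_ge0// real_normK ?num_real//.
  apply: le_trans CS _; rewrite exprMn omE rowE sqr_sqrtr ?dot_ge0// mulrC.
  apply: ler_pM.
  - by apply: sumr_ge0 => a _; exact: sqr_ge0.
  - by apply: sumr_ge0 => a _; exact: sqr_ge0.
  - rewrite dot_sqr le_eqVlt; apply/orP; left; apply/eqP; apply: eq_bigr => a _.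
    by rewrite real_normK ?num_real.
  - rewrite le_eqVlt; apply/orP; left; apply/eqP; apply: eq_bigr => a _.
    by rewrite sqr_sqrtr// dot_ge0.
have : al * (be * om) <= om * ga.
  apply: le_trans upp; apply: (@le_trans _ _ (\sum_i al * norm (X i))).
    by rewrite -mulr_sumr ler_wpM2l.
  by apply: ler_sum => i _; exact: low.
by rewrite mulrA mulrC ler_pM2l// leNgt gab.
Qed.

(** [K] bounds the total energy of the [u_k], or of the [v_k]. It also serves for each single
    vector: this is very lossy, but it only multiplies [eta], which a fine grid makes tiny. *)
Lemma lower_bound (m : nat) (e t : R) : (0 < m)%N -> 0 < e -> e <= 2^-1 -> 0 <= t ->
  let eta := Num.sqrt d%:R / m%:R in
  let K := (1 + e) * n%:R in
  let al := t * s * (1 - eta) - eta * Num.sqrt K in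
  let be := (1 - e) * n%:R * s * Num.sqrt (2 / pi) * (1 - eta) - n%:R * (eta * Num.sqrt K) in
  eta < 1 -> 0 <= al -> (1 + e) * Num.sqrt n%:R < al * be ->
  (probPR R n d <= (2 * expR (- (n%:R * d%:R * e ^+ 2 / 8)) + expR (- (d%:R * e ^+ 2 / 8)) +
    (2 * m).+1%:R ^+ d * (expR (- (n%:R * (normal_peak 1 * expR (- (t + 1) ^+ 2 / 2)))) +
      expR (- (n%:R * e ^+ 2 * (2 / pi) / 24))))%:E)%E.
Proof.
move=> m0 e0 e1 t0 eta K al be eta1 al0 gab.
have s0 : 0 < s by exact: s_gt0.
have nR : 0 < n%:R :> R by rewrite ltr0n ltnW.
have dR : 0 < d%:R :> R by rewrite ltr0n.
have ds : d%:R * s ^+ 2 = 1 by rewrite s_sqr divff// gt_eqF.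
have K0 : 0 < K by rewrite mulr_gt0//; lra.
pose x : Om := fun=> 0.
pose all_blk b := flatten [seq blk d b i | i <- enum 'I_n].
have abu b : uniq (all_blk b) by rewrite blks_uniq ?enum_uniq.
have abs b : (size (all_blk b))%:R = n%:R * d%:R :> R by rewrite size_blks size_enum_ord natrM.
pose z f := @gridpt R d m f.
pose bF (b : bool) y : bool := (1 + e) * ((size (all_blk b))%:R * s ^+ 2) < \sum_(j <- all_blk b) y j ^+ 2.
pose bG y : bool := (\sum_(k <- enum 'I_n) dot (vec true k y) (vec true k y) <= K) &&
     ((1 + e) * (d%:R * s ^+ 2 * K) <
      \sum_(a <- enum 'I_d) \sum_b (\sum_(k <- enum 'I_n) vec false k y a * vec true k y b) ^+ 2).
(* The grid contains the origin, which the tail bounds exclude. *)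
pose bT f y : bool := (0 < dot (z f) (z f)) &&
   all (fun j => dot (z f) (vec false j y) < t * (s * norm (z f))) (enum 'I_n).
pose bS f y : bool := (0 < dot (z f) (z f)) && (\sum_(k <- enum 'I_n) `|dot (z f) (vec true k y)| <
        (1 - e) * n%:R * (s * norm (z f)) * Num.sqrt (2 / pi)).
pose P := (bool + (unit + ({ffun 'I_d -> 'I_(2 * m).+1} + {ffun 'I_d -> 'I_(2 * m).+1})))%type.
pose ev (p : P) : Om -> bool := match p with
  | inl b => bF b | inr (inl _) => bG
  | inr (inr (inl f)) => bT f | inr (inr (inr f)) => bS f end.
pose cv (p : P) : R := match p with
  | inl b => expR (- (n%:R * d%:R * e ^+ 2 / 8)) | inr (inl _) => expR (- (d%:R * e ^+ 2 / 8))
  | inr (inr (inl f)) => expR (- (n%:R * (normal_peak 1 * expR (- (t + 1) ^+ 2 / 2))))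
  | inr (inr (inr f)) => expR (- (n%:R * e ^+ 2 * (2 / pi) / 24)) end.
have -> : 2 * expR (- (n%:R * d%:R * e ^+ 2 / 8)) + expR (- (d%:R * e ^+ 2 / 8)) +
    (2 * m).+1%:R ^+ d * (expR (- (n%:R * (normal_peak 1 * expR (- (t + 1) ^+ 2 / 2)))) +
      expR (- (n%:R * e ^+ 2 * (2 / pi) / 24))) = \sum_(p : P) cv p.
  rewrite !big_sumType /= !sumr_const card_bool card_unit card_ffun !card_ord.
  move: (expR _) (expR _) (expR _) (expR _) => X4 X3 X2 X1.
  rewrite mulr1n -[X1 *+ 2]mulr_natl -[X3 *+ _]mulr_natl -[X4 *+ _]mulr_natl natrX.
  by move: (_ ^+ d) => N; ring.
have mvv c k k' : measurable_fun setT (fun y : Om => dot (vec c k y) (vec c k' y)).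
  by apply: measurable_dot => // a; exact: measurable_vec.
have mzv f c k : measurable_fun setT (fun y : Om => dot (z f) (vec c k y)).
  by apply: measurable_dot => // a; exact: measurable_vec.
have evm p : measurable_fun setT (ev p).
  case: p => [b|[[]|[f|f]]] /=.
  - by apply: measurable_fun_ltr => //; exact: measurable_sumsq.
  - apply: measurable_and; first by apply: measurable_fun_ler => //; exact: measurable_sum.
    apply: measurable_fun_ltr => //; apply: measurable_sum => a; apply: measurable_sum => b.
    apply: measurable_funX; apply: measurable_sum => k.
    by apply: measurable_funM; exact: measurable_vec.
  - apply: measurable_and; first exact: measurable_cst.
    by apply: measurable_all => j; exact: measurable_fun_ltr.
  - apply: measurable_and; first exact: measurable_cst.
    apply: measurable_fun_ltr => //; apply: measurable_sum => j.
    exact: measurableT_comp.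
have evc p : (prob s (ev p) x <= (cv p)%:E)%E.
  have pr0 (c : R) : (prob s (fun _ : Om => false) x <= (expR c)%:E)%E.
    by rewrite /prob marg_cst lee_fin expR_ge0.
  case: p => [b|[[]|[f|f]]] /=.
  - apply: le_trans (chisq_upper s0 x (abu b) (ltW e0) e1) _.
    by rewrite abs.
  - by have := @gram_upper R n d _ s0 K e x K0 (ltW e0) e1.
  - rewrite /bT; case: (ltP 0 (dot (z f) (z f))) => /= z0; last exact: pr0.
    exact: tail_all.
  - rewrite /bS; case: (ltP 0 (dot (z f) (z f))) => /= z0; last exact: pr0.
    by apply: abs_sum_lower => //; exact: ltW.
apply: (@prob_union_le R n d P (index_enum P) ev cv x evm evc) => y Ry.
apply: contrapT => /negP /hasPn nb.
have {}nb p : ~~ ev p y by apply: nb; exact: mem_index_enum.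
have F b : \sum_(k <- enum 'I_n) dot (vec b k y) (vec b k y) <= K.
  have := nb (inl b); rewrite /= /bF -leNgt abs /all_blk big_blks.
  rewrite -mulrA ds mulr1; apply: le_trans.
  by apply: ler_sum => k _; rewrite dot_sqr.
have Fk b k : dot (vec b k y) (vec b k y) <= K.
  apply: le_trans (F b); rewrite big_enum (bigD1 k)//= lerDl sumr_ge0// => k' _; exact: dot_ge0.
(* One factor [1 + e] is the deviation in [gram_upper], the other is already in [K]. *)
have G : \sum_a \sum_b (\sum_k vec false k y a * vec true k y b) ^+ 2 <= ((1 + e) * Num.sqrt n%:R) ^+ 2.
  have := nb (inr (inl tt)); rewrite /= /bG (F true) /= -leNgt ds mul1r.
  rewrite exprMn sqr_sqrtr ?ler0n// /K mulrA -expr2; apply: le_trans.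
  rewrite big_enum le_eqVlt; apply/orP; left; apply/eqP.
  apply: eq_bigr => a _; apply: eq_bigr => b _.
  by rewrite big_enum.
apply: (@not_retrievable y al be ((1 + e) * Num.sqrt n%:R)) => //.
- by rewrite mulr_ge0 ?sqrtr_ge0//; lra.
- apply: (@net_max R d m m0 eta1 n (fun j => vec false j y) (t * s) K) => //.
  + exact: ltnW.
  + by rewrite mulr_ge0// ltW.
  + move=> f z0; have := nb (inr (inr (inl f))); rewrite /= /bT /z z0 /= => /allPn[j _].
    by rewrite -leNgt mulrA => le; exists j.
- apply: (@net_sum R d m m0 eta1 n (fun j => vec true j y) ((1 - e) * n%:R * s * Num.sqrt (2 / pi)) K) => //.
  + by rewrite !mulr_ge0 ?sqrtr_ge0 ?ler0n//; lra.
  + move=> f z0; have := nb (inr (inr (inr f))); rewrite /= /bS /z z0 /= -leNgt big_enum.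
    by apply: le_trans; rewrite le_eqVlt; apply/orP; left; apply/eqP; ring.
Qed.

End lower.

(** * Asymptotics *)

Section asymptotics.
Context {R : realType}.
Implicit Types (e eps x L M rho : R) (n d : nat).

Lemma le_from_sqr (x y : R) : 0 <= y -> x ^+ 2 <= y ^+ 2 -> x <= y.
Proof. by move=> y0; apply: contra_le => yx; rewrite ltrXn2r// ltW. Qed.

Lemma lt_from_sqr (x y : R) : 0 <= y -> x ^+ 2 < y ^+ 2 -> x < y.
Proof.
by move=> y0; apply: contra_lt => yx; rewrite lerXn2r// nnegrE (le_trans y0).
Qed.

Lemma ln_nat_large M : exists N : nat, forall n, (N <= n)%N ->
  (0 < n)%N /\ M <= ln (n%:R : R).
Proof.
exists (Num.truncn (expR M)).+1 => n Nn; have n0 : (0 < n)%N by lia.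
split => //; rewrite -[M]expRK ler_ln ?posrE ?expR_gt0 ?ltr0n//.
have /andP[_ lt] := Num.Theory.truncn_itv (expR_ge0 M).
by apply: le_trans (ltW lt) _; rewrite ler_nat.
Qed.

Lemma expR_ge_cube x : 0 <= x -> x ^+ 3 / 6 <= expR x.
Proof.
move=> x0; apply: le_trans (expR_ge1Dxn 2 x0).
by rewrite (_ : 3`!%:R = 6)//; lra.
Qed.

Lemma expR_ge_sqr x : 0 <= x -> x ^+ 2 / 2 <= expR x.
Proof.
move=> x0; apply: le_trans (expR_ge1Dxn 1 x0).
by rewrite (_ : 2`!%:R = 2)//; lra.
Qed.

Lemma expRN_le_inv x : 0 < x -> expR (- x) <= x^-1.
Proof.
move=> x0; rewrite expRN lef_pV2 ?posrE ?expR_gt0//.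
by apply: le_trans (expR_ge1Dx x); lra.
Qed.

(** At [e = 0] the inequality reads [8 <= rho]. To first order the sides are controlled by
    [8 * (1 + 7 * e)] and [(1 - 7 * e) * rho], which [e] of order [(rho - 8) / (rho + 8)] keeps in
    order. *)
Lemma upper_param rho : 8 < rho -> exists e, [/\ 0 < e, e <= 8^-1 &
  (2 + e) * 2 * (1 + e) * ((1 + e) * (2 + 4 * e)) <=
  (1 - e) * ((1 - 2 * e) * (1 - e)) ^+ 2 * rho].
Proof.
move=> r8; pose e := (rho - 8) / (8 * (rho + 8)).
have r0 : 0 < 8 * (rho + 8) by lra.
have e0 : 0 < e by rewrite divr_gt0//; lra.
have e8 : e <= 8^-1 by rewrite ler_pdivrMr//; lra.
exists e; split => //.
have eE : 8 * e * (rho + 8) = rho - 8.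
  by rewrite /e; field; lra.
have h1 : 1 - 7 * e <= (1 - e) * ((1 - 2 * e) * (1 - e)) ^+ 2.
  have -> : (1 - e) * ((1 - 2 * e) * (1 - e)) ^+ 2 =
    1 - 7 * e + e ^+ 2 * (19 - 25 * e + 16 * e ^+ 2 - 4 * e ^+ 3) by ring.
  rewrite lerDl mulr_ge0 ?sqr_ge0//.
  have : e ^+ 3 <= 1 by apply: exprn_ile1; lra.
  have := sqr_ge0 e; lra.
have h2 : (2 + e) * 2 * (1 + e) * ((1 + e) * (2 + 4 * e)) <= 8 * (1 + 7 * e).
  have -> : (2 + e) * 2 * (1 + e) * ((1 + e) * (2 + 4 * e)) =
    8 + 36 * e + 56 * e ^+ 2 + 36 * e ^+ 3 + 8 * e ^+ 4 by ring.
  have e2 : e ^+ 2 <= 8^-1 * e by rewrite expr2 ler_pM2r.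
  have e3 : e ^+ 3 <= 8^-1 * e ^+ 2 by rewrite exprS ler_wpM2r ?sqr_ge0.
  have e4 : e ^+ 4 <= 8^-1 * e ^+ 3 by rewrite [e ^+ 4]exprS ler_wpM2r ?exprn_ge0// ltW.
  lra.
apply: le_trans h2 _; apply: le_trans (_ : (1 - 7 * e) * rho <= _).
  by nra.
by rewrite ler_wpM2r//; lra.
Qed.

Lemma upper_eps rho eps : 8 < rho -> 0 < eps ->
  exists N : nat, forall n d, (N <= n)%N ->
    rho * n%:R * ln n%:R <= d%:R ^+ 2 -> ((1 - eps)%:E <= probPR R n d)%E.
Proof.
move=> r8 eps0; have [e [e0 e8 key]] := upper_param r8.
(* This gives [d * e >= 80 * L], where 80 is 4 times 20: it absorbs the summand 4 of [KS] in the
   bound [E4], given [h ^+ 2 >= 1 / 4]. *)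
pose C := 80 / e ^+ 2.
have e2 : 0 < e ^+ 2 by rewrite exprn_gt0.
have C80 : 80 <= C.
  by rewrite ler_pdivlMr// -[leRHS]mulr1 ler_pM2l//; apply: exprn_ile1; lra.
have [N HN] := ln_nat_large (Num.max (2 * C ^+ 2) (Num.max 1 (8 / (e * eps)))).
exists N => n d /HN[n0]; set L := ln _; rewrite !ge_max => /and3P[L1 L2 L3] hd.
have nE : n%:R = expR L :> R by rewrite lnK// posrE ltr0n.
have L0 : 0 < L by lra.
have nR : 0 < n%:R :> R by rewrite ltr0n.
have nC : C ^+ 2 * L <= n%:R.
  rewrite nE; apply: le_trans (expR_ge_sqr (ltW L0)).
  have : 2 * C ^+ 2 * L <= L * L by rewrite ler_pM2r.
  rewrite expr2; lra.
have dC : C * L <= d%:R.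
  apply: le_from_sqr; first exact: ler0n.
  apply: le_trans hd; rewrite exprMn [L ^+ 2]expr2 mulrA.
  rewrite ler_pM2r//; apply: le_trans nC _; rewrite ler_peMl ?ler0n//; lra.
have dR : 0 < d%:R :> R by apply: lt_le_trans dC; rewrite mulr_gt0//; lra.
have d0 : (0 < d)%N by rewrite -(ltr0n R).
have Ce : C * e ^+ 2 = 80 by rewrite /C divfK// gt_eqF.
have de : 80 * L <= d%:R * e ^+ 2.
  by rewrite -Ce mulrAC ler_pM2r.
have ne : 80 * L <= (n%:R - 2) * e ^+ 2.
  rewrite -Ce mulrAC ler_pM2r// lerBrDr; apply: le_trans nC; rewrite expr2; nra.
set h := (1 - 2 * e) * (1 - e) in key.
set KS := (1 + e) * ((2 + 4 * e) * n%:R / d%:R) + 4.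
have e4 : e <= 4^-1 by lra.
apply: le_trans (@upper_bound R n d d0 e h KS e0 e4 erefl erefl); rewrite lee_fin lerD2l lerN2.
have h2 : 4^-1 <= h ^+ 2.
  have : 2^-1 <= h by rewrite /h; nra.
  by nra.
have KS0 : 0 < KS.
  rewrite /KS ltr_wpDl// mulr_ge0//; first by lra.
  by rewrite divr_ge0 ?ler0n// mulr_ge0 ?ler0n//; lra.
have E4 : (2 + e) * L <= h ^+ 2 * d%:R / (2 * KS * (1 + e)).
  have p0 : 0 < 2 * KS * (1 + e) by rewrite !mulr_gt0//; lra.
  rewrite ler_pdivlMr// -(ler_pM2r dR).
  have -> : (2 + e) * L * (2 * KS * (1 + e)) * d%:R =
    (2 + e) * 2 * (1 + e) * ((1 + e) * (2 + 4 * e)) * (n%:R * L) + (2 + e) * 8 * (1 + e) * L * d%:R.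
    by rewrite /KS; field; exact: lt0r_neq0.
  (* The share [1 - e] pays for the main term of [KS] through [upper_param], the share [e] for its
     summand 4. *)
  have -> : h ^+ 2 * d%:R * d%:R = (1 - e) * h ^+ 2 * d%:R ^+ 2 + e * h ^+ 2 * d%:R * d%:R by ring.
  apply: lerD.
    apply: (@le_trans _ _ ((1 - e) * h ^+ 2 * rho * (n%:R * L))).
      by rewrite ler_pM2r// mulr_gt0.
    rewrite -mulrA ler_wpM2l//; last by rewrite mulrA.
    by rewrite mulr_ge0 ?sqr_ge0//; lra.
  rewrite ler_pM2r//.
  apply: (@le_trans _ _ (20 * L)).
    by rewrite ler_pM2r//; nra.
  apply: (@le_trans _ _ (e * 4^-1 * d%:R)); last by rewrite ler_pM2r// ler_pM2l.
  have : d%:R * e ^+ 2 <= d%:R * e by rewrite ler_pM2l// expr2 ler_piMr//; lra.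
  lra.
have expL k : expR L ^+ k = expR (k%:R * L) by rewrite expRM_natl.
(* Each family of events costs a multiple of n^(- e), and the multiples 4, 2, 1, 1 add up to 8. *)
apply: (@le_trans _ _ (8 * expR (- (e * L)))); last first.
  apply: (@le_trans _ _ (8 * (e * L)^-1)).
    by rewrite ler_pM2l// expRN_le_inv// mulr_gt0.
  rewrite ler_pdivrMr ?mulr_gt0//.
  by move: L3; rewrite ler_pdivrMr ?mulr_gt0//; lra.
have eL : e * L <= L by rewrite ler_piMl ?(ltW L0)//; lra.
have X1 : n%:R * (4 * expR (- (d%:R * e ^+ 2 / 8))) <= 4 * expR (- (e * L)).
  rewrite nE mulrCA -expRD ler_pM2l// ler_expR; lra.
have sq : n%:R ^+ 2 = expR (2 * L) by rewrite nE expL.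
have X2 : n%:R ^+ 2 * (2 * expR (- (d%:R * e ^+ 2 / 4))) <= 2 * expR (- (e * L)).
  rewrite sq mulrCA -expRD ler_pM2l// ler_expR; lra.
have X3 : n%:R ^+ 2 * expR (- ((n%:R - 2) * e ^+ 2 / 8)) <= expR (- (e * L)).
  rewrite sq -expRD ler_expR; lra.
have X4 : n%:R ^+ 2 * expR (- (h ^+ 2 * d%:R / (2 * KS * (1 + e)))) <= expR (- (e * L)).
  rewrite sq -expRD ler_expR; lra.
rewrite [n%:R ^+ 2 * (_ + _)]mulrDr [n%:R ^+ 2 * (_ + _)]mulrDr; lra.
Qed.

(** At [e = 0] this is [rho < q]. The sides are compared with [(1 + 3 * e) * rho] and
    [(1 - 10 * e) * q], and the gap [q - rho = 16 * e * q] covers both losses. *)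
Lemma lower_param rho (q : R) : 0 < rho -> rho < q -> exists e, [/\ 0 < e, e <= 16^-1 &
  (1 + e) ^+ 2 * rho < ((1 - e) ^+ 2 * (1 - 3 * e)) ^+ 2 * q].
Proof.
move=> r0 rq; have q0 : 0 < q by lra.
pose e := (q - rho) / (16 * q).
have e0 : 0 < e by rewrite divr_gt0//; lra.
have e16 : e <= 16^-1 by rewrite ler_pdivrMr; lra.
exists e; split => //.
have eE : 16 * e * q = q - rho by rewrite /e; field; lra.
have h1 : 1 - 10 * e <= ((1 - e) ^+ 2 * (1 - 3 * e)) ^+ 2.
  have a1 : 1 - 5 * e <= (1 - e) ^+ 2 * (1 - 3 * e) by nra.
  have : (1 - 5 * e) ^+ 2 <= ((1 - e) ^+ 2 * (1 - 3 * e)) ^+ 2.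
    by rewrite lerXn2r ?nnegrE//; nra.
  by apply: le_trans; nra.
apply: (@lt_le_trans _ _ ((1 - 10 * e) * q)); last by rewrite ler_pM2r.
have : (1 + e) ^+ 2 <= 1 + 3 * e by nra.
move=> /(ler_wpM2r (ltW r0)) h2; apply: le_lt_trans h2 _; nra.
Qed.

(* With [a = sqrt n], [sd = sqrt d] and [sl = sqrt (ln n)], a grid of mesh [n^-3] makes
   [eta] at most [a^-5], so that all discretization errors are below [e]. *)
Lemma lower_gap rho (q e a sd eta sK sl s t al be : R) : 0 < e -> e <= 16^-1 ->
  2^-1 <= q -> q <= 1 ->
  (1 + e) ^+ 2 * rho < ((1 - e) ^+ 2 * (1 - 3 * e)) ^+ 2 * q ->
  1 <= a -> 8 <= e * a -> 0 < sd -> sd <= a -> 1 <= sl ->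
  (sd ^+ 2) ^+ 2 <= rho * a ^+ 2 * sl ^+ 2 ->
  0 <= eta -> eta * a ^+ 5 <= 1 -> 0 <= sK -> sK <= 2 * a ->
  s = sd^-1 -> t = (1 - e) * sl ->
  al = t * s * (1 - eta) - eta * sK ->
  be = (1 - e) * a ^+ 2 * s * Num.sqrt q * (1 - eta) - a ^+ 2 * (eta * sK) ->
  [/\ eta < 1, 0 <= al & (1 + e) * a < al * be].
Proof.
move=> e0 e16 q2 q1 key a1 a8 sd0 sda sl1 hd eta0 eta5 sK0 sK2 sE tE alE beE.
have a0 : 0 < a by lra.
have q0 : 0 < q by lra.
have s0 : 0 < s by rewrite sE invr_gt0.
have sa : 1 <= s * a by rewrite sE mulrC ler_pdivlMr// mul1r.
have a4 k : 1 <= a ^+ k by rewrite exprn_ege1.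
have etaa : eta * a <= 1.
  by apply: le_trans eta5; rewrite ler_wpM2l// exprS ler_peMr ?(ltW a0).
have etae : 8 * eta <= e.
  have : eta * (e * a) <= e by rewrite mulrCA ler_piMr ?(ltW e0).
  by apply: le_trans; rewrite mulrC ler_wpM2l.
have eK : 4 * (eta * sK) <= e * s.
  have b1 : eta * sK <= eta * (2 * a) by rewrite ler_wpM2l.
  apply: (@le_trans _ _ (8 * (eta * a))); first by lra.
  rewrite -(ler_pM2r a0) -[e * s * a]mulrA.
  apply: (@le_trans _ _ e); last by rewrite -[leLHS]mulr1 ler_pM2l.
  rewrite -(ler_pM2r a0); apply: le_trans a8.
  have -> : 8 * (eta * a) * a * a = 8 * (eta * a ^+ 3) by ring.
  rewrite -[leRHS]mulr1 ler_pM2l//; apply: le_trans eta5.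
  by rewrite ler_wpM2l// ler_weXn2l.
clear etaa eta5 a8.
have t2 : 2^-1 <= t by rewrite tE; nra.
have al1 : t * s * (1 - e) <= al.
  have ts : 2^-1 * s <= t * s by rewrite ler_pM2r.
  have ets : e * (2^-1 * s) <= e * (t * s) by rewrite ler_pM2l.
  have ets' : 8 * eta * (t * s) <= e * (t * s) by rewrite ler_wpM2r// mulr_ge0 ?(ltW s0)//; lra.
  have ets0 : 0 <= e * (t * s) by rewrite mulr_ge0 ?(ltW e0)// mulr_ge0 ?(ltW s0)//; lra.
  rewrite alE; lra.
have kq : Num.sqrt q ^+ 2 = q by rewrite sqr_sqrtr// ltW.
have kp0 : 0 <= Num.sqrt q by exact: sqrtr_ge0.
have kp1 : 2^-1 <= Num.sqrt q by apply: le_from_sqr => //; rewrite kq; lra.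
have be1 : a ^+ 2 * (s * Num.sqrt q * (1 - 3 * e)) <= be.
  have -> : be = a ^+ 2 * (s * Num.sqrt q * ((1 - e) * (1 - eta)) - eta * sK).
    by rewrite beE; ring.
  rewrite ler_pM2l ?exprn_gt0// lerBrDr.
  have sk : 2^-1 * s <= s * Num.sqrt q by rewrite mulrC ler_pM2l.
  have esk : e * (2^-1 * s) <= e * (s * Num.sqrt q) by rewrite ler_pM2l.
  have es0 : 0 <= e * (s * Num.sqrt q) by rewrite mulr_ge0 ?(ltW e0)// mulr_ge0 ?(ltW s0).
  have b2 : 1 - 2 * e <= (1 - e) * (1 - eta) by nra.
  apply: (@le_trans _ _ (s * Num.sqrt q * (1 - 2 * e))); last first.
    by rewrite ler_wpM2l// mulr_ge0// (ltW s0).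
  lra.
have ts0 : 0 <= t * s * (1 - e) by rewrite mulr_ge0 ?mulr_ge0 ?(ltW s0)//; lra.
split; [by lra|exact: le_trans al1|].
apply: (@lt_le_trans _ _ (t * s * (1 - e) * (a ^+ 2 * (s * Num.sqrt q * (1 - 3 * e))))); last first.
  apply: ler_pM => //; rewrite mulr_ge0 ?sqr_ge0// mulr_ge0//; first by rewrite mulr_ge0// ltW.
  by lra.
(* What remains is (1 + e) d < c sqrt (q n log n) with c = (1 - e)^2 (1 - 3 e); its square is [key]
   combined with the bound on d^2. *)
have -> : t * s * (1 - e) * (a ^+ 2 * (s * Num.sqrt q * (1 - 3 * e))) =
   ((1 - e) ^+ 2 * (1 - 3 * e)) * (sl * Num.sqrt q * a) * a / sd ^+ 2.
  by rewrite tE sE; field; exact: lt0r_neq0.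
rewrite ltr_pdivlMr ?exprn_gt0// [ltLHS]mulrAC ltr_pM2r//.
apply: lt_from_sqr.
  rewrite mulr_ge0 ?mulr_ge0 ?sqr_ge0 ?(ltW a0)//; lra.
rewrite exprMn; apply: (@le_lt_trans _ _ ((1 + e) ^+ 2 * (rho * a ^+ 2 * sl ^+ 2))).
  by rewrite ler_wpM2l ?sqr_ge0.
have -> : ((1 - e) ^+ 2 * (1 - 3 * e) * (sl * Num.sqrt q * a)) ^+ 2 =
   ((1 - e) ^+ 2 * (1 - 3 * e)) ^+ 2 * Num.sqrt q ^+ 2 * (a ^+ 2 * sl ^+ 2) by ring.
have -> : (1 + e) ^+ 2 * (rho * a ^+ 2 * sl ^+ 2) = (1 + e) ^+ 2 * rho * (a ^+ 2 * sl ^+ 2) by ring.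
by rewrite kq ltr_pM2r// mulr_gt0// exprn_gt0//; lra.
Qed.

(** Here [a] is sqrt n and [L] is log n. The level (1 - e) sqrt L makes the exponent of [tail_all]
    at least of order n^(1/2 + e/4), while the logarithm of the net size is at most
    [4 * a * L ^+ 2]. The extra [L] leaves a probability of at most 1 / n. *)
Lemma tail_beats_net e L (pk a sl : R) : 0 < e -> e <= 16^-1 -> 0 < pk -> 4 <= L ->
  a = expR (L / 2) -> 1 <= a -> sl ^+ 2 = L -> 0 <= sl -> 2 / e <= sl ->
  (30 * 64) / (e ^+ 3 * pk) <= L ->
  4 * a * L ^+ 2 + L <= a ^+ 2 * (pk * expR (- ((1 - e) * sl + 1) ^+ 2 / 2)).
Proof.
move=> e0 e16 pk0 L4 aE a1 sl2 sl0 sle Lpk.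
have a0 : 0 < a by lra.
have L0 : 0 < L by lra.
have e3 : 0 < e ^+ 3 by rewrite exprn_gt0.
have cu : 5 * L ^+ 2 <= pk * expR (e * L / 4).
  have x0 : 0 <= e * L / 4 by rewrite divr_ge0// mulr_ge0 ?(ltW e0) ?(ltW L0).
  have := ler_wpM2l (ltW pk0) (expR_ge_cube x0).
  have -> : (e * L / 4) ^+ 3 / 6 = e ^+ 3 * L ^+ 3 / (6 * 64) by field.
  apply: le_trans.
  have : 30 * 64 <= L * (e ^+ 3 * pk) by rewrite -ler_pdivrMr// mulr_gt0.
  move=> /(ler_wpM2r (sqr_ge0 L)).
  have -> : pk * (e ^+ 3 * L ^+ 3 / (6 * 64)) = L * (e ^+ 3 * pk) * L ^+ 2 / (6 * 64) by ring.
  clear; lra.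
clear Lpk.
have tt : ((1 - e) * sl + 1) ^+ 2 <= (1 - e / 2) * L.
  have u : (1 - e) * sl + 1 <= (1 - e / 2) * sl.
    by move: sle; rewrite ler_pdivrMr//; lra.
  apply: (@le_trans _ _ (((1 - e / 2) * sl) ^+ 2)).
    have v : 0 <= (1 - e) * sl + 1 by rewrite addr_ge0// mulr_ge0//; lra.
    by rewrite lerXn2r// nnegrE// (le_trans v).
  rewrite exprMn sl2 ler_pM2r//; nra.
have ex : a * expR (e * L / 4) <= a ^+ 2 * expR (- ((1 - e) * sl + 1) ^+ 2 / 2).
  rewrite [a ^+ 2]expr2 -[leRHS]mulrA ler_pM2l// aE -expRD ler_expR; lra.
rewrite [leRHS]mulrCA; apply: (@le_trans _ _ (pk * (a * expR (e * L / 4)))); last by rewrite ler_pM2l.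
rewrite [leRHS]mulrCA; apply: (@le_trans _ _ (a * (5 * L ^+ 2))); last by rewrite ler_pM2l.
have Lsq : L <= a * L ^+ 2.
  by rewrite expr2 mulrA ler_peMl ?(ltW L0)//; nra.
lra.
Qed.

(** The exponent of [abs_sum_lower] is linear in n, so that a power sqrt n is to spare against the
    net; the cubic lower bound of [expR (L / 2)] is enough. *)
Lemma chernoff_beats_net e L (q a : R) : 0 < e -> 0 < q -> 4 <= L ->
  a = expR (L / 2) -> 1 <= a -> (5 * 48 * 24) / (e ^+ 2 * q) <= L ->
  4 * a * L ^+ 2 + L <= a ^+ 2 * e ^+ 2 * q / 24.
Proof.
move=> e0 q0 L4 aE a1 Lq.
have a0 : 0 < a by lra.
have L0 : 0 < L by lra.
have e2 : 0 < e ^+ 2 by rewrite exprn_gt0.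
have w' : 5 * L ^+ 2 <= a * (e ^+ 2 * q) / 24.
  have x0 : 0 <= L / 2 by rewrite divr_ge0// (ltW L0).
  have := expR_ge_cube x0; rewrite -aE (_ : (L / 2) ^+ 3 / 6 = L ^+ 3 / 48); last by field.
  move=> /(ler_wpM2r (ltW (mulr_gt0 e2 q0))).
  have : 5 * 48 * 24 <= L * (e ^+ 2 * q) by rewrite -ler_pdivrMr// mulr_gt0.
  move=> /(ler_wpM2r (sqr_ge0 L)).
  have -> : L ^+ 3 / 48 * (e ^+ 2 * q) = L * (e ^+ 2 * q) * L ^+ 2 / 48 by ring.
  clear; lra.
have Lsq : L <= a * L ^+ 2.
  by rewrite expr2 mulrA ler_peMl ?(ltW L0)//; nra.
have : a * (5 * L ^+ 2) <= a * (a * (e ^+ 2 * q) / 24) by rewrite ler_pM2l.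
rewrite (_ : a ^+ 2 * e ^+ 2 * q / 24 = a * (a * (e ^+ 2 * q) / 24)); last by ring.
lra.
Qed.

Lemma lower_eps rho eps : 0 < rho -> rho < 2 / pi -> 0 < eps ->
  exists N : nat, forall n d, (N <= n)%N -> (N <= d)%N ->
    d%:R ^+ 2 <= rho * n%:R * ln n%:R -> (probPR R n d <= eps%:E)%E.
Proof.
move=> r0 rq eps0; have [e [e0 e16 key]] := lower_param r0 rq.
have pi2 := @pi_ge2 R.
have pi4 : pi <= 4 :> R by have := @pihalf_lt2 R; lra.
set q := 2 / pi in rq key.
have pi0 : 0 < pi :> R by exact: pi_gt0.
have q1 : q <= 1 by rewrite ler_pdivrMr//; lra.
have q2 : 2^-1 <= q by rewrite ler_pdivlMr//; lra.
have q0 : 0 < q by lra.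
pose pk := normal_peak (1 : R).
have pk0 : 0 < pk by rewrite normal_peak_gt0// oner_neq0.
have e2 : 0 < e ^+ 2 by rewrite exprn_gt0.
have [N1 HN1] := ln_nat_large (Num.max 4 (Num.max (4 / eps) (Num.max ((2 / e) ^+ 2)
   (Num.max ((30 * 64) / (e ^+ 3 * pk)) (Num.max ((5 * 48 * 24) / (e ^+ 2 * q)) (16 / e)))))).
(* A separate threshold for [d], because the bound for the Gram matrix is only exponentially small
   in [d]. *)
pose N2 := (Num.truncn (48 / (e ^+ 2 * eps))).+1.
exists (maxn N1 N2) => n d; rewrite !geq_max => /andP[/HN1[n0 HL] _] /andP[_ dN] hd.
move: HL hd; set L := ln _; rewrite !ge_max => /and5P[L4 Leps Le Lpk /andP[Lq Le16]] hd.
have nE : n%:R = expR L :> R by rewrite lnK// posrE ltr0n.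
have L0 : 0 < L by exact: lt_le_trans L4.
have nR : 0 < n%:R :> R by rewrite ltr0n.
have d48 : 48 / (e ^+ 2 * eps) <= d%:R.
  have /andP[_ /ltW lt] := @Num.Theory.truncn_itv R (48 / (e ^+ 2 * eps)) (ltW (divr_gt0 (ltr0n _ 48) (mulr_gt0 e2 eps0))).
  by apply: le_trans lt _; rewrite ler_nat.
have dR : 0 < d%:R :> R by apply: lt_le_trans d48; rewrite divr_gt0// mulr_gt0.
have d0 : (0 < d)%N by rewrite -(ltr0n R).
pose a : R := expR (L / 2).
have a0 : 0 < a by exact: expR_gt0.
have aa : a ^+ 2 = n%:R.
  by rewrite nE /a -expRM_natl; congr expR; clear; lra.
have La : 1 + L / 2 <= a by exact: expR_ge1Dx.
have a1 : 1 <= a by move: La L4; clear; lra.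
have a8 : 8 <= e * a.
  rewrite mulrC -ler_pdivrMr//; apply: le_trans La.
  by move: Le16; rewrite !ler_pdivrMr//; move: e0; clear; lra.
have slE : Num.sqrt L ^+ 2 = L by rewrite sqr_sqrtr// ltW.
have sle : 2 / e <= Num.sqrt L.
  by apply: le_from_sqr; [exact: sqrtr_ge0|rewrite slE].
have T1 := tail_beats_net e0 e16 pk0 L4 erefl a1 slE (sqrtr_ge0 _) sle Lpk.
have T2 := chernoff_beats_net e0 q0 L4 erefl a1 Lq.
clear Lpk Lq Le Le16.
rewrite -/a aa in T1 T2.
have nL : L <= n%:R.
  by rewrite nE; apply: le_trans (expR_ge1Dx L); clear; lra.
have n4 : 4 <= n%:R :> R by exact: le_trans nL.
have n4N : (4 <= n)%N by rewrite -(ler_nat R).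
have rho1 : rho <= 1 by exact: le_trans (ltW rq) q1.
have d2nL : d%:R ^+ 2 <= n%:R * L.
  apply: le_trans hd _; rewrite -mulrA ler_piMl//.
  by rewrite mulr_ge0 ?ler0n// ltW.
have dn : d%:R <= n%:R :> R.
  apply: le_from_sqr; first exact: ler0n.
  apply: le_trans d2nL _.
  by rewrite expr2 ler_pM2l.
have L1 : 1 <= L by apply: le_trans L4; clear; lra.
have daL : d%:R <= a * L.
  apply: le_from_sqr; first by rewrite mulr_ge0 ?(ltW a0) ?(ltW L0).
  by apply: le_trans d2nL _; rewrite exprMn aa ler_pM2l// expr2 ler_peMl ?(ltW L0).
pose m := (n ^ 3)%N.
have m0 : (0 < m)%N by rewrite expn_gt0 n0.
have mE : m%:R = a ^+ 6 :> R by rewrite natrX -aa -exprM.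
have sd0 : 0 < Num.sqrt (d%:R : R) by rewrite sqrtr_gt0.
have sd2 : Num.sqrt (d%:R : R) ^+ 2 = d%:R by rewrite sqr_sqrtr// ler0n.
have sda : Num.sqrt (d%:R : R) <= a.
  by apply: le_from_sqr; [exact: ltW|rewrite sd2 aa].
have sl1 : 1 <= Num.sqrt L by rewrite -[leLHS]sqrtr1 ler_wsqrtr.
have t0 : 0 <= (1 - e) * Num.sqrt L.
  by rewrite mulr_ge0 ?sqrtr_ge0//; move: e16; clear; lra.
have hd' : (Num.sqrt (d%:R : R) ^+ 2) ^+ 2 <= rho * a ^+ 2 * Num.sqrt L ^+ 2.
  by rewrite sd2 aa slE.
set eta := Num.sqrt d%:R / m%:R : R.
have eta0 : 0 <= eta by rewrite divr_ge0 ?ler0n ?sqrtr_ge0.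
have eta5 : eta * a ^+ 5 <= 1.
  rewrite /eta mE mulrAC ler_pdivrMr ?exprn_gt0// mul1r [leRHS]exprS.
  by rewrite ler_pM2r// exprn_gt0.
set K := (1 + e) * n%:R.
have sK : Num.sqrt K <= 2 * a.
  apply: le_from_sqr; first by rewrite mulr_ge0 ?(ltW a0).
  rewrite sqr_sqrtr; last by rewrite mulr_ge0 ?ler0n//; move: e0; clear; lra.
  by rewrite exprMn aa /K ler_pM2r//; move: e16; clear; lra.
have [eta1 al0 gab] := lower_gap e0 e16 q2 q1 key a1 a8 sd0 sda sl1 hd' eta0 eta5 (sqrtr_ge0 K) sK erefl erefl erefl erefl.
have n1 : (1 < n)%N by exact: leq_trans n4N.
have e1 : e <= 2^-1 by apply: le_trans e16 _; clear; lra.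
have sE : (Num.sqrt (d%:R : R))^-1 = Num.sqrt (d%:R)^-1 by rewrite sqrtrV// ler0n.
have aE : a = Num.sqrt n%:R by rewrite -aa sqrtr_sqr ger0_norm// ltW.
rewrite sE in al0 gab; rewrite {1}aE aa in gab.
have LB := @lower_bound R n d d0 n1 m e ((1 - e) * Num.sqrt L) m0 e0 e1 t0 eta1 al0 gab.
apply: le_trans LB _; rewrite lee_fin -/pk -/q.
(* With [m = n ^ 3] and [n >= 4], each coordinate takes [2 * m + 1 <= n ^ 4] values, and [d] is at
   most sqrt n times log n. *)
have G : (2 * m).+1%:R ^+ d <= expR (4 * a * L ^+ 2).
  apply: (@le_trans _ _ (expR (4 * L) ^+ d)).
    rewrite lerXn2r ?nnegrE ?expR_ge0 ?ler0n//.
    rewrite expRM_natl -nE -natrX ler_nat /m.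
    have : (n ^ 4 = n * n ^ 3)%N by rewrite expnS.
    have : (0 < n ^ 3)%N by rewrite expn_gt0 n0.
    move: n4N; clear; nia.
  rewrite -expRM_natl ler_expR.
  have : d%:R * L <= a * L * L by rewrite ler_pM2r.
  rewrite expr2; clear; lra.
have GE X : 4 * a * L ^+ 2 + L <= X -> (2 * m).+1%:R ^+ d * expR (- X) <= expR (- L).
  move=> TX; apply: (@le_trans _ _ (expR (4 * a * L ^+ 2) * expR (- X))).
    by rewrite ler_wpM2r// expR_ge0.
  by rewrite -expRD ler_expR; move: TX; clear; lra.
have := GE _ T1; have := GE _ T2; rewrite mulrDr.
(* The budget: [eps / 4] for each of the two nets, and [eps / 6] for each of the two energy events
   and the Gram event. *)
have Z1 : expR (- L) <= eps / 4.
  apply: le_trans (expRN_le_inv L0) _; rewrite -[leLHS]mul1r ler_pdivrMr//.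
  by move: Leps; rewrite ler_pdivrMr//; clear; lra.
have Z2 : expR (- (d%:R * e ^+ 2 / 8)) <= eps / 6.
  have x0 : 0 < d%:R * e ^+ 2 / 8 by rewrite divr_gt0// mulr_gt0.
  apply: le_trans (expRN_le_inv x0) _; rewrite -[leLHS]mul1r ler_pdivrMr//.
  by move: d48; rewrite ler_pdivrMr ?mulr_gt0//; clear; lra.
have Z3 : expR (- (n%:R * d%:R * e ^+ 2 / 8)) <= expR (- (d%:R * e ^+ 2 / 8)).
  rewrite ler_expR lerN2 -!mulrA ler_peMl//.
    by rewrite mulr_ge0 ?ler0n// mulr_ge0 ?(ltW e0)// divr_ge0 ?(ltW e0).
  by apply: le_trans n4; clear; lra.
move: Z1 Z2 Z3; clear; lra.
Qed.

End asymptotics.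

(** * Limits along sequences *)

Lemma ereal_cvg_real (R : realType) (f : nat -> \bar R) (l : R) :
  (forall k, f k \is a fin_num) ->
  (forall eps : R, 0 < eps -> \forall k \near \oo, ((l - eps)%:E <= f k <= (l + eps)%:E)%E) ->
  f @ \oo --> l%:E.
Proof.
move=> ff H; apply/fine_cvgP; split; first exact: nearW.
apply/cvgrPdist_le => eps /H; apply: filterS => k.
rewrite -{1 2}(fineK (ff k)) !lee_fin => /andP[h1 h2] /=.
by rewrite distrC ler_norml; lra.
Qed.

Lemma probPR_fin_num (R : realType) n d : probPR R n d \is a fin_num.
Proof.
rewrite fin_real//; apply/andP; split.
  by apply: lt_le_trans (probPR_ge0 R n d); exact: ltNyr.
by apply: le_lt_trans (probPR_le1 R n d) _; exact: ltry.
Qed.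

Lemma upper_regime_gt8 (R : realType) (rho : R) : 8 < rho -> upper_regime rho.
Proof.
move=> r8 nn dd nny ddy H; apply: ereal_cvg_real => [k|eps eps0].
  exact: probPR_fin_num.
have [N HN] := upper_eps r8 eps0.
move/cvgnyPge : nny => /(_ N); apply: filterS => k Nk.
rewrite HN//=.
by apply: le_trans (probPR_le1 R _ _) _; rewrite lee_fin; lra.
Qed.

Lemma lower_regime_lt (R : realType) (rho : R) : 0 < rho -> rho < 2 / pi -> lower_regime rho.
Proof.
move=> r0 rq nn dd nny ddy H; apply: ereal_cvg_real => [k|eps eps0].
  exact: probPR_fin_num.
have [N HN] := lower_eps r0 rq eps0.
move/cvgnyPge : nny => /(_ N) nN; move/cvgnyPge : ddy => /(_ N) dN.
near=> k; rewrite !add0r HN ?andbT.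
- by apply: le_trans (probPR_ge0 R _ _); rewrite lee_fin oppr_le0 ltW.
- by near: k.
- by near: k.
- exact: H.
Unshelve. all: by end_near. Qed.

Theorem theorem2p1 (R : realType) :
  (exists rho1 rho2 : R, 0 < rho2 < rho1 /\
     upper_regime rho1 /\ lower_regime rho2) /\
  (forall rho1 : R, 8 < rho1 -> upper_regime rho1) /\
  (forall rho2 : R, 0 < rho2 -> rho2 < 2 / pi -> lower_regime rho2).
Proof.
have pi0 := @pi_gt0 R.
split; last by split; [exact: upper_regime_gt8|exact: lower_regime_lt].
exists 9, (1 / pi).
have pi_inv : 0 < 1 / pi :> R by rewrite divr_gt0.
split; last split.
- rewrite pi_inv /= ltr_pdivrMr//; have := @pi_ge2 R; lra.
- by apply: upper_regime_gt8; lra.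
- by apply: lower_regime_lt => //; rewrite ltr_pM2r ?invr_gt0//; lra.
Qed.
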